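(* Let $\mu\in\mathbb{C}$ with $\operatorname{Re}\mu<1/2$, and let $a=\{a_n\}_{n\in\mathbb{N}}$ be a complex sequence with $\sum_{n=1}^\infty |a_n|<\infty$. Then for every $n\in\mathbb{N}$, $$a_n=\frac{n}{\pi}\sinh(\pi n)\,\Gamma\!\left(\tfrac12+in-\mu\right)\Gamma\!\left(\tfrac12-in-\mu\right)\int_1^\infty P^\mu_{in-1/2}(x,\pi)\sum_{m=1}^\infty a_m P^\mu_{im-1/2}(x)\,dx,$$ where the iterated series and integral converge absolutely.
   Context: $\Gamma$ is Euler's gamma function and $i$ the imaginary unit. For $x>1$, $P^\mu_\nu(x)$ is the associated Legendre function (of the first kind), i.e. the analytic continuation to $x>1$ of $P^\mu_\nu(z)=\frac{1}{\Gamma(1-\mu)}\left(\frac{z+1}{z-1}\right)^{\mu/2}{}_2F_1\!\left(-\nu,1+\nu;1-\mu;\frac{1-z}{2}\right)$ ($|1-z|<2$), ${}_2F_1$ the Gauss hypergeometric function; equivalently, for $\operatorname{Re}\mu<1/2$ and $x=\cosh\alpha$, $\alpha>0$, $P^\mu_\nu(\cosh\alpha)=\sqrt{2/\pi}\,\frac{(\sinh\alpha)^\mu}{\Gamma(1/2-\mu)}\int_0^\alpha\frac{\cosh(t(\nu+1/2))}{(\cosh\alpha-\cosh t)^{1/2+\mu}}dt$. The incomplete Legendre integral is defined for $z>1$, $\omega>0$ by $$P^\mu_\nu(z,\omega)=\sqrt{\tfrac{2}{\pi}}\,\frac{\Gamma(1/2-\mu)(z^2-1)^{-\mu/2}}{\Gamma(1+\nu-\mu)\Gamma(-\nu-\mu)}\int_0^\omega\frac{\cosh(t(\nu+1/2))}{(\cosh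 t+z)^{1/2-\mu}}\,dt,$$ with powers of positive numbers taken with principal values; here it is used with $\nu=in-1/2$, $\omega=\pi$. *)

(* Defs.v *)
From Stdlib Require Import Reals.
From Coquelicot Require Import Coquelicot Complex.
Open Scope R_scope.

Definition cexp (z : C) : C :=
  (exp (Re z) * cos (Im z), exp (Re z) * sin (Im z)).

Definition ccosh (z : C) : C := ((cexp z + cexp (- z)) / 2)%C.

Definition cpow (x : R) (z : C) : C := cexp (z * RtoC (ln x))%C.

Definition CInt (f : R -> C) (a b : R) : C :=
  (RInt (fun t => Re (f t)) a b, RInt (fun t => Im (f t)) a b).

Definition CInt_gen (f : R -> C) (Fa Fb : (R -> Prop) -> Prop) : C :=
  (RInt_gen (fun t => Re (f t)) Fa Fb, RInt_gen (fun t => Im (f t)) Fa Fb).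

Definition CSeries (u : nat -> C) : C :=
  (Series (fun k => Re (u k)), Series (fun k => Im (u k))).

(* Euler's Gamma function, via Euler's integral (valid for Re z > 0,
   which is the only range in which it is used below) *)
Definition Gamma (z : C) : C :=
  CInt_gen (fun t => (cpow t (z - 1) * RtoC (exp (- t)))%C)
           (at_right 0) (Rbar_locally p_infty).

Definition arcosh (x : R) : R := ln (x + sqrt (x ^ 2 - 1)).

(* Associated Legendre function P^mu_nu(x), x > 1, Re mu < 1/2, via
   P^mu_nu(cosh a) = sqrt(2/pi) (sinh a)^mu / Gamma(1/2-mu)
                     * int_0^a cosh(t(nu+1/2)) (cosh a - cosh t)^(-1/2-mu) dt *)
Definition LegendreP (mu nu : C) (x : R) : C :=
  let a := arcosh x in
  (RtoC (sqrt (2 / PI)) * cpow (sinh a) mu / Gamma (RtoC (1/2) - mu) *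
   CInt_gen (fun t => ccosh (RtoC t * (nu + RtoC (1/2))) *
                      cpow (cosh a - cosh t) (- RtoC (1/2) - mu))
            (at_point 0) (at_left a))%C.

Definition LegendreP_inc (mu nu : C) (z omega : R) : C :=
  (RtoC (sqrt (2 / PI)) * Gamma (RtoC (1/2) - mu) * cpow (z ^ 2 - 1) (- mu / 2)
   / (Gamma (1 + nu - mu) * Gamma (- nu - mu)) *
   CInt (fun t => ccosh (RtoC t * (nu + RtoC (1/2))) *
                  cpow (cosh t + z) (mu - RtoC (1/2))) 0 omega)%C.

Definition nuc (n : nat) : C := (- (1/2), INR n).

(* Main.v *)
Require Import Defs.
From Stdlib Require Import Reals Lra Lia.
From Coquelicot Require Import Coquelicot Complex.
Open Scope R_scope.

(** With [b = 1/2 - mu], the Gamma factors and the powers of [x^2 - 1] cancel, and the formula reduces to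
    [int_1^oo G_n F_m dx = delta_{nm} PI^2 / (2 n sinh (n PI))], where
    [F_m x = int_0^(arcosh x) cos (m s) (x - cosh s)^(b-1) ds] and
    [G_n x = int_0^PI cos (n t) (cosh t + x)^(-b) dt].

    Since [int_0^PI cos (n t) dt = 0], an integration by parts in [t] gives
    [n G_n x = b int_0^PI sin (n t) sinh t (cosh t + x)^(-b-1) dt = O (x^(-Re b - 1))], so that the
    [x]-integral converges absolutely, uniformly in [m]. To avoid the singularity of [F_m], integrate by
    parts in [x] against [M_m x = int cos (m s) (x - cosh s)_+^b ds], for which [M_m' = b F_m]. Fubini's
    theorem then leaves the elementary integral
    [(b+1) int (x - cosh s)_+^b (cosh t + x)^(-b-2) dx = 1 / (cosh s + cosh t)], and
    [int_0^oo cos (m s) sinh t / (cosh s + cosh t) ds = PI sin (m t) / sinh (m PI)] reduces the claim to the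
    orthogonality of the sines. This last integral follows from Green's identity, because
    [sinh t / (cosh s + cosh t)] solves the wave equation and its rotation
    [sin t / (cosh s + cos t)] is harmonic and concentrates at [s = 0] when [t] tends to [PI].

    Cancelling Gamma factors requires [Gamma z <> 0] for [Re z > 0]; by the functional equation it
    suffices to prove this for large [Re z], where the integrand concentrates. *)

(** * Componentwise calculus of complex-valued functions *)

(** For [0 < Re b < 1] the integrand of [F_m] is unbounded at the moving endpoint [arcosh x], so
    [F_m] is no parameter integral with a continuous integrand. An integration by parts in [s] turns
    it into an integral of [(x - cosh s)_+^b] divided by [b (x^2 - 1)]. Powers extended by zero are
    continuous when the exponent has positive real part, so integrals are exchanged on fixed
    rectangles, where Fubini for continuous functions suffices. The same rewriting with [b + 1] for
    [b] gives [M_m] an integrand that can be differentiated under the integral sign.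

    Dominated convergence is replaced by explicit primitives: an improper integral converges once
    its integrand is bounded by a [g] whose primitive has limits at both ends. Since [|F_m|] is at
    most [F_0] taken with the exponent [Re b], one [g] serves all [m], and integrating the series
    term by term costs only a tail of the sum of [|a_m|]. Complex integrals are pairs of real ones;
    moduli are bounded by pairing with the conjugate of the value. *)

Definition clim {T : Type} (f : T -> C) (F : (T -> Prop) -> Prop) (l : C) :=
  filterlim (fun x => Re (f x)) F (locally (Re l)) /\
  filterlim (fun x => Im (f x)) F (locally (Im l)).

Definition ccont {T : UniformSpace} (f : T -> C) (x : T) :=
  continuous (fun t => Re (f t)) x /\ continuous (fun t => Im (f t)) x.

Definition cder (f : R -> C) (x : R) (l : C) :=
  is_derive (fun t => Re (f t)) x (Re l) /\ is_derive (fun t => Im (f t)) x (Im l).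

Ltac unfold_ball :=
  unfold ball in *; simpl in *; unfold AbsRing_ball, abs, minus, plus, opp in *; simpl in *.
Ltac unfold_ball_in H :=
  unfold ball in H; simpl in H; unfold AbsRing_ball, abs, minus, plus, opp in H; simpl in H.

Lemma C_ext (z w : C) : Re z = Re w -> Im z = Im w -> z = w.
Proof. destruct z, w; simpl; intros; subst; reflexivity. Qed.

Lemma Im_le_Cmod (z : C) : Rabs (Im z) <= Cmod z.
Proof. eapply Rle_trans; [|apply Rmax_Cmod]. apply Rmax_r. Qed.

Lemma Cmod_le_Re_Im (z : C) : Cmod z <= Rabs (Re z) + Rabs (Im z).
Proof.
  unfold Cmod. destruct z as [u v]; simpl.
  pose proof (Rabs_pos u). pose proof (Rabs_pos v).
  rewrite <- (sqrt_Rsqr (Rabs u + Rabs v)) by lra. apply sqrt_le_1_alt. unfold Rsqr.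
  assert (Rabs u * Rabs u = u * u) by (rewrite <- Rabs_mult; apply Rabs_pos_eq; nra).
  assert (Rabs v * Rabs v = v * v) by (rewrite <- Rabs_mult; apply Rabs_pos_eq; nra).
  nra.
Qed.

Section Limits.
Context {T : Type} {F : (T -> Prop) -> Prop} {FF : Filter F}.
Implicit Types f g : T -> C.

Lemma flim_plus (f g : T -> R) (a b : R) :
  filterlim f F (locally a) -> filterlim g F (locally b) ->
  filterlim (fun x => f x + g x) F (locally (a + b)).
Proof. intros Hf Hg. apply (filterlim_comp_2 f g Rplus Hf Hg). apply (filterlim_plus a b). Qed.

Lemma flim_mult (f g : T -> R) (a b : R) :
  filterlim f F (locally a) -> filterlim g F (locally b) ->
  filterlim (fun x => f x * g x) F (locally (a * b)).
Proof. intros Hf Hg. apply (filterlim_comp_2 f g Rmult Hf Hg). apply (filterlim_mult a b). Qed.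

Lemma flim_opp (f : T -> R) (a : R) :
  filterlim f F (locally a) -> filterlim (fun x => - f x) F (locally (- a)).
Proof. intros Hf. eapply filterlim_comp; [exact Hf|]. apply (filterlim_opp a). Qed.

Lemma flim_minus (f g : T -> R) (a b : R) :
  filterlim f F (locally a) -> filterlim g F (locally b) ->
  filterlim (fun x => f x - g x) F (locally (a - b)).
Proof. intros Hf Hg. apply flim_plus; [exact Hf|]. now apply flim_opp. Qed.

Lemma clim_const (c : C) : clim (fun _ : T => c) F c.
Proof. split; apply filterlim_const. Qed.

Lemma clim_plus f g l k : clim f F l -> clim g F k -> clim (fun x => f x + g x)%C F (l + k)%C.
Proof. intros [H1 H2] [H3 H4]; split; simpl; now apply flim_plus. Qed.

Lemma clim_opp f l : clim f F l -> clim (fun x => - f x)%C F (- l)%C.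
Proof. intros [H1 H2]; split; simpl; now apply flim_opp. Qed.

Lemma clim_minus f g l k : clim f F l -> clim g F k -> clim (fun x => f x - g x)%C F (l - k)%C.
Proof. intros H1 H2. apply clim_plus; [exact H1|]. now apply clim_opp. Qed.

Lemma clim_mult f g l k : clim f F l -> clim g F k -> clim (fun x => f x * g x)%C F (l * k)%C.
Proof.
  intros [H1 H2] [H3 H4]; split.
  - apply flim_minus; now apply flim_mult.
  - apply flim_plus; now apply flim_mult.
Qed.

Lemma clim_RtoC (f : T -> R) (a : R) :
  filterlim f F (locally a) -> clim (fun x => RtoC (f x)) F (RtoC a).
Proof. intros H; split; [exact H | apply filterlim_const]. Qed.

Lemma clim_ext_loc f g l : F (fun x => f x = g x) -> clim f F l -> clim g F l.
Proof.
  intros H [H1 H2]; split; eapply filterlim_ext_loc; try eassumption;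
  (eapply filter_imp; [|exact H]); intros x Hx; simpl; now rewrite Hx.
Qed.

Lemma clim_eq f l k : clim f F l -> l = k -> clim f F k.
Proof. intros; now subst. Qed.

Lemma flim_squeeze (f : T -> R) (g : T -> R) (l : R) :
  F (fun x => Rabs (f x - l) <= g x) -> filterlim g F (locally 0) ->
  filterlim f F (locally l).
Proof.
  intros H Hg. apply filterlim_locally. intros eps.
  pose proof (proj1 (filterlim_locally g 0) Hg eps) as He.
  generalize (filter_and _ _ H He). apply filter_imp. intros x [H1 H2].
  unfold_ball.
  pose proof (Rle_abs (g x + - 0)). unfold Rminus in H1. lra.
Qed.

Lemma clim_squeeze f (g : T -> R) l :
  F (fun x => Cmod (f x - l)%C <= g x) -> filterlim g F (locally 0) -> clim f F l.
Proof.
  intros H Hg; split; eapply flim_squeeze; try exact Hg;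
  (eapply filter_imp; [|exact H]); intros x Hx; simpl; eapply Rle_trans; try exact Hx.
  - apply (re_le_Cmod (f x - l)%C).
  - apply (Im_le_Cmod (f x - l)%C).
Qed.

Lemma clim_Cmod f l : clim f F l -> filterlim (fun x => Cmod (f x)) F (locally (Cmod l)).
Proof.
  intros [H1 H2].
  apply flim_squeeze with (g := fun x => Rabs (Re (f x) - Re l) + Rabs (Im (f x) - Im l)).
  - apply filter_forall. intros x.
    assert (Rabs (Cmod (f x) - Cmod l) <= Cmod (f x - l)%C).
    { apply Rabs_le. split.
      - assert (Cmod l <= Cmod (f x) + Cmod (f x - l)%C); [|lra].
        replace l with (f x + - (f x - l))%C at 1 by ring.
        eapply Rle_trans; [apply Cmod_triangle|]. rewrite Cmod_opp. lra.
      - assert (Cmod (f x) <= Cmod l + Cmod (f x - l)%C); [|lra].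
        replace (f x) with (l + (f x - l))%C at 1 by ring.
        apply Cmod_triangle. }
    eapply Rle_trans; [exact H|]. apply (Cmod_le_Re_Im (f x - l)%C).
  - assert (HA : forall (u : T -> R) a, filterlim u F (locally a) ->
               filterlim (fun x => Rabs (u x - a)) F (locally 0)).
    { intros u a Hu. replace 0 with (Rabs (a - a)) by (rewrite Rminus_diag; apply Rabs_R0).
      eapply filterlim_comp; [apply flim_minus; [exact Hu|apply filterlim_const]|].
      apply (continuous_Rabs (a - a)). }
    rewrite <- (Rplus_0_r 0). apply flim_plus; now apply HA.
Qed.

End Limits.

Lemma clim_comp {T U : Type} (F : (T -> Prop) -> Prop) (G : (U -> Prop) -> Prop)
  (u : T -> U) (f : U -> C) l : filterlim u F G -> clim f G l -> clim (fun x => f (u x)) F l.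
Proof.
  intros Hu [H1 H2]; split.
  - exact (filterlim_comp _ _ _ u (fun x => Re (f x)) _ _ _ Hu H1).
  - exact (filterlim_comp _ _ _ u (fun x => Im (f x)) _ _ _ Hu H2).
Qed.

Lemma ccont_clim {T : UniformSpace} (f : T -> C) x : ccont f x <-> clim f (locally x) (f x).
Proof. split; exact (fun H => H). Qed.

Lemma ccont_at_left f (x : R) : ccont f x -> clim f (at_left x) (f x).
Proof.
  intros [H1 H2]; split.
  - exact (filterlim_filter_le_1 _ (@filter_le_within _ (locally x) _ _) H1).
  - exact (filterlim_filter_le_1 _ (@filter_le_within _ (locally x) _ _) H2).
Qed.

Lemma ccont_at_right f (x : R) : ccont f x -> clim f (at_right x) (f x).
Proof.
  intros [H1 H2]; split.
  - exact (filterlim_filter_le_1 _ (@filter_le_within _ (locally x) _ _) H1).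
  - exact (filterlim_filter_le_1 _ (@filter_le_within _ (locally x) _ _) H2).
Qed.

Section Continuity.
Context {T : UniformSpace}.
Implicit Types (f g : T -> C) (x : T).

Lemma ccont_const (c : C) x : ccont (fun _ => c) x.
Proof. apply ccont_clim, clim_const. Qed.
Lemma ccont_plus f g x : ccont f x -> ccont g x -> ccont (fun t => f t + g t)%C x.
Proof. apply (clim_plus (F := locally x)). Qed.
Lemma ccont_minus f g x : ccont f x -> ccont g x -> ccont (fun t => f t - g t)%C x.
Proof. apply (clim_minus (F := locally x)). Qed.
Lemma ccont_opp f x : ccont f x -> ccont (fun t => - f t)%C x.
Proof. apply (clim_opp (F := locally x)). Qed.
Lemma ccont_mult f g x : ccont f x -> ccont g x -> ccont (fun t => f t * g t)%C x.
Proof. apply (clim_mult (F := locally x)). Qed.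
Lemma ccont_RtoC (f : T -> R) x : continuous f x -> ccont (fun t => RtoC (f t)) x.
Proof. apply (clim_RtoC (F := locally x)). Qed.
Lemma ccont_Cmod f x : ccont f x -> continuous (fun t => Cmod (f t)) x.
Proof. apply (clim_Cmod (F := locally x)). Qed.
Lemma ccont_ext_loc f g x : locally x (fun t => f t = g t) -> ccont f x -> ccont g x.
Proof.
  intros H Hf. apply ccont_clim. rewrite <- (locally_singleton _ _ H).
  eapply clim_ext_loc; [exact H|exact Hf].
Qed.
Lemma ccont_ext f g x : (forall t, f t = g t) -> ccont f x -> ccont g x.
Proof. intros H; apply ccont_ext_loc. now apply filter_forall. Qed.
End Continuity.

Lemma ccont_comp {T U : UniformSpace} (u : T -> U) (f : U -> C) (x : T) :
  continuous u x -> ccont f (u x) -> ccont (fun t => f (u t)) x.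
Proof. apply (clim_comp (locally x) (locally (u x))). Qed.

Lemma continuous_pair {S T U : UniformSpace} (f : S -> T) (g : S -> U) (x : S) :
  continuous f x -> continuous g x ->
  continuous (fun t => (f t, g t)) x.
Proof.
  intros Hf Hg. apply filterlim_locally. intros eps.
  generalize (filter_and _ _ (proj1 (filterlim_locally f _) Hf eps)
                (proj1 (filterlim_locally g _) Hg eps)).
  apply filter_imp. intros t [H1 H2]. split; assumption.
Qed.

Lemma continuous_2d_swap_fst {U : UniformSpace} (f : R * R -> U) (x y : R) :
  continuous f (x, y) -> continuous (fun s => f (s, y)) x.
Proof.
  intros H. apply (continuous_comp (fun s => (s, y)) f x); [|exact H].
  apply continuous_pair; [apply continuous_id | apply continuous_const].
Qed.
Lemma continuous_2d_swap_snd {U : UniformSpace} (f : R * R -> U) (x y : R) :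
  continuous f (x, y) -> continuous (fun s => f (x, s)) y.
Proof.
  intros H. apply (continuous_comp (fun s => (x, s)) f y); [|exact H].
  apply continuous_pair; [apply continuous_const | apply continuous_id].
Qed.

Section Derivatives.
Implicit Types (f g : R -> C) (x : R).

Lemma cder_const (c : C) x : cder (fun _ => c) x 0%C.
Proof. split; apply (is_derive_const (K := R_AbsRing) (V := R_NormedModule)). Qed.
Lemma cder_plus f g x l k : cder f x l -> cder g x k -> cder (fun t => f t + g t)%C x (l + k)%C.
Proof. intros [H1 H2] [H3 H4]; split; simpl.
  - apply (is_derive_plus (fun t => Re (f t)) (fun t => Re (g t)) x _ _ H1 H3).
  - apply (is_derive_plus (fun t => Im (f t)) (fun t => Im (g t)) x _ _ H2 H4). Qed.
Lemma cder_opp f x l : cder f x l -> cder (fun t => - f t)%C x (- l)%C.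
Proof. intros [H1 H2]; split; simpl.
  - apply (is_derive_opp (fun t => Re (f t)) x _ H1).
  - apply (is_derive_opp (fun t => Im (f t)) x _ H2). Qed.
Lemma der_mult (f g : R -> R) x l k : is_derive f x l -> is_derive g x k ->
  is_derive (fun t => f t * g t) x (l * g x + f x * k).
Proof. intros H1 H2. apply (is_derive_mult f g x l k H1 H2). intros; apply Rmult_comm. Qed.

Lemma cder_mult f g x l k : cder f x l -> cder g x k ->
  cder (fun t => f t * g t)%C x (l * g x + f x * k)%C.
Proof.
  intros [H1 H2] [H3 H4]; split.
  - replace (Re (l * g x + f x * k)%C) with
      ((Re l * Re (g x) + Re (f x) * Re k) - (Im l * Im (g x) + Im (f x) * Im k)) by (unfold Re, Im; simpl; ring).
    apply (is_derive_minus (fun t => Re (f t) * Re (g t)) (fun t => Im (f t) * Im (g t)) x);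
    apply der_mult; assumption.
  - replace (Im (l * g x + f x * k)%C) with
      ((Re l * Im (g x) + Re (f x) * Im k) + (Im l * Re (g x) + Im (f x) * Re k)) by (unfold Re, Im; simpl; ring).
    apply (is_derive_plus (fun t => Re (f t) * Im (g t)) (fun t => Im (f t) * Re (g t)) x);
    apply der_mult; assumption.
Qed.
Lemma cder_scal (c : C) f x l : cder f x l -> cder (fun t => c * f t)%C x (c * l)%C.
Proof.
  intros H. replace (c * l)%C with (0 * f x + c * l)%C by ring.
  apply (cder_mult (fun _ => c)); [apply cder_const|exact H].
Qed.
Lemma cder_RtoC (f : R -> R) x (l : R) : is_derive f x l -> cder (fun t => RtoC (f t)) x (RtoC l).
Proof. intros H; split; [exact H|]. apply (is_derive_const (K := R_AbsRing) (V := R_NormedModule) 0 x). Qed.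
Lemma cder_ext_loc f g x l : locally x (fun t => f t = g t) -> cder f x l -> cder g x l.
Proof. intros H [H1 H2]; split; eapply is_derive_ext_loc; try eassumption;
  (eapply filter_imp; [|exact H]); intros t Ht; simpl; now rewrite Ht. Qed.
Lemma cder_comp f (u : R -> R) x l k : cder f (u x) l -> is_derive u x k ->
  cder (fun t => f (u t)) x (RtoC k * l)%C.
Proof.
  intros [H1 H2] H; split.
  - replace (Re (RtoC k * l)%C) with (k * Re l) by (unfold Re, Im; simpl; ring).
    apply (is_derive_comp (fun t => Re (f t)) u x _ _ H1 H).
  - replace (Im (RtoC k * l)%C) with (k * Im l) by (unfold Re, Im; simpl; ring).
    apply (is_derive_comp (fun t => Im (f t)) u x _ _ H2 H).
Qed.
Lemma cder_eq f x l k : cder f x l -> l = k -> cder f x k.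
Proof. intros; now subst. Qed.
Lemma cder_ccont f x l : cder f x l -> ccont f x.
Proof. intros [H1 H2]; split.
  - apply (ex_derive_continuous (fun t => Re (f t))). eexists; exact H1.
  - apply (ex_derive_continuous (fun t => Im (f t))). eexists; exact H2. Qed.

End Derivatives.

(** * Integrals of complex-valued functions and Fubini's theorem *)

Lemma ex_RInt_cont (f : R -> R) a b :
  a <= b -> (forall x, a <= x <= b -> continuous f x) -> ex_RInt f a b.
Proof.
  intros Hab H. apply (ex_RInt_continuous (V := R_CompleteNormedModule)).
  intros z. rewrite Rmin_left, Rmax_right by lra. apply H.
Qed.

Lemma RInt_Rplus (f g : R -> R) a b : ex_RInt f a b -> ex_RInt g a b ->
  RInt (fun x => f x + g x) a b = RInt f a b + RInt g a b.
Proof. apply (RInt_plus (V := R_CompleteNormedModule)). Qed.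

Lemma RInt_Rminus (f g : R -> R) a b : ex_RInt f a b -> ex_RInt g a b ->
  RInt (fun x => f x - g x) a b = RInt f a b - RInt g a b.
Proof. apply (RInt_minus (V := R_CompleteNormedModule)). Qed.

Lemma RInt_Rscal (c : R) (f : R -> R) a b : ex_RInt f a b ->
  RInt (fun x => c * f x) a b = c * RInt f a b.
Proof. apply (RInt_scal (V := R_CompleteNormedModule)). Qed.

Lemma RInt_RChasles (f : R -> R) a b c : ex_RInt f a b -> ex_RInt f b c ->
  RInt f a b + RInt f b c = RInt f a c.
Proof. apply (RInt_Chasles (V := R_CompleteNormedModule)). Qed.

Lemma RInt_FTC (f f' : R -> R) a b : a <= b ->
  (forall x, a <= x <= b -> is_derive f x (f' x)) ->
  (forall x, a <= x <= b -> continuous f' x) ->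
  RInt f' a b = f b - f a.
Proof.
  intros Hab Hd Hc. apply is_RInt_unique.
  apply (is_RInt_derive (V := R_CompleteNormedModule) f f' a b);
  intros x; rewrite Rmin_left, Rmax_right by lra; auto.
Qed.

Definition ccont_on (f : R -> C) a b := forall x, a <= x <= b -> ccont f x.

Lemma ccont_on_ex_Re f a b : a <= b -> ccont_on f a b -> ex_RInt (fun t => Re (f t)) a b.
Proof. intros Hab H. apply ex_RInt_cont; auto. intros x Hx. apply H, Hx. Qed.
Lemma ccont_on_ex_Im f a b : a <= b -> ccont_on f a b -> ex_RInt (fun t => Im (f t)) a b.
Proof. intros Hab H. apply ex_RInt_cont; auto. intros x Hx. apply H, Hx. Qed.

#[local] Hint Resolve ccont_on_ex_Re ccont_on_ex_Im : core.

Lemma CInt_ext f g a b : a <= b -> (forall x, a < x < b -> f x = g x) -> CInt f a b = CInt g a b.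
Proof.
  intros Hab H. unfold CInt. f_equal; apply (RInt_ext (V := R_CompleteNormedModule));
  intros x; rewrite Rmin_left, Rmax_right by lra; intros Hx; now rewrite H.
Qed.

Lemma CInt_plus f g a b : a <= b -> ccont_on f a b -> ccont_on g a b ->
  CInt (fun x => f x + g x)%C a b = (CInt f a b + CInt g a b)%C.
Proof.
  intros Hab Hf Hg. apply C_ext; unfold CInt; simpl.
  - apply (RInt_Rplus (fun t => Re (f t)) (fun t => Re (g t))); auto.
  - apply (RInt_Rplus (fun t => Im (f t)) (fun t => Im (g t))); auto.
Qed.

Lemma CInt_scal c f a b : a <= b -> ccont_on f a b ->
  CInt (fun x => c * f x)%C a b = (c * CInt f a b)%C.
Proof.
  intros Hab Hf. pose proof (ccont_on_ex_Re f a b Hab Hf) as H1.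
  pose proof (ccont_on_ex_Im f a b Hab Hf) as H2.
  apply C_ext.
  - change (RInt (fun t => Re c * Re (f t) - Im c * Im (f t)) a b =
      Re c * RInt (fun t => Re (f t)) a b - Im c * RInt (fun t => Im (f t)) a b).
    rewrite RInt_Rminus, !RInt_Rscal; auto;
    now apply (ex_RInt_scal (V := R_NormedModule)).
  - change (RInt (fun t => Re c * Im (f t) + Im c * Re (f t)) a b =
      Re c * RInt (fun t => Im (f t)) a b + Im c * RInt (fun t => Re (f t)) a b).
    rewrite RInt_Rplus, !RInt_Rscal; auto;
    now apply (ex_RInt_scal (V := R_NormedModule)).
Qed.

Lemma ccont_on_scal c f a b : ccont_on f a b -> ccont_on (fun x => c * f x)%C a b.
Proof. intros H x Hx. apply ccont_mult; [apply ccont_const|now apply H]. Qed.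

Lemma CInt_minus f g a b : a <= b -> ccont_on f a b -> ccont_on g a b ->
  CInt (fun x => f x - g x)%C a b = (CInt f a b - CInt g a b)%C.
Proof.
  intros Hab Hf Hg.
  rewrite (CInt_ext _ (fun x => f x + (-(1)) * g x)%C); [|exact Hab|intros; ring].
  rewrite CInt_plus, CInt_scal; auto; [ring|]. now apply ccont_on_scal.
Qed.

Lemma CInt_Chasles f a b c : a <= b -> b <= c -> ccont_on f a c ->
  (CInt f a b + CInt f b c)%C = CInt f a c.
Proof.
  intros Hab Hbc H.
  assert (ccont_on f a b) by (intros x Hx; apply H; lra).
  assert (ccont_on f b c) by (intros x Hx; apply H; lra).
  apply C_ext; unfold CInt; simpl; apply RInt_RChasles; auto.
Qed.

Lemma CInt_point f a : CInt f a a = 0%C.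
Proof. unfold CInt. rewrite !RInt_point. reflexivity. Qed.

Lemma CInt_RtoC (f : R -> R) a b : CInt (fun x => RtoC (f x)) a b = RtoC (RInt f a b).
Proof.
  unfold CInt, RtoC. simpl. f_equal. rewrite RInt_const.
  unfold scal; simpl; unfold mult; simpl. ring.
Qed.

(* With [z] the integral, [|z|^2 = Re (int (conj z * f)) <= |z| * int g]. *)
Lemma CInt_le f (g : R -> R) a b : a <= b -> ccont_on f a b -> ex_RInt g a b ->
  (forall x, a < x < b -> Cmod (f x) <= g x) -> Cmod (CInt f a b) <= RInt g a b.
Proof.
  intros Hab Hf Hg H. set (z := CInt f a b).
  destruct (Req_dec (Cmod z) 0) as [H0|H0].
  - rewrite H0. rewrite <- (Rmult_0_r (b - a)).
    replace ((b - a) * 0) with (RInt (fun _ => 0) a b)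
      by (rewrite RInt_const; reflexivity).
    apply RInt_le; auto. { apply (ex_RInt_const (V := R_NormedModule)). }
    intros x Hx. eapply Rle_trans; [apply Cmod_ge_0|now apply H].
  - assert (Hp : 0 < Cmod z) by (pose proof (Cmod_ge_0 z); lra).
    apply Rmult_le_reg_l with (Cmod z); [exact Hp|].
    replace (Cmod z * Cmod z) with (Re (Cconj z * z)%C)
      by (pose proof (Cmod2_alt z); unfold Re, Im in *; simpl in *; nra).
    unfold z at 2. rewrite <- CInt_scal; auto. unfold CInt at 1; simpl.
    rewrite <- RInt_Rscal by exact Hg.
    apply RInt_le; auto.
    + apply (ccont_on_ex_Re (fun x => Cconj z * f x)%C); auto. now apply ccont_on_scal.
    + now apply (ex_RInt_scal (V := R_NormedModule)).
    + intros x Hx. apply Rle_trans with (Cmod (Cconj z * f x)%C).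
      * eapply Rle_trans; [apply Rle_abs|]. apply (re_le_Cmod (Cconj z * f x)%C).
      * rewrite Cmod_mult, Cmod_conj. apply Rmult_le_compat_l; [lra|]. now apply H.
Qed.

Lemma CInt_le_const f (K : R) a b : a <= b -> ccont_on f a b ->
  (forall x, a < x < b -> Cmod (f x) <= K) -> Cmod (CInt f a b) <= (b - a) * K.
Proof.
  intros Hab Hf H. replace ((b - a) * K) with (RInt (fun _ => K) a b)
    by (rewrite RInt_const; reflexivity).
  apply CInt_le; auto. apply (ex_RInt_const (V := R_NormedModule)).
Qed.

Lemma CInt_FTC f f' a b : a <= b -> (forall x, a <= x <= b -> cder f x (f' x)) ->
  ccont_on f' a b -> CInt f' a b = (f b - f a)%C.
Proof.
  intros Hab Hd Hc. apply C_ext.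
  - apply (RInt_FTC (fun t => Re (f t)) (fun t => Re (f' t))); auto; intros; [now apply Hd|now apply Hc].
  - apply (RInt_FTC (fun t => Im (f t)) (fun t => Im (f' t))); auto; intros; [now apply Hd|now apply Hc].
Qed.

Lemma RInt_der (f : R -> R) (a0 a x : R) : a0 < a -> a0 < x ->
  (forall t, a0 < t -> continuous f t) -> is_derive (fun u => RInt f a u) x (f x).
Proof.
  intros Ha Hx H. apply (is_derive_RInt (V := R_NormedModule) f (fun u => RInt f a u) a x).
  - assert (Hp : 0 < x - a0) by lra. exists (mkposreal _ Hp). intros y Hy.
    unfold_ball_in Hy.
    apply Rabs_def2 in Hy.
    apply (RInt_correct (V := R_CompleteNormedModule)).
    apply (ex_RInt_continuous (V := R_CompleteNormedModule)).
    intros z Hz. apply H. destruct Hz as [Hz _]. revert Hz. unfold Rmin. destruct Rle_dec; lra.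
  - now apply H.
Qed.

Lemma CInt_der f (a0 a x : R) : a0 < a -> a0 < x ->
  (forall t, a0 < t -> ccont f t) -> cder (fun u => CInt f a u) x (f x).
Proof.
  intros Ha Hx H. split; unfold CInt; simpl.
  - apply (RInt_der (fun t => Re (f t)) a0); auto. intros t Ht; now apply H.
  - apply (RInt_der (fun t => Im (f t)) a0); auto. intros t Ht; now apply H.
Qed.

(** * Parameter integrals and Fubini's theorem on rectangles *)

Definition cont2 (f : R -> R -> R) x y := continuous (fun p : R * R => f (fst p) (snd p)) (x, y).

Lemma cont2_fst f x y : cont2 f x y -> continuous (fun s => f s y) x.
Proof. intros H. apply (continuous_2d_swap_fst (fun p => f (fst p) (snd p)) x y H). Qed.
Lemma cont2_snd f x y : cont2 f x y -> continuous (fun s => f x s) y.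
Proof. intros H. apply (continuous_2d_swap_snd (fun p => f (fst p) (snd p)) x y H). Qed.

Lemma cont2_pt f x y : cont2 f x y -> continuity_2d_pt f x y.
Proof. intros H. now apply continuity_2d_pt_filterlim. Qed.

Lemma RInt_param_cont (f : R -> R -> R) a b x : a <= b ->
  (forall x y, cont2 f x y) -> continuous (fun x => RInt (fun y => f x y) a b) x.
Proof.
  intros Hab H. apply filterlim_locally. intros eps.
  (* The added [1] covers the case [a = b]. *)
  assert (Hpos : 0 < eps / (2 * (b - a + 1))).
  { apply Rdiv_lt_0_compat; [apply cond_pos|lra]. }
  destruct (uniform_continuity_2d_1d' f a b x) with (eps := mkposreal _ Hpos) as [d Hd].
  { intros y _. apply cont2_pt, H. }
  exists d. intros y Hy.
  unfold_ball.
  assert (Hex : forall x, ex_RInt (fun y => f x y) a b).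
  { intros u. apply ex_RInt_cont; auto. intros v _. apply cont2_snd, H. }
  change (Rabs (RInt (fun y0 => f y y0) a b - RInt (fun y0 => f x y0) a b) < eps).
  rewrite <- RInt_Rminus by auto.
  apply Rle_lt_trans with ((b - a) * (eps / (2 * (b - a + 1)))).
  - apply abs_RInt_le_const; auto.
    + apply (ex_RInt_minus (V := R_NormedModule) (fun t => f y t) (fun t => f x t)); auto.
    + intros t Ht. left. apply Rabs_def2 in Hy. pose proof (cond_pos d).
      apply (Hd t x t y); try lra. rewrite Rminus_diag, Rabs_R0. lra.
  - pose proof (cond_pos eps).
    apply Rmult_lt_reg_r with (2 * (b - a + 1)); [lra|].
    replace ((b - a) * (eps / (2 * (b - a + 1))) * (2 * (b - a + 1))) with ((b - a) * eps)
      by (field; lra). nra.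
Qed.

Lemma cont2_swap f x y : cont2 f x y -> cont2 (fun u v => f v u) y x.
Proof.
  intros H. unfold cont2.
  apply (continuous_comp (fun p : R * R => (snd p, fst p)) (fun p => f (fst p) (snd p)) (y, x)).
  - apply continuous_pair; [apply continuous_snd|apply continuous_fst].
  - exact H.
Qed.

(** As functions of the upper limit [u] of the [x]-integral, both sides vanish at [a] and have
    derivative [RInt (f u) c d]. Continuity on the whole plane spares any discussion of one-sided
    derivatives at the edges. *)
Lemma RInt_Fubini_glob (f : R -> R -> R) a b c d : a <= b -> c <= d ->
  (forall x y, cont2 f x y) ->
  RInt (fun x => RInt (fun y => f x y) c d) a b = RInt (fun y => RInt (fun x => f x y) a b) c d.
Proof.
  intros Hab Hcd H.
  assert (H' : forall x y, cont2 (fun u v => f v u) x y) by (intros; apply cont2_swap, H).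
  destruct (Req_dec a b) as [E|E].
  { subst b. rewrite RInt_point.
    rewrite (RInt_ext _ (fun _ => 0)) by (intros; now rewrite RInt_point).
    rewrite RInt_const. unfold scal; simpl; unfold mult; simpl. unfold zero; simpl. ring. }
  set (D := fun u => RInt (fun x => RInt (fun y => f x y) c d) a u
                     - RInt (fun y => RInt (fun x => f x y) a u) c d).
  assert (E1 : D a = 0).
  { unfold D. rewrite RInt_point.
    rewrite (RInt_ext _ (fun _ => 0)) by (intros; now rewrite RInt_point).
    rewrite RInt_const. unfold scal; simpl; unfold mult; simpl. unfold zero; simpl. ring. }
  assert (E2 : D a = D b).
  { apply (eq_is_derive (V := R_NormedModule)); [|lra].
    intros t Ht.
    replace (@zero R_NormedModule) with (RInt (fun y => f t y) c d - RInt (fun y => f t y) c d)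
      by (unfold zero; simpl; ring).
    apply (is_derive_minus (V := R_NormedModule)
      (fun u => RInt (fun x => RInt (fun y => f x y) c d) a u)
      (fun u => RInt (fun y => RInt (fun x => f x y) a u) c d)).
    - apply (RInt_der (fun x => RInt (fun y => f x y) c d) (a - 1)); try lra.
      intros u _. now apply RInt_param_cont.
    - assert (Hd : forall u y, is_derive (fun u => RInt (fun x => f x y) a u) u (f u y)).
      { intros u y. apply (RInt_der (fun x => f x y) (Rmin a u - 1)).
        - pose proof (Rmin_l a u); lra.
        - pose proof (Rmin_r a u); lra.
        - intros v _. apply cont2_fst, H. }
      (* Differentiation under the integral sign is available with the integrand written as a
         [Derive]. *)
      rewrite (RInt_ext (fun y => f t y) (fun y => Derive (fun u => RInt (fun x => f x y) a u) t))
        by (intros y _; symmetry; apply is_derive_unique, Hd).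
      apply is_derive_RInt_param.
      + apply filter_forall. intros u y _. eexists. apply Hd.
      + intros y _. apply continuity_2d_pt_ext with f.
        * intros u v. symmetry. apply is_derive_unique, Hd.
        * apply cont2_pt, H.
      + apply filter_forall. intros u. apply ex_RInt_cont; auto. intros y _.
        destruct (Rle_dec a u).
        * now apply (RInt_param_cont (fun y x => f x y)).
        * apply continuous_ext with (fun y => opp (RInt (fun x => f x y) u a)).
          { intros v. rewrite opp_RInt_swap; auto. apply ex_RInt_cont; [lra|]. intros; apply cont2_fst, H. }
          apply (continuous_opp (V := R_NormedModule) (fun y => RInt (fun x => f x y) u a)).
          apply (RInt_param_cont (fun y x => f x y)); auto; lra. }
  unfold D in E2 at 2. lra.
Qed.

(** The retraction of the line onto [[a, b]]. Composing with it extends a function continuous on a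
    rectangle to one continuous on the plane with the same values on the rectangle, which carries
    the global results over to rectangles. *)
Definition clamp a b x := Rmax a (Rmin b x).
Lemma clamp_in a b x : a <= b -> a <= clamp a b x <= b.
Proof. intros H. unfold clamp, Rmax, Rmin. repeat destruct Rle_dec; lra. Qed.
Lemma clamp_id a b x : a <= x <= b -> clamp a b x = x.
Proof. intros H. unfold clamp, Rmax, Rmin. repeat destruct Rle_dec; lra. Qed.
Lemma clamp_cont a b x : continuous (clamp a b) x.
Proof.
  apply filterlim_locally. intros eps. exists eps. intros y Hy.
  unfold_ball.
  apply Rabs_def2 in Hy. apply Rabs_def1; unfold clamp, Rmax, Rmin;
  repeat destruct Rle_dec; lra.
Qed.

Definition cont2_on (f : R -> R -> R) a b c d :=
  forall x y, a <= x <= b -> c <= y <= d -> cont2 f x y.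

Lemma cont2_clamp f a b c d : a <= b -> c <= d -> cont2_on f a b c d ->
  forall x y, cont2 (fun x y => f (clamp a b x) (clamp c d y)) x y.
Proof.
  intros Hab Hcd H x y. unfold cont2.
  apply (continuous_comp (fun p : R * R => (clamp a b (fst p), clamp c d (snd p)))
           (fun p => f (fst p) (snd p)) (x, y)).
  - apply continuous_pair.
    + apply (continuous_comp fst (clamp a b)); [apply continuous_fst|apply clamp_cont].
    + apply (continuous_comp snd (clamp c d)); [apply continuous_snd|apply clamp_cont].
  - apply H; now apply clamp_in.
Qed.

Lemma RInt_Fubini (f : R -> R -> R) a b c d : a <= b -> c <= d -> cont2_on f a b c d ->
  RInt (fun x => RInt (fun y => f x y) c d) a b = RInt (fun y => RInt (fun x => f x y) a b) c d.
Proof.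
  intros Hab Hcd H.
  pose proof (RInt_Fubini_glob _ a b c d Hab Hcd (cont2_clamp f a b c d Hab Hcd H)) as E.
  etransitivity; [|etransitivity; [exact E|]].
  - apply RInt_ext. intros x Hx. rewrite Rmin_left, Rmax_right in Hx by lra.
    apply RInt_ext. intros y Hy. rewrite Rmin_left, Rmax_right in Hy by lra.
    rewrite !clamp_id by lra. reflexivity.
  - apply RInt_ext. intros x Hx. rewrite Rmin_left, Rmax_right in Hx by lra.
    apply RInt_ext. intros y Hy. rewrite Rmin_left, Rmax_right in Hy by lra.
    rewrite !clamp_id by lra. reflexivity.
Qed.

Definition ccont2 (f : R -> R -> C) x y := ccont (fun p : R * R => f (fst p) (snd p)) (x, y).
Definition ccont2_on f a b c d := forall x y, a <= x <= b -> c <= y <= d -> ccont2 f x y.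

Lemma ccont2_fst f x y : ccont2 f x y -> ccont (fun s => f s y) x.
Proof. intros [H1 H2]; split; [apply (cont2_fst (fun x y => Re (f x y)))|apply (cont2_fst (fun x y => Im (f x y)))]; assumption. Qed.
Lemma ccont2_snd f x y : ccont2 f x y -> ccont (fun s => f x s) y.
Proof. intros [H1 H2]; split; [apply (cont2_snd (fun x y => Re (f x y)))|apply (cont2_snd (fun x y => Im (f x y)))]; assumption. Qed.

Lemma CInt_Fubini f a b c d : a <= b -> c <= d -> ccont2_on f a b c d ->
  CInt (fun x => CInt (fun y => f x y) c d) a b = CInt (fun y => CInt (fun x => f x y) a b) c d.
Proof.
  intros Hab Hcd H. unfold CInt; simpl. f_equal.
  - apply (RInt_Fubini (fun x y => Re (f x y))); auto. intros x y Hx Hy. now apply H.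
  - apply (RInt_Fubini (fun x y => Im (f x y))); auto. intros x y Hx Hy. now apply H.
Qed.

Lemma CInt_param_cont_glob f c d x : c <= d -> (forall x y, ccont2 f x y) ->
  ccont (fun x => CInt (fun y => f x y) c d) x.
Proof.
  intros Hcd H. split; unfold CInt; simpl.
  - apply (RInt_param_cont (fun x y => Re (f x y))); auto. intros; apply H.
  - apply (RInt_param_cont (fun x y => Im (f x y))); auto. intros; apply H.
Qed.

Lemma ccont2_clamp f a b c d : a <= b -> c <= d -> ccont2_on f a b c d ->
  forall x y, ccont2 (fun x y => f (clamp a b x) (clamp c d y)) x y.
Proof.
  intros Hab Hcd H x y; split.
  - apply (cont2_clamp (fun x y => Re (f x y))); auto. intros u v Hu Hv. now apply H.
  - apply (cont2_clamp (fun x y => Im (f x y))); auto. intros u v Hu Hv. now apply H.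
Qed.

Lemma CInt_param_cont f a b c d x : a < x < b -> c <= d -> ccont2_on f a b c d ->
  ccont (fun x => CInt (fun y => f x y) c d) x.
Proof.
  intros Hx Hcd H.
  apply ccont_ext_loc with (fun x => CInt (fun y => f (clamp a b x) (clamp c d y)) c d).
  - assert (L : locally x (fun t => a < t < b)).
    { apply filter_and; [apply (open_gt a x)|apply (open_lt b x)]; lra. }
    eapply filter_imp; [|exact L]. intros t Ht. apply CInt_ext; auto.
    intros y Hy. rewrite !clamp_id by lra. reflexivity.
  - apply CInt_param_cont_glob; auto. apply ccont2_clamp; auto. lra.
Qed.

(** Writing [f x y] as [f x0 y] plus the integral of [g] from [x0] to [x] and exchanging the
    integrals by Fubini leaves a constant plus an integral with upper limit [x], to which the
    fundamental theorem applies. *)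
Lemma CInt_param_der f g a b c d x : a < x < b -> c <= d ->
  (forall x y, a <= x <= b -> c <= y <= d -> cder (fun x => f x y) x (g x y)) ->
  ccont2_on f a b c d -> ccont2_on g a b c d ->
  cder (fun x => CInt (fun y => f x y) c d) x (CInt (fun y => g x y) c d).
Proof.
  intros Hx Hcd Hd Hf Hg.
  (* Any base point strictly between [a] and [x] would do: for [t] near [x] the segment from [x0] to
     [t] then stays inside [[a, b]]. *)
  set (x0 := (a + x) / 2).
  set (h := fun x y => g (clamp a b x) (clamp c d y)).
  assert (Hh : forall x y, ccont2 h x y) by (apply ccont2_clamp; auto; lra).
  apply cder_ext_loc with (fun x => CInt (fun y => f x0 y) c d + CInt (fun u => CInt (fun y => h u y) c d) x0 x)%C.
  - assert (L : locally x (fun t => x0 < t < b)).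
    { unfold x0. apply filter_and; [apply (open_gt _ x)|apply (open_lt b x)]; lra. }
    eapply filter_imp; [|exact L]. intros t Ht. unfold x0 in *.
    rewrite CInt_Fubini; try lra; [|intros u v _ _; apply Hh].
    rewrite <- CInt_plus; try lra.
    + apply CInt_ext; auto. intros y Hy.
      rewrite (CInt_FTC (fun x => f x y)); try lra.
      * ring.
      * intros u Hu. unfold h. rewrite !clamp_id by lra. apply Hd; lra.
      * intros u Hu. apply ccont2_fst, Hh.
    + intros y Hy. apply ccont2_snd. apply Hf; lra.
    + intros y Hy. apply (CInt_param_cont_glob (fun y u => h u y)); try lra.
      intros u v. destruct (Hh v u). split; now apply (cont2_swap (fun x y => _ (h x y))).
  - apply cder_eq with (0 + CInt (fun y => h x y) c d)%C.
    + apply cder_plus; [apply cder_const|].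
      apply (CInt_der (fun u => CInt (fun y => h u y) c d) a); unfold x0; try lra.
      intros t _. now apply CInt_param_cont_glob.
    + rewrite Cplus_0_l. apply CInt_ext; auto. intros y Hy. unfold h. rewrite !clamp_id by lra. reflexivity.
Qed.

(** * Complex powers *)

Lemma cexp_plus z w : cexp (z + w)%C = (cexp z * cexp w)%C.
Proof.
  destruct z as [a b], w as [c d]. unfold cexp; simpl. rewrite exp_plus, cos_plus, sin_plus.
  apply C_ext; simpl; ring.
Qed.

Lemma cexp_0 : cexp 0 = 1%C.
Proof. unfold cexp; simpl. rewrite exp_0, cos_0, sin_0. apply C_ext; simpl; ring. Qed.

Lemma Cmod_cexp z : Cmod (cexp z) = exp (Re z).
Proof.
  unfold Cmod, cexp; simpl.
  replace (_ + _) with ((exp (Re z))² * ((sin (Im z))² + (cos (Im z))²)) by (unfold Rsqr; ring).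
  rewrite sin2_cos2, Rmult_1_r. apply sqrt_Rsqr. left; apply exp_pos.
Qed.

Lemma cder_cexp (w : R -> C) x l : cder w x l -> cder (fun t => cexp (w t)) x (cexp (w x) * l)%C.
Proof.
  intros [H1 H2].
  assert (E : is_derive (fun t => exp (Re (w t))) x (Re l * exp (Re (w x)))).
  { apply (is_derive_comp exp (fun t => Re (w t)) x); [apply is_derive_exp|exact H1]. }
  assert (Cs : is_derive (fun t => cos (Im (w t))) x (Im l * - sin (Im (w x)))).
  { apply (is_derive_comp cos (fun t => Im (w t)) x); [apply is_derive_cos|exact H2]. }
  assert (Sn : is_derive (fun t => sin (Im (w t))) x (Im l * cos (Im (w x)))).
  { apply (is_derive_comp sin (fun t => Im (w t)) x); [apply is_derive_sin|exact H2]. }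
  split; unfold cexp; simpl.
  - evar_last; [apply (der_mult _ _ _ _ _ E Cs)|]. unfold Re, Im; simpl; ring.
  - evar_last; [apply (der_mult _ _ _ _ _ E Sn)|]. unfold Re, Im; simpl; ring.
Qed.

Lemma cpow_plus y z w : cpow y (z + w)%C = (cpow y z * cpow y w)%C.
Proof. unfold cpow. rewrite <- cexp_plus. f_equal. ring. Qed.

Lemma cpow_0 y : cpow y 0 = 1%C.
Proof. unfold cpow. rewrite Cmult_0_l. apply cexp_0. Qed.

Lemma cpow_1 y : 0 < y -> cpow y 1 = RtoC y.
Proof.
  intros H. unfold cpow. rewrite Cmult_1_l. unfold cexp, RtoC; simpl.
  rewrite exp_ln, cos_0, sin_0 by exact H. f_equal; ring.
Qed.

Lemma cpow_base1 z : cpow 1 z = 1%C.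
Proof. unfold cpow. rewrite ln_1. rewrite Cmult_0_r. apply cexp_0. Qed.

Lemma cpow_mult x y z : 0 < x -> 0 < y -> cpow (x * y) z = (cpow x z * cpow y z)%C.
Proof.
  intros Hx Hy. unfold cpow. rewrite <- cexp_plus. f_equal.
  rewrite ln_mult, RtoC_plus by assumption. ring.
Qed.

Lemma cpow_opp_inv y z : (cpow y (- z) * cpow y z = 1)%C.
Proof. rewrite <- cpow_plus. replace (- z + z)%C with (RtoC 0) by ring. apply cpow_0. Qed.

Lemma cpow_inv y z : 0 < y -> cpow (/ y) z = cpow y (- z).
Proof. intros H. unfold cpow. rewrite ln_Rinv by exact H. rewrite RtoC_opp. f_equal. ring. Qed.

Lemma Cmod_cpow y z : Cmod (cpow y z) = Rpower y (Re z).
Proof. unfold cpow. rewrite Cmod_cexp. unfold Rpower. f_equal. simpl. unfold Re; ring. Qed.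

Lemma cpow_R y (r : R) : cpow y (RtoC r) = RtoC (Rpower y r).
Proof.
  unfold cpow. rewrite <- RtoC_mult. unfold cexp, RtoC, Rpower; simpl.
  rewrite cos_0, sin_0. f_equal; ring.
Qed.

Lemma cpow_S y z : 0 < y -> cpow y (z + 1)%C = (RtoC y * cpow y z)%C.
Proof. intros H. rewrite cpow_plus, cpow_1 by exact H. ring. Qed.

Lemma cder_cpow y z : 0 < y -> cder (fun t => cpow t z) y (z * cpow y (z - 1))%C.
Proof.
  intros H. unfold cpow at 1.
  eapply cder_eq.
  - apply cder_cexp. apply cder_scal. apply cder_RtoC. apply is_derive_ln. exact H.
  - assert (E : cpow y z = (RtoC y * cpow y (z - 1))%C).
    { rewrite <- cpow_S by exact H. f_equal. ring. }
    change (cpow y z * (z * RtoC (/ y)) = z * cpow y (z - 1))%C.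
    rewrite E, RtoC_inv by lra. field.
    intros E'. apply RtoC_inj in E'. lra.
Qed.

Lemma ccont_cpow y z : 0 < y -> ccont (fun t => cpow t z) y.
Proof. intros H. eapply cder_ccont. now apply cder_cpow. Qed.

(** The truncated power [y_+^z]. For [Re z > 0] it is continuous on the whole line, so an integral
    over [cosh s < x] may be taken over any longer interval that does not depend on [x]. *)
Definition ppow (y : R) (z : C) : C := if Rle_dec y 0 then 0%C else cpow y z.

Lemma ppow_pos y z : 0 < y -> ppow y z = cpow y z.
Proof. intros H. unfold ppow. destruct Rle_dec; [lra|reflexivity]. Qed.
Lemma ppow_neg y z : y <= 0 -> ppow y z = 0%C.
Proof. intros H. unfold ppow. destruct Rle_dec; [reflexivity|lra]. Qed.

Lemma ppow_S y z : ppow y (z + 1)%C = (RtoC y * ppow y z)%C.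
Proof.
  destruct (Rle_dec y 0).
  - rewrite !ppow_neg by lra. ring.
  - rewrite !ppow_pos by lra. apply cpow_S. lra.
Qed.

Lemma Rpower_small (s eps : R) : 0 < s -> 0 < eps ->
  forall y, 0 < y < Rpower eps (/ s) -> Rpower y s < eps.
Proof.
  intros Hs He y Hy.
  replace eps with (Rpower (Rpower eps (/ s)) s).
  - apply Rlt_Rpower_l; lra.
  - rewrite Rpower_mult. replace (/ s * s) with 1 by (field; lra). now apply Rpower_1.
Qed.

Lemma ppow_small z : 0 < Re z -> forall eps, 0 < eps ->
  exists d, 0 < d /\ forall y, y < d -> Cmod (ppow y z) < eps.
Proof.
  intros Hz eps He. exists (Rpower eps (/ Re z)). split; [apply exp_pos|].
  intros y Hy. destruct (Rle_dec y 0).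
  - rewrite ppow_neg, Cmod_0 by lra. exact He.
  - rewrite ppow_pos, Cmod_cpow by lra. apply Rpower_small; lra.
Qed.

Lemma locally_pos y : 0 < y -> locally y (fun t => 0 < t).
Proof. intros; now apply (open_gt 0 y). Qed.
Lemma locally_neg y : y < 0 -> locally y (fun t => t < 0).
Proof. intros; now apply (open_lt 0 y). Qed.

Lemma ccont_ppow y z : 0 < Re z -> ccont (fun t => ppow t z) y.
Proof.
  intros Hz. destruct (Rtotal_order y 0) as [H|[H|H]].
  - apply ccont_ext_loc with (fun _ => 0%C); [|apply ccont_const].
    eapply filter_imp; [|apply locally_neg, H]. intros t Ht. simpl in Ht. rewrite ppow_neg; auto; lra.
  - subst y. split; apply filterlim_locally; intros eps;
    destruct (ppow_small z Hz eps (cond_pos eps)) as [d [Hd Hs]];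
    exists (mkposreal d Hd); intros t Ht;
    unfold_ball;
    apply Rabs_def2 in Ht; rewrite (ppow_neg 0) by lra; simpl;
    (eapply Rle_lt_trans; [|apply (Hs t); lra]); rewrite Ropp_0, Rplus_0_r.
    + apply re_le_Cmod.
    + apply Im_le_Cmod.
  - apply ccont_ext_loc with (fun t => cpow t z); [|now apply ccont_cpow].
    eapply filter_imp; [|apply locally_pos, H]. intros t Ht. simpl in Ht. now rewrite ppow_pos.
Qed.

Lemma cder_ppow y z : 0 < Re z -> cder (fun t => ppow t (z + 1)%C) y ((z + 1) * ppow y z)%C.
Proof.
  intros Hz. destruct (Rtotal_order y 0) as [H|[H|H]].
  - apply cder_ext_loc with (fun _ => 0%C).
    + eapply filter_imp; [|apply locally_neg, H]. intros t Ht. simpl in Ht. rewrite ppow_neg; auto; lra.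
    + eapply cder_eq; [apply cder_const|]. rewrite ppow_neg by lra. ring.
  (* At [0] the difference quotient of [ppow t (z + 1)] is [ppow h z] by [ppow_S], and this tends to
     [0]. *)
  - subst y. rewrite ppow_neg, Cmult_0_r by lra.
    split; apply is_derive_Reals; intros eps He;
    destruct (ppow_small z Hz eps He) as [d [Hd Hs]];
    exists (mkposreal d Hd); intros h Hh Hhd; simpl in Hhd; apply Rabs_def2 in Hhd;
    rewrite (ppow_neg 0), Rplus_0_l, ppow_S by lra;
    [replace ((Re (RtoC h * ppow h z) - Re 0) / h - Re 0) with (Re (ppow h z))
       by (unfold Re, RtoC, Cmult; simpl; field; exact Hh)
    |replace ((Im (RtoC h * ppow h z) - Im 0) / h - Im 0) with (Im (ppow h z))
       by (unfold Im, RtoC, Cmult; simpl; field; exact Hh)];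
    (eapply Rle_lt_trans; [|apply (Hs h); lra]); [apply re_le_Cmod|apply Im_le_Cmod].
  - apply cder_ext_loc with (fun t => cpow t (z + 1)%C).
    + eapply filter_imp; [|apply locally_pos, H]. intros t Ht. simpl in Ht. now rewrite ppow_pos.
    + eapply cder_eq; [now apply cder_cpow|]. rewrite ppow_pos by exact H. f_equal. f_equal. ring.
Qed.

(* The mean value inequality for [t^(z+1)], whose derivative is bounded by [|z+1|] on [0,1]. *)
Lemma ppow_near_1 z rho : 0 < Re z -> 0 <= rho <= 1 ->
  Cmod (1 - ppow rho (z + 1))%C <= Cmod (z + 1)%C * (1 - rho).
Proof.
  intros Hz Hr.
  assert (E : CInt (fun t => (z + 1) * ppow t z)%C rho 1 = (1 - ppow rho (z + 1))%C).
  { rewrite (CInt_FTC (fun t => ppow t (z + 1)%C)).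
    - rewrite (ppow_pos 1) by lra. now rewrite cpow_base1.
    - lra.
    - intros x _. now apply cder_ppow.
    - intros x _. apply ccont_mult; [apply ccont_const|now apply ccont_ppow]. }
  rewrite <- E, Rmult_comm. apply CInt_le_const; [lra| |].
  - intros x _. apply ccont_mult; [apply ccont_const|now apply ccont_ppow].
  - intros x Hx. rewrite Cmod_mult, ppow_pos, Cmod_cpow by lra.
    rewrite <- (Rmult_1_r (Cmod (z + 1))) at 2. apply Rmult_le_compat_l; [apply Cmod_ge_0|].
    replace 1 with (Rpower 1 (Re z)) by (unfold Rpower; rewrite ln_1, Rmult_0_r; apply exp_0).
    apply Rle_Rpower_l; lra.
Qed.

(** * Improper integrals *)

Notation poo := (Rbar_locally p_infty).

Lemma is_RInt_gen_prim (f P : R -> R) Fa Fb {FFa : Filter Fa} {FFb : Filter Fb} (la lb : R) :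
  filter_prod Fa Fb (fun ab => is_RInt f (fst ab) (snd ab) (P (snd ab) - P (fst ab))) ->
  filterlim P Fa (locally la) -> filterlim P Fb (locally lb) ->
  is_RInt_gen f Fa Fb (lb - la).
Proof.
  intros H Ha Hb.
  assert (HL : filterlim (fun ab : R * R => P (snd ab) - P (fst ab)) (filter_prod Fa Fb) (locally (lb - la))).
  { apply flim_minus.
    - eapply filterlim_comp; [apply filterlim_snd|exact Hb].
    - eapply filterlim_comp; [apply filterlim_fst|exact Ha]. }
  intros Q HQ. unfold filtermapi. specialize (HL Q HQ). unfold filtermap in HL.
  generalize (filter_and _ _ H HL). apply filter_imp. intros [u v] [H1 H2]. simpl in *.
  eexists; split; eassumption.
Qed.

Lemma at_right_poo (a : R) : filter_prod (at_right a) poo (fun ab => a < fst ab < snd ab).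
Proof.
  apply Filter_prod with (fun x => a < x < a + 1) (fun x => a + 1 < x).
  - exists (mkposreal 1 Rlt_0_1). intros y Hy Hay.
    unfold_ball_in Hy.
    apply Rabs_def2 in Hy. lra.
  - exists (a + 1). auto.
  - intros; simpl; lra.
Qed.

Lemma is_RInt_gen_FTC (f P : R -> R) a la lb :
  (forall x, a < x -> is_derive P x (f x)) -> (forall x, a < x -> continuous f x) ->
  filterlim P (at_right a) (locally la) -> filterlim P poo (locally lb) ->
  is_RInt_gen f (at_right a) poo (lb - la).
Proof.
  intros Hd Hc. apply (is_RInt_gen_prim f P (at_right a) poo).
  apply (filter_imp (F := filter_prod (at_right a) poo) _ _) with (2 := at_right_poo a). intros [u v] H; simpl in *.
  apply (is_RInt_derive (V := R_CompleteNormedModule) P f);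
  intros x; rewrite Rmin_left, Rmax_right by lra; intros; [apply Hd|apply Hc]; lra.
Qed.

(** Increments of the integral of [f] are bounded by increments of [G], so the Cauchy property of
    [G] along [F] passes to the integral. Keeping [F] abstract covers both ends of the half-line;
    [a + 1] is an arbitrary interior base point. *)
Lemma dominated_cauchy (f g G : R -> R) a F {FF : ProperFilter F} l :
  (forall x, a < x -> continuous f x) -> (forall x, a < x -> continuous g x) ->
  (forall x, a < x -> is_derive G x (g x)) -> (forall x, a < x -> Rabs (f x) <= g x) ->
  F (fun x => a < x) -> filterlim G F (locally l) ->
  exists k, filterlim (fun x => RInt f (a + 1) x) F (locally k).
Proof.
  intros Hf Hg HG Hfg HF HL.
  apply (filterlim_locally_cauchy (U := R_CompleteNormedModule) (F := F) (fun x => RInt f (a + 1) x)).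
  intros eps. pose proof (cond_pos eps) as He.
  assert (He2 : 0 < eps / 2) by lra.
  exists (fun x => a < x /\ ball l (mkposreal _ He2) (G x)). split.
  - apply filter_and; [exact HF|]. apply (proj1 (filterlim_locally G l) HL).
  - assert (HE : forall u v, a < u -> a < v -> ex_RInt f u v).
    { intros u v Hu Hv. apply (ex_RInt_continuous (V := R_CompleteNormedModule)).
      intros z [Hz _]. apply Hf. revert Hz; unfold Rmin; destruct Rle_dec; lra. }
    assert (HC : forall u v, a < u -> a < v -> RInt f (a + 1) v - RInt f (a + 1) u = RInt f u v).
    { intros u v Hu Hv. rewrite <- (RInt_RChasles f (a + 1) u v); try ring; apply HE; lra. }
    assert (HK : forall u v, a < u <= v -> Rabs (RInt f u v) <= G v - G u).
    { intros u v Huv. eapply Rle_trans; [apply abs_RInt_le; [lra|apply HE; lra]|].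
      rewrite <- (RInt_FTC G g u v); try lra; [|intros; apply HG; lra|intros; apply Hg; lra].
      apply RInt_le; try lra.
      - apply ex_RInt_cont; [lra|]. intros x Hx. apply (continuous_comp f Rabs).
        + apply Hf; lra. + apply continuous_Rabs.
      - apply ex_RInt_cont; [lra|]. intros; apply Hg; lra.
      - intros; apply Hfg; lra. }
    intros u v [Hu Bu] [Hv Bv].
    unfold_ball.
    change (Rabs (RInt f (a + 1) v - RInt f (a + 1) u) < eps).
    apply Rabs_def2 in Bu. apply Rabs_def2 in Bv.
    destruct (Rle_dec u v).
    + rewrite HC by assumption. eapply Rle_lt_trans; [apply HK; lra|]. lra.
    + rewrite Rabs_minus_sym, HC by assumption. eapply Rle_lt_trans; [apply HK; lra|]. lra.
Qed.

Lemma at_right_gt (a : R) : at_right a (fun x => a < x).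
Proof. exists (mkposreal 1 Rlt_0_1). auto. Qed.
Lemma poo_gt (a : R) : poo (fun x => a < x).
Proof. exists a. auto. Qed.

Lemma ex_RInt_gen_dominated (f g G : R -> R) a la lb :
  (forall x, a < x -> continuous f x) -> (forall x, a < x -> continuous g x) ->
  (forall x, a < x -> is_derive G x (g x)) -> (forall x, a < x -> Rabs (f x) <= g x) ->
  filterlim G (at_right a) (locally la) -> filterlim G poo (locally lb) ->
  ex_RInt_gen f (at_right a) poo.
Proof.
  intros Hf Hg HG Hfg Ha Hb.
  destruct (dominated_cauchy f g G a (at_right a) la) as [ka Hka]; auto using at_right_gt.
  destruct (dominated_cauchy f g G a poo lb) as [kb Hkb]; auto using poo_gt.
  exists (kb - ka). apply is_RInt_gen_FTC with (fun x => RInt f (a + 1) x); auto.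
  intros x Hx. apply RInt_der with a; auto; lra.
Qed.

Definition is_CInt_gen (f : R -> C) Fa Fb (l : C) :=
  is_RInt_gen (fun t => Re (f t)) Fa Fb (Re l) /\ is_RInt_gen (fun t => Im (f t)) Fa Fb (Im l).

Lemma is_CInt_gen_unique f Fa Fb l {FFa : ProperFilter Fa} {FFb : ProperFilter Fb} :
  is_CInt_gen f Fa Fb l -> CInt_gen f Fa Fb = l.
Proof.
  intros [H1 H2]. apply C_ext; unfold CInt_gen; simpl;
  apply (is_RInt_gen_unique (V := R_CompleteNormedModule)); assumption || now apply Proper_StrongProper.
Qed.

Lemma is_CInt_gen_plus f g Fa Fb l k {FFa : Filter Fa} {FFb : Filter Fb} :
  is_CInt_gen f Fa Fb l -> is_CInt_gen g Fa Fb k ->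
  is_CInt_gen (fun x => f x + g x)%C Fa Fb (l + k)%C.
Proof.
  intros [H1 H2] [H3 H4]; split.
  - apply (is_RInt_gen_plus (V := R_NormedModule) _ _ _ _ H1 H3).
  - apply (is_RInt_gen_plus (V := R_NormedModule) _ _ _ _ H2 H4).
Qed.

Lemma is_CInt_gen_scal c f Fa Fb l {FFa : Filter Fa} {FFb : Filter Fb} :
  is_CInt_gen f Fa Fb l -> is_CInt_gen (fun x => c * f x)%C Fa Fb (c * l)%C.
Proof.
  intros [H1 H2]; split.
  - apply (is_RInt_gen_minus (V := R_NormedModule) (fun x => Re c * Re (f x)) (fun x => Im c * Im (f x)));
    apply (is_RInt_gen_scal (V := R_NormedModule)); assumption.
  - apply (is_RInt_gen_plus (V := R_NormedModule) (fun x => Re c * Im (f x)) (fun x => Im c * Re (f x)));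
    apply (is_RInt_gen_scal (V := R_NormedModule)); assumption.
Qed.

Lemma is_CInt_gen_ext f g Fa Fb l {FFa : Filter Fa} {FFb : Filter Fb} :
  filter_prod Fa Fb (fun ab : R * R =>
     forall x : R, Rmin (fst ab) (snd ab) < x < Rmax (fst ab) (snd ab) -> f x = g x) ->
  is_CInt_gen f Fa Fb l -> is_CInt_gen g Fa Fb l.
Proof.
  intros H [H1 H2]; split; (eapply is_RInt_gen_ext; [|eassumption]);
  (eapply filter_imp; [|exact H]); intros ab Hab x Hx; simpl; now rewrite Hab.
Qed.

Lemma ext_at_right_poo (P : R -> Prop) a : (forall x, a < x -> P x) ->
  filter_prod (at_right a) poo (fun ab : R * R =>
     forall x : R, Rmin (fst ab) (snd ab) < x < Rmax (fst ab) (snd ab) -> P x).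
Proof.
  intros H. apply (filter_imp (F := filter_prod (at_right a) poo) _ _) with (2 := at_right_poo a). intros [u v] Huv x; simpl in *.
  rewrite Rmin_left, Rmax_right by lra. intros; apply H; lra.
Qed.

Lemma is_CInt_gen_FTC f P a la lb :
  (forall x, a < x -> cder P x (f x)) -> (forall x, a < x -> ccont f x) ->
  clim P (at_right a) la -> clim P poo lb -> is_CInt_gen f (at_right a) poo (lb - la)%C.
Proof.
  intros Hd Hc [H1 H2] [H3 H4]; split.
  - apply is_RInt_gen_FTC with (fun t => Re (P t)); auto; intros; [now apply Hd|now apply Hc].
  - apply is_RInt_gen_FTC with (fun t => Im (P t)); auto; intros; [now apply Hd|now apply Hc].
Qed.

Lemma ex_CInt_gen_dominated f (g G : R -> R) a la lb :
  (forall x, a < x -> ccont f x) -> (forall x, a < x -> continuous g x) ->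
  (forall x, a < x -> is_derive G x (g x)) -> (forall x, a < x -> Cmod (f x) <= g x) ->
  filterlim G (at_right a) (locally la) -> filterlim G poo (locally lb) ->
  is_CInt_gen f (at_right a) poo (CInt_gen f (at_right a) poo).
Proof.
  intros Hf Hg HG Hfg Ha Hb. unfold CInt_gen.
  split; simpl; apply (RInt_gen_correct (V := R_CompleteNormedModule));
  apply ex_RInt_gen_dominated with g G la lb; auto.
  - intros; now apply Hf.
  - intros. eapply Rle_trans; [apply re_le_Cmod|auto].
  - intros; now apply Hf.
  - intros. eapply Rle_trans; [apply Im_le_Cmod|auto].
Qed.

Lemma is_RInt_gen_ge0 (f : R -> R) a (l : R) : (forall x, a < x -> 0 <= f x) ->
  is_RInt_gen f (at_right a) poo l -> 0 <= l.
Proof.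
  intros H Hl.
  assert (H0 : is_RInt_gen (fun _ : R => 0) (at_right a) poo 0).
  { assert (E : is_RInt_gen (fun _ : R => 0) (at_right a) poo (0 - 0)).
    2: now rewrite Rminus_0_r in E.
    apply is_RInt_gen_FTC with (fun _ => 0); intros; try apply filterlim_const.
    apply (is_derive_const (K := R_AbsRing) (V := R_NormedModule) 0 x). }
  rewrite <- (@norm_zero R_AbsRing R_NormedModule).
  apply (RInt_gen_norm (V := R_CompleteNormedModule) (fun _ => 0) f 0 l (Fa := at_right a) (Fb := poo)); auto.
  - apply (filter_imp (F := filter_prod (at_right a) poo) _ _) with (2 := at_right_poo a). intros [u v]; simpl; lra.
  - apply (filter_imp (F := filter_prod (at_right a) poo) _ _) with (2 := at_right_poo a). intros [u v] Huv x Hx; simpl in *.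
    change (norm 0) with (Rabs 0). rewrite Rabs_R0. apply H; lra.
Qed.

Lemma is_RInt_gen_le (f g : R -> R) a (lf lg : R) : (forall x, a < x -> f x <= g x) ->
  is_RInt_gen f (at_right a) poo lf -> is_RInt_gen g (at_right a) poo lg -> lf <= lg.
Proof.
  intros H Hf Hg. assert (0 <= lg - lf); [|lra].
  apply is_RInt_gen_ge0 with (fun x => g x - f x) a; [intros x Hx; specialize (H x Hx); lra|].
  apply (is_RInt_gen_minus (V := R_NormedModule) g f lg lf Hg Hf).
Qed.

(** The interval [[a + 1, a + 2]] contributes a positive amount [c]. If [l <= 0], integrals over all
    large enough intervals would be below [c], although one of them contains [[a + 1, a + 2]] and
    [f] is positive. *)
Lemma is_RInt_gen_gt0 (f : R -> R) a (l : R) : (forall x, a < x -> continuous f x) ->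
  (forall x, a < x -> 0 < f x) -> is_RInt_gen f (at_right a) poo l -> 0 < l.
Proof.
  intros Hc H Hl.
  assert (E : forall u v, a < u <= v -> ex_RInt f u v).
  { intros. apply ex_RInt_cont; [lra|]. intros; apply Hc; lra. }
  set (c := RInt f (a + 1) (a + 2)).
  assert (Hcp : 0 < c).
  { apply RInt_gt_0; [lra|intros; apply H; lra|]. intros; apply Hc; lra. }
  apply Rnot_le_lt. intros Hn.
  assert (Hl2 := Hl (fun y => y < c)).
  assert (HQ : locally l (fun y => y < c)) by (apply (open_lt c l); lra).
  specialize (Hl2 HQ). unfold filtermapi in Hl2.
  assert (HP : filter_prod (at_right a) poo (fun ab => a < fst ab < a + 1 /\ a + 2 < snd ab)).
  { apply Filter_prod with (fun x => a < x < a + 1) (fun x => a + 2 < x).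
    - exists (mkposreal 1 Rlt_0_1). intros y Hy Hay.
      unfold_ball_in Hy.
      apply Rabs_def2 in Hy. lra.
    - apply poo_gt.
    - intros; simpl; lra. }
  destruct (filter_ex _ (filter_and _ _ Hl2 HP)) as [[u v] [[y [Hy Hyc]] [H1 H2]]]. simpl in *.
  apply (is_RInt_unique (V := R_CompleteNormedModule)) in Hy.
  rewrite <- (RInt_RChasles f u (a + 1) v) in Hy by (apply E; lra).
  rewrite <- (RInt_RChasles f (a + 1) (a + 2) v) in Hy by (apply E; lra).
  assert (0 <= RInt f u (a + 1)) by (apply RInt_ge_0; [lra|apply E; lra|intros; left; apply H; lra]).
  assert (0 <= RInt f (a + 2) v) by (apply RInt_ge_0; [lra|apply E; lra|intros; left; apply H; lra]).
  fold c in Hy. change (y < c) in Hyc. lra.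
Qed.

(** * The Gamma function has no zero in the right half-plane *)

Definition Gamma_integrand (z : C) (t : R) : C := (cpow t (z - 1) * RtoC (exp (- t)))%C.

Lemma exp_le_mono x y : x <= y -> exp x <= exp y.
Proof. intros [H|H]; [left; now apply exp_increasing|right; now rewrite H]. Qed.

Lemma ln_le_sub1 u : 0 < u -> ln u <= u - 1.
Proof. intros H. pose proof (exp_ineq1_le (ln u)) as E. rewrite exp_ln in E by exact H. lra. Qed.

(** The exponent [p ln (1 + t) - t] is maximal at [1 + t = p]; the bound is [ln u <= u - 1] at
    [u = (1 + t) / p]. *)
Lemma Rpower_exp_bound p t : 0 < p -> 0 <= t ->
  Rpower (1 + t) p * exp (- t) <= exp (1 - p + p * ln p).
Proof.
  intros Hp Ht. unfold Rpower. rewrite <- exp_plus. apply exp_le_mono.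
  assert (H : ln ((1 + t) / p) <= (1 + t) / p - 1).
  { apply ln_le_sub1. apply Rdiv_lt_0_compat; lra. }
  rewrite ln_div in H by lra.
  apply (Rmult_le_compat_l p) in H; [|lra].
  replace (p * ((1 + t) / p - 1)) with (1 + t - p) in H by (field; lra). lra.
Qed.

Lemma Gamma_integrand_cont z t : 0 < t -> ccont (Gamma_integrand z) t.
Proof.
  intros H. apply ccont_mult; [now apply ccont_cpow|]. apply ccont_RtoC.
  apply continuous_exp_comp. apply (continuous_opp (V := R_NormedModule)). apply continuous_id.
Qed.

Lemma lim_inv_poo (a : R) : filterlim (fun t => / (a + t)) poo (locally 0).
Proof.
  apply (filterlim_comp _ _ _ (fun t => a + t) Rinv poo poo (locally 0)).
  - intros P [y Hy]. exists (y - a). intros x Hx. apply Hy. lra.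
  - apply (filterlim_Rbar_inv p_infty). discriminate.
Qed.

Lemma lim_frac_poo : filterlim (fun t => t / (1 + t)) poo (locally 1).
Proof.
  apply filterlim_ext_loc with (fun t => 1 - / (1 + t)).
  - exists 0. intros x Hx. field. lra.
  - pose proof (flim_minus (fun _ : R => 1) (fun t => / (1 + t)) 1 0 (F := poo)
      (filterlim_const _) (lim_inv_poo 1)) as L.
    now rewrite Rminus_0_r in L.
Qed.

Lemma lim_frac_0 : filterlim (fun t => t / (1 + t)) (at_right 0) (locally 0).
Proof.
  assert (C : continuous (fun t => t / (1 + t)) 0).
  { apply (ex_derive_continuous (fun t => t / (1 + t))). auto_derive. lra. }
  unfold continuous in C. replace (0 / (1 + 0)) with 0 in C by field.
  exact (filterlim_filter_le_1 _ (@filter_le_within _ (locally 0) _ _) C).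
Qed.

(** With [K] a bound for [(1 + t)^(s+1) e^(-t)], the integrand is at most
    [K t^(s-1) / (1 + t)^(s+1)], whose primitive is [(K / s) (t / (1 + t))^s]. This single majorant
    settles both ends, as its primitive tends to [0] at [0] and to [K / s] at infinity. *)
Lemma Gamma_correct z : 0 < Re z -> is_CInt_gen (Gamma_integrand z) (at_right 0) poo (Gamma z).
Proof.
  intros Hz. set (s := Re z) in *. set (K := exp (1 - (s + 1) + (s + 1) * ln (s + 1))).
  set (P := fun t => K / s * Re (ppow (t / (1 + t)) (RtoC s))).
  apply ex_CInt_gen_dominated with
    (g := fun t => K * (Rpower (t / (1 + t)) (s - 1) * (/ (1 + t) ^ 2)))
    (G := P) (la := K / s * 0) (lb := K / s * 1).
  - intros; now apply Gamma_integrand_cont.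
  - intros x Hx. apply (ex_derive_continuous (V := R_NormedModule)).
    unfold Rpower. auto_derive.
    repeat split; try lra; [apply Rdiv_lt_0_compat; lra|]. apply Rgt_not_eq. nra.
  - intros x Hx.
    apply is_derive_ext_loc with (fun t => K / s * Rpower (t / (1 + t)) s).
    { eapply filter_imp; [|apply locally_pos, Hx]. intros t Ht; simpl in Ht. unfold P.
      rewrite ppow_pos, cpow_R; [reflexivity|]. apply Rdiv_lt_0_compat; lra. }
    assert (Hf : 0 < x / (1 + x)) by (apply Rdiv_lt_0_compat; lra).
    unfold Rpower. auto_derive. { split; [lra|]. split; auto. }
    replace ((s - 1) * ln (x / (1 + x))) with (s * ln (x / (1 + x)) - ln (x / (1 + x))) by ring.
    unfold Rminus. rewrite exp_plus, exp_Ropp, exp_ln by exact Hf.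
    change (x * / (1 + x)) with (x / (1 + x)). generalize (exp (s * ln (x / (1 + x)))). intros e. field. lra.
  - intros x Hx. unfold Gamma_integrand. rewrite Cmod_mult, Cmod_cpow, Cmod_R.
    rewrite Rabs_pos_eq by (left; apply exp_pos).
    replace (Re (z - 1)%C) with (s - 1) by (unfold s; simpl; unfold Re; ring).
    pose proof (Rpower_exp_bound (s + 1) x ltac:(lra) ltac:(lra)) as B. fold K in B.
    unfold Rdiv. rewrite <- Rpower_mult_distr; [|lra|apply Rinv_0_lt_compat; lra].
    replace (Rpower (/ (1 + x)) (s - 1)) with (/ Rpower (1 + x) (s + 1) * (1 + x) ^ 2).
    + replace (K * _) with (Rpower x (s - 1) * (K * / Rpower (1 + x) (s + 1)))
        by (field; split; [lra|apply Rgt_not_eq, exp_pos]).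
      apply Rmult_le_compat_l; [left; apply exp_pos|].
      assert (HR : 0 < Rpower (1 + x) (s + 1)) by apply exp_pos.
      apply Rmult_le_reg_l with (Rpower (1 + x) (s + 1)); [exact HR|].
      replace (Rpower (1 + x) (s + 1) * (K * / Rpower (1 + x) (s + 1))) with K by (field; lra).
      exact B.
    + rewrite <- (Rpower_pow 2) by lra. simpl INR.
      unfold Rpower. rewrite <- exp_Ropp, <- exp_plus. f_equal. rewrite ln_Rinv by lra. ring.
  - unfold P. apply flim_mult; [apply filterlim_const|].
    pose proof (ccont_ppow 0 (RtoC s) Hz) as [C _]. unfold continuous in C.
    rewrite ppow_neg in C by lra.
    eapply (filterlim_comp _ _ _ (fun t => t / (1 + t)) (fun y => Re (ppow y (RtoC s))));
      [apply lim_frac_0|exact C].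
  - unfold P. apply flim_mult; [apply filterlim_const|].
    pose proof (ccont_ppow 1 (RtoC s) Hz) as [C _]. unfold continuous in C.
    rewrite ppow_pos, cpow_base1 in C by lra.
    eapply (filterlim_comp _ _ _ (fun t => t / (1 + t)) (fun y => Re (ppow y (RtoC s))));
      [apply lim_frac_poo|exact C].
Qed.

Lemma Gamma_S z : 0 < Re z -> Gamma (z + 1)%C = (z * Gamma z)%C.
Proof.
  intros Hz. assert (Hz1 : 0 < Re (z + 1)%C) by (simpl; unfold Re in *; lra).
  (* The integrand is the derivative of [t^z e^(-t)], which vanishes at both ends. *)
  assert (H0 : is_CInt_gen (fun t => z * Gamma_integrand z t + - (1) * Gamma_integrand (z + 1) t)%C (at_right 0) poo (0 - 0)%C).
  { apply is_CInt_gen_FTC with (fun t => ppow t z * RtoC (exp (- t)))%C.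
    - intros t Ht. apply cder_ext_loc with (fun t => cpow t z * RtoC (exp (- t)))%C.
      + eapply filter_imp; [|apply locally_pos, Ht]. intros u Hu; simpl in Hu. now rewrite ppow_pos.
      + eapply cder_eq.
        * apply cder_mult; [now apply cder_cpow|]. apply cder_RtoC.
          instantiate (1 := - exp (- t)). auto_derive; auto. ring.
        * unfold Gamma_integrand. replace (z + 1 - 1)%C with z by ring. rewrite RtoC_opp. ring.
    - intros t Ht. apply ccont_plus; apply ccont_mult; try apply ccont_const; now apply Gamma_integrand_cont.
    - pose proof (ccont_ppow 0 z Hz) as C1. apply ccont_at_right in C1.
      rewrite ppow_neg in C1 by lra.
      apply clim_eq with (0 * RtoC (exp (- 0)))%C; [|ring].
      apply clim_mult; [exact C1|]. apply (ccont_at_right (fun t => RtoC (exp (- t)))).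
      apply ccont_RtoC. apply continuous_exp_comp. apply (continuous_opp (V := R_NormedModule)), continuous_id.
    - set (s := Re z) in *. set (K := exp (1 - (s + 1) + (s + 1) * ln (s + 1))).
      apply clim_squeeze with (fun t => K * / (1 + t)).
      + exists 0. intros t Ht. replace (_ - 0)%C with (ppow t z * RtoC (exp (- t)))%C by ring.
        rewrite ppow_pos, Cmod_mult, Cmod_cpow, Cmod_R by exact Ht. fold s.
        rewrite Rabs_pos_eq by (left; apply exp_pos).
        pose proof (Rpower_exp_bound (s + 1) t ltac:(lra) ltac:(lra)) as B. fold K in B.
        rewrite Rpower_plus, Rpower_1 in B by lra.
        apply Rmult_le_reg_r with (1 + t); [lra|].
        rewrite Rmult_assoc, Rmult_assoc, Rinv_l, Rmult_1_r by lra.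
        eapply Rle_trans; [|exact B].
        rewrite (Rmult_assoc (Rpower (1 + t) s)). rewrite (Rmult_comm (1 + t)).
        apply Rmult_le_compat_r.
        * apply Rmult_le_pos; [left; apply exp_pos|lra].
        * apply Rle_Rpower_l; lra.
      + rewrite <- (Rmult_0_r K). apply flim_mult; [apply filterlim_const|apply lim_inv_poo]. }
  pose proof (is_CInt_gen_plus _ _ _ _ _ _ (is_CInt_gen_scal z _ _ _ _ (Gamma_correct z Hz))
    (is_CInt_gen_scal (- (1))%C _ _ _ _ (Gamma_correct (z + 1)%C Hz1))) as H1.
  pose proof (is_CInt_gen_unique _ _ _ _ H0) as E0.
  pose proof (is_CInt_gen_unique _ _ _ _ H1) as E1. cbv beta in E1. rewrite E0 in E1. clear H0 H1.
  replace (Gamma (z + 1)%C) with (z * Gamma z - (z * Gamma z + - (1) * Gamma (z + 1)))%C by ring.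
  rewrite <- E1. ring.
Qed.

Lemma cos_ge_quad u : 1 - u ^ 2 / 2 <= cos u.
Proof.
  assert (P : forall u, 0 <= u -> 1 - u ^ 2 / 2 <= cos u).
  { intros v Hv.
    assert (E : RInt (fun t => t - sin t) 0 v = (v ^ 2 / 2 + cos v) - (0 ^ 2 / 2 + cos 0)).
    { apply (RInt_FTC (fun t => t ^ 2 / 2 + cos t)); auto.
      - intros x _. auto_derive; auto. field.
      - intros x _. apply (ex_derive_continuous (V := R_NormedModule)). auto_derive; auto. }
    assert (0 <= RInt (fun t => t - sin t) 0 v).
    { apply RInt_ge_0; auto.
      - apply ex_RInt_cont; auto. intros x _. apply (ex_derive_continuous (V := R_NormedModule)). auto_derive; auto.
      - intros x Hx. pose proof (sin_lt_x x (proj1 Hx)). lra. }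
    rewrite cos_0 in E. lra. }
  destruct (Rle_dec 0 u); [now apply P|].
  rewrite <- cos_neg. replace (u ^ 2) with ((- u) ^ 2) by ring. apply P. lra.
Qed.

(** For [u = e^(2v)] the right-hand side is [(e^v - e^(-v))^2], so the inequality is the square of
    [2 |v| <= 2 sinh |v|]. *)
Lemma ln_sqr_le u : 0 < u -> ln u ^ 2 <= u - 2 + / u.
Proof.
  intros Hu. set (v := ln u / 2).
  assert (Q : forall v, 0 <= v -> 2 * v <= exp v - exp (- v)).
  { intros w Hw.
    assert (E : RInt (fun t => exp t + exp (- t) - 2) 0 w = (exp w - exp (- w) - 2 * w) - (exp 0 - exp (- 0) - 2 * 0)).
    { apply (RInt_FTC (fun t => exp t - exp (- t) - 2 * t)); auto.
      - intros x _. auto_derive; auto. ring.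
      - intros x _. apply (ex_derive_continuous (V := R_NormedModule)). auto_derive; auto. }
    assert (0 <= RInt (fun t => exp t + exp (- t) - 2) 0 w).
    { apply RInt_ge_0; auto.
      - apply ex_RInt_cont; auto. intros x _. apply (ex_derive_continuous (V := R_NormedModule)). auto_derive; auto.
      - intros x Hx. pose proof (exp_ineq1_le x). pose proof (exp_ineq1_le (- x)). lra. }
    rewrite Ropp_0, exp_0 in E. lra. }
  assert (S : (2 * v) ^ 2 <= (exp v - exp (- v)) ^ 2).
  { destruct (Rle_dec 0 v) as [H|H].
    - specialize (Q v H). nra.
    - specialize (Q (- v) ltac:(lra)). rewrite Ropp_involutive in Q. nra. }
  assert (E1 : exp v * exp v = u).
  { rewrite <- exp_plus. unfold v. replace (ln u / 2 + ln u / 2) with (ln u) by field. now apply exp_ln. }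
  assert (E2 : exp v * exp (- v) = 1) by (rewrite <- exp_plus, Rplus_opp_r; apply exp_0).
  assert (E3 : exp (- v) * exp (- v) = / u).
  { rewrite <- E1, Rinv_mult. now rewrite exp_Ropp. }
  replace (2 * v) with (ln u) in S by (unfold v; field). nra.
Qed.

Lemma Gamma_integrand_R x t : Gamma_integrand (RtoC x) t = RtoC (Rpower t (x - 1) * exp (- t)).
Proof. unfold Gamma_integrand. rewrite <- RtoC_minus, cpow_R, <- RtoC_mult. reflexivity. Qed.

(* The phase is rotated to vanish at [t = x], where [t^(x-1) e^(-t)] concentrates; [cos] is then
   bounded below by a combination of [t], [1] and [1/t], integrated by the functional equation. *)
Lemma Gamma_neq_0_large (x y : R) : 1 + y ^ 2 < x -> Gamma (x, y) <> 0%C.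
Proof.
  intros Hx E. assert (Hx1 : 1 < x) by nra.
  assert (HR : forall u, 0 < u -> is_RInt_gen (fun t => Rpower t (u - 1) * exp (- t)) (at_right 0) poo (Re (Gamma (RtoC u)))).
  { intros u Hu. destruct (Gamma_correct (RtoC u) Hu) as [H _].
    apply (is_RInt_gen_ext (fun t => Re (Gamma_integrand (RtoC u) t))); [|exact H].
    apply filter_forall. intros ab t _. now rewrite Gamma_integrand_R. }
  assert (HS : forall u, 0 < u -> Re (Gamma (RtoC (u + 1))) = u * Re (Gamma (RtoC u))).
  { intros u Hu. rewrite RtoC_plus, Gamma_S by exact Hu. simpl. unfold Re; ring. }
  set (g := Re (Gamma (RtoC x))).
  assert (Hg : 0 < g).
  { apply is_RInt_gen_gt0 with (fun t => Rpower t (x - 1) * exp (- t)) 0; [| |apply HR; lra].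
    - intros t Ht. apply (ex_derive_continuous (V := R_NormedModule)). unfold Rpower. auto_derive; auto.
    - intros t Ht. apply Rmult_lt_0_compat; apply exp_pos. }
  assert (Hz : 0 < Re (x, y)) by (simpl; lra).
  (* Multiplication by [x^(-iy)] turns the phase [t^(iy)] into [(t / x)^(iy)]. If Gamma vanishes at
     [(x, y)], the real part of the rotated integral is [0]. *)
  pose proof (is_CInt_gen_scal (cpow x (0, - y)) _ _ _ _ (Gamma_correct (x, y) Hz)) as [H1 _].
  rewrite E, Cmult_0_r in H1. simpl (Re 0) in H1.
  (* This is [t^(x-1) e^(-t)] times [1 - y^2 (t/x - 2 + x/t) / 2]. The second factor bounds
     [cos (y ln (t/x))] from below, by [cos_ge_quad] and [ln_sqr_le]. *)
  set (h := fun t => (1 + y ^ 2) * (Rpower t (x - 1) * exp (- t)) -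
     (y ^ 2 / (2 * x) * (Rpower t (x + 1 - 1) * exp (- t)) + x * y ^ 2 / 2 * (Rpower t (x - 1 - 1) * exp (- t)))).
  assert (H2 : is_RInt_gen h (at_right 0) poo
    ((1 + y ^ 2) * g - (y ^ 2 / (2 * x) * Re (Gamma (RtoC (x + 1))) + x * y ^ 2 / 2 * Re (Gamma (RtoC (x - 1)))))).
  { apply (is_RInt_gen_minus (V := R_NormedModule)).
    - apply (is_RInt_gen_scal (V := R_NormedModule)). apply HR; lra.
    - apply (is_RInt_gen_plus (V := R_NormedModule));
      apply (is_RInt_gen_scal (V := R_NormedModule)); apply HR; lra. }
  assert (Hle : (1 + y ^ 2) * g - (y ^ 2 / (2 * x) * Re (Gamma (RtoC (x + 1))) + x * y ^ 2 / 2 * Re (Gamma (RtoC (x - 1)))) <= 0).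
  { refine (is_RInt_gen_le _ _ 0 _ _ _ H2 H1). intros t Ht. unfold h.
    replace (cpow x (0%R, (- y)%R) * Gamma_integrand (x, y) t)%C with
      (RtoC (Rpower t (x - 1) * exp (- t)) * cexp (0%R, (y * ln (t / x))%R))%C.
    - replace (Re _) with (Rpower t (x - 1) * exp (- t) * cos (y * ln (t / x)))
        by (unfold cexp; simpl; rewrite exp_0; unfold Re; simpl; ring).
      replace (Rpower t (x + 1 - 1)) with (Rpower t (x - 1) * t)
        by (replace (x + 1 - 1) with (x - 1 + 1) by ring; rewrite Rpower_plus, Rpower_1 by exact Ht; ring).
      replace (Rpower t (x - 1 - 1)) with (Rpower t (x - 1) * / t)
        by (unfold Rminus at 2; rewrite Rpower_plus, Rpower_Ropp, Rpower_1 by exact Ht; ring).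
      set (w := Rpower t (x - 1) * exp (- t)).
      assert (0 < w) by (apply Rmult_lt_0_compat; apply exp_pos).
      pose proof (cos_ge_quad (y * ln (t / x))) as B1.
      pose proof (ln_sqr_le (t / x) ltac:(apply Rdiv_lt_0_compat; lra)) as B2.
      replace (/ (t / x)) with (x * / t) in B2 by (field; lra).
      replace (_ - _) with (w * (1 - y ^ 2 * (t / x - 2 + x * / t) / 2)) by (unfold w; field; lra).
      apply Rmult_le_compat_l; [lra|].
      assert (0 <= y ^ 2) by apply pow2_ge_0.
      assert (y ^ 2 * ln (t / x) ^ 2 <= y ^ 2 * (t / x - 2 + x * / t)) by (apply Rmult_le_compat_l; lra).
      replace ((y * ln (t / x)) ^ 2) with (y ^ 2 * ln (t / x) ^ 2) in B1 by ring. lra.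
    - unfold Gamma_integrand, cpow. rewrite RtoC_mult. unfold Rpower.
      assert (A : RtoC (exp ((x - 1) * ln t)) = cexp (RtoC ((x - 1) * ln t))).
      { unfold cexp, RtoC; simpl. rewrite cos_0, sin_0. f_equal; ring. }
      rewrite A. rewrite ln_div by lra.
      replace (cexp (RtoC ((x - 1) * ln t)) * RtoC (exp (- t)) * cexp (0%R, (y * (ln t - ln x))%R))%C with
        (cexp (RtoC ((x - 1) * ln t) + (0%R, (y * (ln t - ln x))%R)) * RtoC (exp (- t)))%C
        by (rewrite cexp_plus; ring).
      rewrite Cmult_assoc, <- cexp_plus. f_equal. f_equal. apply C_ext; simpl; ring. }
  rewrite HS in Hle by lra. fold g in Hle.
  assert (Eg : Re (Gamma (RtoC (x - 1))) = g / (x - 1)).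
  { unfold g. replace x with (x - 1 + 1) at 2 by ring. rewrite HS by lra. field. lra. }
  rewrite Eg in Hle.
  (* The integral of [h] is [g (1 - y^2 / (2 (x - 1)))], which is positive because [y^2 < x - 1]. *)
  replace ((1 + y ^ 2) * g - (y ^ 2 / (2 * x) * (x * g) + x * y ^ 2 / 2 * (g / (x - 1))))
    with (g * (1 - y ^ 2 / (2 * (x - 1)))) in Hle by (field; lra).
  assert (0 < 1 - y ^ 2 / (2 * (x - 1))).
  { apply Rmult_lt_reg_r with (2 * (x - 1)); [lra|]. rewrite Rmult_0_l, Rmult_minus_distr_r.
    replace (y ^ 2 / (2 * (x - 1)) * (2 * (x - 1))) with (y ^ 2) by (field; lra). nra. }
  nra.
Qed.

Lemma Gamma_neq_0 z : 0 < Re z -> Gamma z <> 0%C.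
Proof.
  intros Hz. destruct z as [x y]. simpl in Hz.
  assert (H : forall n : nat, Gamma (x + INR n, y) <> 0%C -> Gamma (x, y) <> 0%C).
  { induction n as [|n IH].
    - simpl. now rewrite Rplus_0_r.
    - intros H. apply IH. intros E. apply H.
      replace (x + INR (S n), y) with (((x + INR n)%R, y) + 1)%C
        by (rewrite S_INR; apply C_ext; simpl; ring).
      rewrite Gamma_S, E; [ring|]. simpl. pose proof (pos_INR n). lra. }
  destruct (INR_unbounded (1 + y ^ 2)) as [n Hn].
  apply (H n). apply Gamma_neq_0_large. lra.
Qed.

(** * Two Fourier integrals *)

Section RealContinuity.
Context {T : UniformSpace}.
Implicit Types (f g : T -> R) (x : T).
Lemma rc_plus f g x : continuous f x -> continuous g x -> continuous (fun t => f t + g t) x.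
Proof. apply (continuous_plus (V := R_NormedModule)). Qed.
Lemma rc_minus f g x : continuous f x -> continuous g x -> continuous (fun t => f t - g t) x.
Proof. apply (continuous_minus (V := R_NormedModule)). Qed.
Lemma rc_mult f g x : continuous f x -> continuous g x -> continuous (fun t => f t * g t) x.
Proof. apply (continuous_mult (K := R_AbsRing)). Qed.
Lemma rc_opp f x : continuous f x -> continuous (fun t => - f t) x.
Proof. apply (continuous_opp (V := R_NormedModule)). Qed.
Lemma rc_inv f x : continuous f x -> f x <> 0 -> continuous (fun t => / f t) x.
Proof. intros H H0. apply (continuous_comp f Rinv); [exact H|]. now apply continuous_Rinv. Qed.
Lemma rc_div f g x : continuous f x -> continuous g x -> g x <> 0 -> continuous (fun t => f t / g t) x.
Proof. intros. apply rc_mult; auto. now apply rc_inv. Qed.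
Lemma rc_pow f n x : continuous f x -> continuous (fun t => f t ^ n) x.
Proof.
  intros H. apply (continuous_comp f (fun y => y ^ n)); [exact H|].
  apply (ex_derive_continuous (V := R_NormedModule)). auto_derive; auto.
Qed.
Lemma rc_cos f x : continuous f x -> continuous (fun t => cos (f t)) x.
Proof. intros H. apply (continuous_comp f cos); [exact H|apply continuous_cos]. Qed.
Lemma rc_sin f x : continuous f x -> continuous (fun t => sin (f t)) x.
Proof. intros H. apply (continuous_comp f sin); [exact H|apply continuous_sin]. Qed.
Lemma rc_exp f x : continuous f x -> continuous (fun t => exp (f t)) x.
Proof. intros H. apply (continuous_comp f exp); [exact H|apply continuous_exp]. Qed.
Lemma rc_cosh f x : continuous f x -> continuous (fun t => cosh (f t)) x.
Proof.
  intros H. apply (continuous_comp f cosh); [exact H|].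
  apply (ex_derive_continuous (V := R_NormedModule)). auto_derive; auto.
Qed.
Lemma rc_sinh f x : continuous f x -> continuous (fun t => sinh (f t)) x.
Proof.
  intros H. apply (continuous_comp f sinh); [exact H|].
  apply (ex_derive_continuous (V := R_NormedModule)). auto_derive; auto.
Qed.
End RealContinuity.

Ltac eqR := match goal with |- @eq _ ?a ?b => change (@eq R a b) end.

(** Syntax-directed continuity: what remains is the nonvanishing of denominators. The cases with a
    partially applied operation catch functions that unification has eta-reduced. *)
Ltac rcont :=
  first [ apply continuous_const | apply continuous_id | apply continuous_fst | apply continuous_snd |
  lazymatch goal with
  | |- continuous cosh _ => apply (rc_cosh (fun t => t)), continuous_id
  | |- continuous sinh _ => apply (rc_sinh (fun t => t)), continuous_id
  | |- continuous cos _ => apply continuous_cos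
  | |- continuous sin _ => apply continuous_sin
  | |- continuous exp _ => apply continuous_exp
  | |- continuous Ropp _ => apply (rc_opp (fun t => t)), continuous_id
  | |- continuous (Rmult ?m) _ => apply (rc_mult (fun _ => m) (fun t => t)); [apply continuous_const|apply continuous_id]
  | |- continuous (Rplus ?m) _ => apply (rc_plus (fun _ => m) (fun t => t)); [apply continuous_const|apply continuous_id]
  | |- continuous (Rminus ?m) _ => apply (rc_minus (fun _ => m) (fun t => t)); [apply continuous_const|apply continuous_id]
  | |- continuous (fun t => cosh _) _ => apply rc_cosh; rcont
  | |- continuous (fun t => sinh _) _ => apply rc_sinh; rcont
  | |- continuous (fun t => cos _) _ => apply rc_cos; rcont
  | |- continuous (fun t => sin _) _ => apply rc_sin; rcont
  | |- continuous (fun t => exp _) _ => apply rc_exp; rcont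
  | |- continuous (fun t => _ + _) _ => apply rc_plus; rcont
  | |- continuous (fun t => _ - _) _ => apply rc_minus; rcont
  | |- continuous (fun t => - _) _ => apply rc_opp; rcont
  | |- continuous (fun t => _ / _) _ => apply rc_div; [rcont | rcont | ]
  | |- continuous (fun t => _ * _) _ => apply rc_mult; rcont
  | |- continuous (fun t => / _) _ => apply rc_inv; [rcont | ]
  | |- continuous (fun t => _ ^ _) _ => apply rc_pow; rcont
  | |- _ => idtac
  end ].

(** * Inequalities for hyperbolic functions *)

Lemma cosh_sqr x : cosh x * cosh x = 1 + sinh x * sinh x.
Proof.
  unfold cosh, sinh. assert (E : exp x * exp (- x) = 1) by (rewrite <- exp_plus, Rplus_opp_r; apply exp_0).
  nra.
Qed.

Lemma cosh_even x : cosh (- x) = cosh x.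
Proof. unfold cosh. rewrite Ropp_involutive. lra. Qed.

Lemma sinh_ge_x x : 0 <= x -> x <= sinh x.
Proof.
  intros H.
  assert (E : RInt (fun t => cosh t - 1) 0 x = (sinh x - x) - (sinh 0 - 0)).
  { apply (RInt_FTC (fun t => sinh t - t)); auto.
    - intros t _. auto_derive; auto. ring.
    - intros t _. rcont. }
  assert (0 <= RInt (fun t => cosh t - 1) 0 x).
  { apply RInt_ge_0; auto.
    - apply ex_RInt_cont; auto. intros; rcont.
    - intros t Ht. unfold cosh. pose proof (exp_ineq1_le t). pose proof (exp_ineq1_le (- t)). lra. }
  rewrite sinh_0 in E. lra.
Qed.

Lemma cosh_quad x : 1 + x ^ 2 / 2 <= cosh x.
Proof.
  assert (P : forall x, 0 <= x -> 1 + x ^ 2 / 2 <= cosh x).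
  { clear x. intros x H.
    assert (E : RInt (fun t => sinh t - t) 0 x = (cosh x - x ^ 2 / 2) - (cosh 0 - 0 ^ 2 / 2)).
    { apply (RInt_FTC (fun t => cosh t - t ^ 2 / 2)); auto.
      - intros t _. auto_derive; auto. field.
      - intros t _. rcont. }
    assert (0 <= RInt (fun t => sinh t - t) 0 x).
    { apply RInt_ge_0; auto.
      - apply ex_RInt_cont; auto. intros; rcont.
      - intros t Ht. pose proof (sinh_ge_x t). lra. }
    rewrite cosh_0 in E. lra. }
  destruct (Rle_dec 0 x); [now apply P|].
  rewrite <- cosh_even. replace (x ^ 2) with ((- x) ^ 2) by ring. apply P. lra.
Qed.

Lemma cosh_ge_1 x : 1 <= cosh x.
Proof. pose proof (cosh_quad x). pose proof (pow2_ge_0 x). lra. Qed.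

Lemma cosh_gt_1 x : 0 < x -> 1 < cosh x.
Proof. intros. pose proof (cosh_quad x). nra. Qed.

Lemma sinh_nonneg x : 0 <= x -> 0 <= sinh x.
Proof. intros H. pose proof (sinh_ge_x x H). lra. Qed.

Lemma cosh_mono x y : 0 <= x <= y -> cosh x <= cosh y.
Proof.
  intros H.
  assert (E : RInt (fun t => sinh t) x y = cosh y - cosh x).
  { apply (RInt_FTC cosh); try lra.
    - intros t _. auto_derive; auto. ring.
    - intros t _. rcont. }
  assert (0 <= RInt (fun t => sinh t) x y).
  { apply RInt_ge_0; try lra.
    - apply ex_RInt_cont; [lra|]. intros; rcont.
    - intros t Ht. apply sinh_nonneg. lra. }
  lra.
Qed.

Lemma sinh_mono x y : x <= y -> sinh x <= sinh y.
Proof. intros [H|H]; [left; now apply sinh_lt|right; now rewrite H]. Qed.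

Ltac coshpos :=
  cbv beta; cbn [fst snd]; try apply pow_nonzero; try apply Rgt_not_eq;
  repeat match goal with |- context [cosh ?u] =>
    lazymatch goal with H : 1 <= cosh u |- _ => fail | _ => pose proof (cosh_ge_1 u) end end;
  lra.
Ltac exint := apply ex_RInt_cont; [lra|]; intros; cbv beta; rcont; coshpos.

(** Both sides are the integral of [D] over the rectangle [[0, S] x [0, T]], integrated first in [t]
    or first in [s]. *)
Lemma RInt_Green (A B D : R -> R -> R) S T : 0 <= S -> 0 <= T ->
  (forall s t, 0 <= s <= S -> 0 <= t <= T -> is_derive (fun t => A s t) t (D s t)) ->
  (forall s t, 0 <= s <= S -> 0 <= t <= T -> is_derive (fun s => B s t) s (D s t)) ->
  cont2_on D 0 S 0 T ->
  RInt (fun s => A s T - A s 0) 0 S = RInt (fun t => B S t - B 0 t) 0 T.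
Proof.
  intros HS HT HA HB HD.
  rewrite (RInt_ext _ (fun s => RInt (fun t => D s t) 0 T)).
  2:{ intros s. rewrite Rmin_left, Rmax_right by lra. intros Hs. symmetry.
      apply (RInt_FTC (fun t => A s t)); auto.
      - intros t Ht. apply HA; lra.
      - intros t Ht. apply (cont2_snd D s t). apply HD; lra. }
  rewrite RInt_Fubini by assumption.
  apply RInt_ext. intros t. rewrite Rmin_left, Rmax_right by lra. intros Ht.
  apply (RInt_FTC (fun s => B s t)); auto.
  - intros s Hs. apply HB; lra.
  - intros s Hs. apply (cont2_fst D s t). apply HD; lra.
Qed.

Lemma RInt_le_const (f : R -> R) K a b : a <= b -> (forall x, a <= x <= b -> continuous f x) ->
  (forall x, a <= x <= b -> Rabs (f x) <= K) -> Rabs (RInt f a b) <= (b - a) * K.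
Proof. intros. apply abs_RInt_le_const; auto. now apply ex_RInt_cont. Qed.

(** Bounds the flux through the edge [s = S] in both applications of Green's identity. There the
    arguments [C] and [S] are [cosh S] and [sinh S], so it vanishes as the edge moves to
    infinity. *)
Definition tail_err (m C S : R) := S / (C - 1) ^ 2 + m / (C - 1).

(** Stated for an abstract denominator [N >= C - 1] and numerator [f], since it serves both
    [sinh t / (cosh S + cosh t)] and [sin t / (cosh S + cos t)]. *)
Lemma tail_err_bound m C s N u w k : 0 <= m -> 1 < C -> 0 <= s -> C - 1 <= N -> 0 <= k ->
  Rabs u <= 1 -> Rabs w <= 1 -> forall f, Rabs f <= k ->
  Rabs (- f * s / N ^ 2 * u + m * (f / N) * w) <= k * tail_err m C s.
Proof.
  intros Hm HC Hs HN Hk Hu Hw f Hf.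
  assert (H1 : / N ^ 2 <= / (C - 1) ^ 2) by (apply Rinv_le_contravar; nra).
  assert (H2 : / N <= / (C - 1)) by (apply Rinv_le_contravar; lra).
  assert (0 < / N ^ 2) by (apply Rinv_0_lt_compat; nra).
  assert (0 < / N) by (apply Rinv_0_lt_compat; lra).
  eapply Rle_trans; [apply Rabs_triang|]. unfold tail_err, Rdiv.
  rewrite Rmult_plus_distr_l. rewrite !Rabs_mult, Rabs_Ropp.
  rewrite (Rabs_pos_eq s), (Rabs_pos_eq m), (Rabs_pos_eq (/ N)), (Rabs_pos_eq (/ N ^ 2)) by lra.
  pose proof (Rabs_pos f). pose proof (Rabs_pos u). pose proof (Rabs_pos w).
  apply Rplus_le_compat.
  - rewrite <- (Rmult_1_r (k * _)). apply Rmult_le_compat; try lra.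
    + apply Rmult_le_pos; [|lra]. apply Rmult_le_pos; lra.
    + rewrite <- Rmult_assoc. apply Rmult_le_compat; try lra.
      * apply Rmult_le_pos; lra.
      * apply Rmult_le_compat_r; lra.
  - rewrite <- (Rmult_1_r (k * _)). apply Rmult_le_compat; try lra.
    + apply Rmult_le_pos; [lra|]. apply Rmult_le_pos; lra.
    + rewrite Rmult_comm, Rmult_assoc. apply Rmult_le_compat; try lra.
      * apply Rmult_le_pos; lra.
      * rewrite Rmult_comm. apply Rmult_le_compat_l; lra.
Qed.

Lemma cos_abs u : Rabs (cos u) <= 1.
Proof. apply Rabs_le. pose proof (COS_bound u). lra. Qed.
Lemma sin_abs u : Rabs (sin u) <= 1.
Proof. apply Rabs_le. pose proof (SIN_bound u). lra. Qed.

(** The weight [1 / (1 + cosh s)] is half the square of the hyperbolic secant of [s / 2], and the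
    [t]-derivative at [t = 0] of the kernel of [wave_int]. *)
Definition sech_int (m S : R) := RInt (fun s => cos (m * s) / (1 + cosh s)) 0 S.
Definition wave_int (m S t : R) := RInt (fun s => cos (m * s) * (sinh t / (cosh s + cosh t))) 0 S.

(* [r = sinh t / (cosh s + cosh t)] solves the wave equation [r_tt = r_ss]; Green's identity
   against [sin (m (t - T)) cos (m s)]. *)
Lemma wave_int_sech_int m S T : 0 < m -> 0 < S -> 0 <= T <= PI ->
  Rabs (m * wave_int m S T - sin (m * T) * sech_int m S) <= PI * (sinh PI * tail_err m (cosh S) (sinh S)).
Proof.
  intros Hm HS HT.
  (* With [v = sin (m (t - T)) cos (m s)], [A = r_t v - r v_t] and [B = r_s v - r v_s]; both [A_t]
     and [B_s] equal [D = (r_ss + m^2 r) v]. *)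
  set (A := fun s t => ((cosh t * cosh s + 1) / (cosh s + cosh t) ^ 2 * sin (m * (t - T))
     - m * (sinh t / (cosh s + cosh t)) * cos (m * (t - T))) * cos (m * s)).
  set (B := fun s t => sin (m * (t - T)) *
     (- sinh t * sinh s / (cosh s + cosh t) ^ 2 * cos (m * s) + m * (sinh t / (cosh s + cosh t)) * sin (m * s))).
  set (D := fun s t => (- sinh t * cosh s / (cosh s + cosh t) ^ 2
     + 2 * sinh t * (cosh s * cosh s - 1) / (cosh s + cosh t) ^ 3
     + m * m * (sinh t / (cosh s + cosh t))) * sin (m * (t - T)) * cos (m * s)).
  assert (HN : forall s t, 0 < cosh s + cosh t) by (intros s t; pose proof (cosh_ge_1 s); pose proof (cosh_ge_1 t); lra).
  assert (G := RInt_Green A B D S T (Rlt_le _ _ HS) (proj1 HT)).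
  assert (G1 : RInt (fun s => A s T - A s 0) 0 S = RInt (fun t => B S t - B 0 t) 0 T).
  { apply G; clear G.
    - intros s t _ _. unfold A. specialize (HN s t).
      auto_derive. { repeat split; apply Rgt_not_eq; try nra. }
      unfold D. pose proof (cosh_sqr t) as E.
      replace (t + - T) with (t - T) by ring.
      (* With the functions replaced by variables, the goal is a rational identity modulo
         [ct * ct = 1 + st * st]. *)
      generalize dependent (sinh t). generalize dependent (cosh t). generalize dependent (cosh s).
      generalize (sin (m * (t - T))) (cos (m * (t - T))) (cos (m * s)).
      intros sn cn cm cs ct HN st E.
      assert (E' : ct * ct = 1 + st * st) by exact E.
      apply Rminus_diag_uniq.
      field_simplify_eq; [|lra].
      replace (st ^ 3) with (st * (ct * ct - 1)) by (rewrite E'; ring).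
      replace (st ^ 2) with (ct * ct - 1) by (rewrite E'; ring). ring.
    - intros s t _ _. unfold B. specialize (HN s t).
      auto_derive. { repeat split; apply Rgt_not_eq; try nra. }
      unfold D. rewrite (cosh_sqr s).
      replace (t + - T) with (t - T) by ring.
      field. lra.
    - intros s t _ _. unfold cont2, D. rcont; cbn [fst snd]; try apply pow_nonzero; apply Rgt_not_eq, HN. }
  (* On the edge [t = T] the factor [v] vanishes and [- r v_t] remains; on [t = 0] the kernel [r]
     vanishes and [r_t v] remains. *)
  assert (E1 : RInt (fun s => A s T - A s 0) 0 S = - (m * wave_int m S T - sin (m * T) * sech_int m S)).
  { unfold wave_int, sech_int.
    rewrite <- !RInt_Rscal; [| |].
    - rewrite <- RInt_Rminus.
      + replace (- RInt (fun x => m * (cos (m * x) * (sinh T / (cosh x + cosh T))) - sin (m * T) * (cos (m * x) / (1 + cosh x))) 0 S)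
          with (-1 * RInt (fun x => m * (cos (m * x) * (sinh T / (cosh x + cosh T))) - sin (m * T) * (cos (m * x) / (1 + cosh x))) 0 S) by ring.
        rewrite <- RInt_Rscal.
        * apply RInt_ext. intros s _. unfold A. rewrite Rminus_diag, Rminus_0_l, sinh_0, cosh_0.
          replace (m * - T) with (- (m * T)) by ring.
          rewrite Rmult_0_r, sin_0, cos_0, sin_neg. pose proof (HN s T). pose proof (HN s 0).
          rewrite cosh_0 in H0. eqR. field. split; lra.
        * exint.
      + exint.
      + exint.
    - exint.
    - exint. }
  rewrite <- Rabs_Ropp, <- E1, G1.
  apply Rle_trans with ((T - 0) * (sinh PI * tail_err m (cosh S) (sinh S))).
  - apply RInt_le_const; [lra| |].
    + intros t _. unfold B. rcont; try apply pow_nonzero; apply Rgt_not_eq, HN.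
    + intros t Ht. unfold B at 2. rewrite sinh_0, !Rmult_0_r, sin_0.
      replace (B S t - _) with (B S t) by (field; apply Rgt_not_eq, HN).
      unfold B. rewrite Rabs_mult.
      rewrite <- (Rmult_1_l (sinh PI * _)).
      apply Rmult_le_compat; try apply Rabs_pos; [apply sin_abs|].
      apply tail_err_bound; try apply cos_abs; try apply sin_abs; try lra.
      * now apply cosh_gt_1.
      * apply sinh_nonneg; lra.
      * pose proof (cosh_ge_1 t); lra.
      * apply sinh_nonneg. lra.
      * rewrite Rabs_pos_eq by (apply sinh_nonneg; lra). apply sinh_mono. lra.
  - apply Rmult_le_compat_r; [|lra].
    pose proof (sinh_nonneg PI ltac:(lra)). pose proof (cosh_gt_1 S HS). pose proof (sinh_nonneg S ltac:(lra)).
    apply Rmult_le_pos; [lra|]. unfold tail_err.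
    apply Rplus_le_le_0_compat; apply Rmult_le_pos; try lra; left; apply Rinv_0_lt_compat; nra.
Qed.

Lemma atan_le_id u : 0 <= u -> 0 <= atan u <= u.
Proof.
  intros H. split.
  - destruct H as [H|H]; [|rewrite <- H, atan_0; lra].
    rewrite <- atan_0. left. now apply atan_increasing.
  - assert (E : RInt (fun t => 1 - / (1 + t ^ 2)) 0 u = (u - atan u) - (0 - atan 0)).
    { apply (RInt_FTC (fun t => t - atan t)); auto.
      - intros t _. auto_derive; auto. unfold Rsqr. field. nra.
      - intros t _. rcont. nra. }
    assert (0 <= RInt (fun t => 1 - / (1 + t ^ 2)) 0 u).
    { apply RInt_ge_0; auto.
      - apply ex_RInt_cont; auto. intros; rcont. nra.
      - intros t Ht. assert (/ (1 + t ^ 2) <= / 1) by (apply Rinv_le_contravar; nra). lra. }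
    rewrite atan_0 in E. lra.
Qed.

Lemma cos_lt_1 e : 0 < e < PI -> cos e < 1.
Proof. intros H. rewrite <- cos_0. apply cos_decreasing_1; lra. Qed.

(** The integrand is a Poisson kernel in [s], whose mass on the half-line tends to [PI] with
    [e -> 0]. Its primitive is [2 atan ((e^s - cos e) / sin e)]; at [s = 0] the argument is
    [tan (e / 2)], which costs exactly [e], and near infinity the complementary arctangent is at
    most [e / (e^S - 1)]. *)
Lemma RInt_poisson e S : 0 < e < PI -> 0 < S ->
  Rabs (RInt (fun s => sin e / (cosh s - cos e)) 0 S - PI) <= 2 * (e / (exp S - 1)) + e.
Proof.
  intros He HS.
  assert (Hs : 0 < sin e) by (apply sin_gt_0; lra).
  pose proof (cos_lt_1 e He) as Hc.
  pose proof (sin2_cos2 e) as Hsc. unfold Rsqr in Hsc.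
  rewrite (RInt_FTC (fun s => 2 * atan ((exp s - cos e) / sin e))); [|lra| |].
  - rewrite exp_0.
    assert (E1 : atan ((1 - cos e) / sin e) = e / 2).
    { rewrite <- (atan_tan (e / 2)) by lra. f_equal. unfold tan.
      assert (0 < cos (e / 2)) by (apply cos_gt_0; lra).
      assert (0 < sin (e / 2)) by (apply sin_gt_0; lra).
      replace e with (2 * (e / 2)) at 1 2 by field. rewrite sin_2a, cos_2a_sin. field. split; lra. }
    rewrite E1.
    assert (Hx : 1 < exp S) by (rewrite <- exp_0; now apply exp_increasing).
    set (u := sin e / (exp S - cos e)).
    assert (Hu : 0 < u) by (apply Rdiv_lt_0_compat; lra).
    replace ((exp S - cos e) / sin e) with (/ u) by (unfold u; field; lra).
    rewrite atan_inv by exact Hu.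
    pose proof (atan_le_id u ltac:(lra)) as Ha.
    assert (Hu2 : u <= e / (exp S - 1)).
    { unfold u. pose proof (sin_lt_x e (proj1 He)).
      apply Rmult_le_compat; try lra.
      - left; apply Rinv_0_lt_compat; lra.
      - apply Rinv_le_contravar; lra. }
    replace (2 * (PI / 2 - atan u) - 2 * (e / 2) - PI) with (- (2 * atan u + e)) by field.
    rewrite Rabs_Ropp, Rabs_pos_eq by lra. lra.
  - intros s _. pose proof (cosh_ge_1 s).
    auto_derive; [lra|]. unfold Rsqr.
    pose proof (exp_pos s) as P.
    assert (EC : cosh s = (exp s + / exp s) / 2) by (unfold cosh; now rewrite exp_Ropp).
    rewrite EC in *. set (x := exp s) in *.
    assert (N : x * x - 2 * x * cos e + 1 <> 0).
    { replace (x * x - 2 * x * cos e + 1) with (Rsqr (x - cos e) + sin e * sin e) by (unfold Rsqr; lra).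
      pose proof (Rle_0_sqr (x - cos e)). apply Rgt_not_eq. nra. }
    assert (N3 : (x + / x) / 2 - cos e <> 0) by lra.
    apply Rmult_eq_reg_r with ((x + / x) / 2 - cos e); [|exact N3].
    replace (sin e / ((x + / x) / 2 - cos e) * ((x + / x) / 2 - cos e)) with (sin e)
      by (unfold Rdiv at 1; rewrite Rmult_assoc, Rinv_l by exact N3; ring).
    replace (1 + (x + - cos e) * / sin e * ((x + - cos e) * / sin e * 1)) with
      ((x * x - 2 * x * cos e + 1) / (sin e * sin e)).
    + field. repeat split; lra.
    + replace (x * x - 2 * x * cos e + 1) with (sin e * sin e + (x - cos e) * (x - cos e)) by lra. field. lra.
  - intros s _. rcont. pose proof (cosh_ge_1 s). lra.
Qed.

(** Half-angle formulas reduce this to [s / 2 <= sinh (s / 2)]. It bounds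
    [s sinh s / (cosh s - cos e)] independently of [e]. *)
Lemma sinh_half_bound S s : 0 <= s <= S -> s * sinh s <= 2 * cosh (S / 2) * (cosh s - 1).
Proof.
  intros H.
  assert (E1 : sinh s = 2 * sinh (s / 2) * cosh (s / 2)).
  { replace s with (s / 2 + s / 2) at 1 by field. unfold sinh, cosh. rewrite Ropp_plus_distr, !exp_plus. field. }
  assert (E2 : cosh s - 1 = 2 * (sinh (s / 2) * sinh (s / 2))).
  { replace s with (s / 2 + s / 2) at 1 by field. unfold sinh, cosh. rewrite Ropp_plus_distr, !exp_plus.
    assert (exp (s / 2) * exp (- (s / 2)) = 1) by (rewrite <- exp_plus, Rplus_opp_r; apply exp_0). nra. }
  rewrite E1, E2.
  pose proof (sinh_ge_x (s / 2) ltac:(lra)). pose proof (cosh_mono (s / 2) (S / 2) ltac:(lra)).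
  pose proof (cosh_ge_1 (s / 2)).
  assert (s * cosh (s / 2) <= 2 * sinh (s / 2) * cosh (S / 2)) by (apply Rmult_le_compat; lra).
  assert (0 <= sinh (s / 2)) by lra. nra.
Qed.

Lemma le_of_le_plus_vanishing (X Y : R) (d : R -> R) : continuous d 0 -> d 0 = 0 ->
  (forall e, 0 < e < 1 -> X <= Y + d e) -> X <= Y.
Proof.
  intros Hd H0 H. apply Rnot_lt_le. intros Hn.
  assert (Hp : 0 < X - Y) by lra.
  destruct (proj1 (filterlim_locally d _) Hd (mkposreal _ Hp)) as [[r Hr] Hb].
  set (e := Rmin (r / 2) (1 / 2)).
  assert (0 < e) by (unfold e; apply Rmin_pos; lra).
  assert (e < r) by (pose proof (Rmin_l (r / 2) (1 / 2)); unfold e; lra).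
  assert (e < 1) by (pose proof (Rmin_r (r / 2) (1 / 2)); unfold e; lra).
  specialize (H e ltac:(lra)).
  assert (B : ball (d 0) (X - Y) (d e)).
  { apply Hb. unfold ball; simpl; unfold AbsRing_ball, abs, minus, plus, opp; simpl.
    rewrite Ropp_0, Rplus_0_r, Rabs_pos_eq; lra. }
  unfold_ball_in B.
  rewrite H0, Ropp_0, Rplus_0_r in B. apply Rabs_def2 in B. lra.
Qed.

Section Sech.
Variables (m S : R).
Hypotheses (Hm : 0 < m) (HS : 0 < S).

(** With [q = sin t / (cosh s + cos t)] and [v = sinh (m (PI - t)) cos (m s)], [A = q_t v - q v_t]
    and [B = -(q_s v - q v_s)]. The opposite sign in [B], compared with the wave equation, reflects
    [q_tt = - q_ss]. *)
Let A s t := ((cos t * cosh s + 1) / (cosh s + cos t) ^ 2 * sinh (m * (PI - t))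
   + m * (sin t / (cosh s + cos t)) * cosh (m * (PI - t))) * cos (m * s).
Let B s t := - sinh (m * (PI - t)) *
   (- sin t * sinh s / (cosh s + cos t) ^ 2 * cos (m * s) + m * (sin t / (cosh s + cos t)) * sin (m * s)).
Let D s t := - (- sin t * cosh s / (cosh s + cos t) ^ 2
   + 2 * sin t * (cosh s * cosh s - 1) / (cosh s + cos t) ^ 3
   + m * m * (sin t / (cosh s + cos t))) * sinh (m * (PI - t)) * cos (m * s).

(** The denominator vanishes only at the corner [s = 0], [t = PI], which is why the rectangle is cut
    at [t = PI - e]. *)
Lemma sech_den s t : 0 <= t < PI -> 0 < cosh s + cos t.
Proof.
  intros H. pose proof (cosh_ge_1 s).
  assert (-1 < cos t) by (rewrite <- cos_PI; apply cos_decreasing_1; lra). lra.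
Qed.

(* [q = sin t / (cosh s + cos t)] is harmonic; Green's identity against [sinh (m (PI - t)) cos (m s)]. *)
Lemma sech_green e : 0 < e < PI ->
  Rabs (RInt (fun s => A s (PI - e)) 0 S - sinh (m * PI) * sech_int m S)
    <= PI * (sinh (m * PI) * tail_err m (cosh S) (sinh S)).
Proof.
  intros He.
  assert (G1 : RInt (fun s => A s (PI - e) - A s 0) 0 S = RInt (fun t => B S t - B 0 t) 0 (PI - e)).
  { apply (RInt_Green A B D S (PI - e)); try lra.
    - intros s t _ Ht. unfold A. pose proof (sech_den s t ltac:(lra)) as HN.
      auto_derive. { repeat split; apply Rgt_not_eq; try nra. }
      unfold D. pose proof (sin2_cos2 t) as E. unfold Rsqr in E.
      replace (PI + - t) with (PI - t) by ring.
      generalize dependent (sin t). generalize dependent (cos t). generalize dependent (cosh s).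
      generalize (sinh (m * (PI - t))) (cosh (m * (PI - t))) (cos (m * s)).
      intros sn cn cm cs ct HN st E.
      apply Rminus_diag_uniq.
      field_simplify_eq; [|lra].
      replace (st ^ 3) with (st * (1 - ct * ct)) by (rewrite <- E; ring).
      replace (st ^ 2) with (1 - ct * ct) by (rewrite <- E; ring). ring.
    - intros s t _ Ht. unfold B. pose proof (sech_den s t ltac:(lra)) as HN.
      auto_derive. { repeat split; apply Rgt_not_eq; try nra. }
      unfold D. rewrite (cosh_sqr s).
      replace (PI + - t) with (PI - t) by ring.
      field. lra.
    - intros s t _ Ht. unfold cont2, D.
      rcont; cbn [fst snd]; try apply pow_nonzero; apply Rgt_not_eq, sech_den; lra. }
  assert (HcA : forall t, 0 <= t < PI -> ex_RInt (fun s => A s t) 0 S).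
  { intros t Ht. apply ex_RInt_cont; [lra|]. intros s _. unfold A.
    rcont; try apply pow_nonzero; apply Rgt_not_eq, sech_den; lra. }
  rewrite RInt_Rminus in G1 by (apply HcA; lra).
  assert (E1 : RInt (fun s => A s 0) 0 S = sinh (m * PI) * sech_int m S).
  { unfold sech_int. rewrite <- RInt_Rscal by exint.
    apply RInt_ext. intros s _. unfold A. rewrite cos_0, sin_0, Rminus_0_r.
    pose proof (cosh_ge_1 s). eqR. field; lra. }
  rewrite <- E1, G1.
  pose proof (sinh_nonneg (m * PI) ltac:(pose proof PI_RGT_0; nra)) as Hsh.
  pose proof (cosh_gt_1 S HS) as Hch. pose proof (sinh_nonneg S ltac:(lra)) as Hss.
  assert (Ht0 : 0 <= tail_err m (cosh S) (sinh S)).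
  { unfold tail_err. apply Rplus_le_le_0_compat; apply Rmult_le_pos; try lra; left; apply Rinv_0_lt_compat; nra. }
  apply Rle_trans with ((PI - e - 0) * (sinh (m * PI) * tail_err m (cosh S) (sinh S))).
  - apply RInt_le_const; [lra| |].
    + intros t Ht. unfold B. rcont; try apply pow_nonzero; apply Rgt_not_eq, sech_den; lra.
    + intros t Ht. unfold B at 2. rewrite sinh_0, !Rmult_0_r, sin_0.
      replace (B S t - _) with (B S t) by (field; apply Rgt_not_eq, sech_den; lra).
      unfold B. rewrite Rabs_mult, Rabs_Ropp.
      apply Rmult_le_compat; try apply Rabs_pos.
      * rewrite Rabs_pos_eq by (apply sinh_nonneg; nra). apply sinh_mono. nra.
      * rewrite <- (Rmult_1_l (tail_err _ _ _)).
        apply tail_err_bound; try apply cos_abs; try apply sin_abs; try lra.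
        pose proof (COS_bound t); lra.
  - apply Rmult_le_compat_r; [|lra]. now apply Rmult_le_pos.
Qed.

(** On the edge [t = PI - e] the kernel [q] is the Poisson kernel of [RInt_poisson], so the term
    with [m cosh (m e)] tends to [m PI]. The other term carries the factor [sinh (m e)], and its
    integral only has to stay bounded as [e] tends to [0]. *)
Lemma sech_boundary e : 0 < e < PI ->
  Rabs (RInt (fun s => A s (PI - e)) 0 S - m * PI) <=
    sinh (m * e) * (sinh S / (cosh S - 1) + m * ((S - 0) * (m * (2 * cosh (S / 2)))))
    + m * cosh (m * e) * (2 * (e / (exp S - 1)) + e + (S - 0) * (m ^ 2 * e))
    + m * PI * (cosh (m * e) - 1).
Proof.
  intros He.
  pose proof (cos_lt_1 e He) as Hc.
  assert (Hs : 0 < sin e) by (apply sin_gt_0; lra).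
  assert (HN : forall s, 0 < cosh s - cos e) by (intros s; pose proof (cosh_ge_1 s); lra).
  set (J1 := RInt (fun s => (1 - cos e * cosh s) / (cosh s - cos e) ^ 2 * cos (m * s)) 0 S).
  set (J2 := RInt (fun s => sin e / (cosh s - cos e) * cos (m * s)) 0 S).
  assert (EA : RInt (fun s => A s (PI - e)) 0 S = sinh (m * e) * J1 + m * cosh (m * e) * J2).
  { unfold J1, J2. rewrite <- !RInt_Rscal.
    - rewrite <- RInt_Rplus.
      + apply RInt_ext. intros s _. unfold A.
        replace (cos (PI - e)) with (- cos e) by (rewrite cos_minus, cos_PI, sin_PI; ring).
        replace (sin (PI - e)) with (sin e) by (rewrite sin_minus, cos_PI, sin_PI; ring).
        replace (PI - (PI - e)) with e by ring.
        specialize (HN s). eqR. field. lra.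
      + apply ex_RInt_cont; [lra|]. intros s _. rcont; try apply pow_nonzero; apply Rgt_not_eq, HN.
      + apply ex_RInt_cont; [lra|]. intros s _. rcont; try apply pow_nonzero; apply Rgt_not_eq, HN.
    - apply ex_RInt_cont; [lra|]. intros s _. rcont; try apply pow_nonzero; apply Rgt_not_eq, HN.
    - apply ex_RInt_cont; [lra|]. intros s _. rcont; try apply pow_nonzero; apply Rgt_not_eq, HN. }
  assert (B1 : Rabs J1 <= sinh S / (cosh S - 1) + m * ((S - 0) * (m * (2 * cosh (S / 2))))).
  (* The kernel of [J1] is the derivative of [sinh s / (cosh s - cos e)]. After integration by parts
     the factor [sin (m s) <= m s] compensates the singularity that forms at [s = 0]. *)
  { assert (EJ : J1 = cos (m * S) * (sinh S / (cosh S - cos e)) + m * RInt (fun s => sin (m * s) * (sinh s / (cosh s - cos e))) 0 S).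
    { assert (F : RInt (fun s => (1 - cos e * cosh s) / (cosh s - cos e) ^ 2 * cos (m * s)
                     - m * (sin (m * s) * (sinh s / (cosh s - cos e)))) 0 S
                  = cos (m * S) * (sinh S / (cosh S - cos e)) - cos (m * 0) * (sinh 0 / (cosh 0 - cos e))).
      { apply (RInt_FTC (fun s => cos (m * s) * (sinh s / (cosh s - cos e)))); [lra| |].
        - intros s _. specialize (HN s). auto_derive; [lra|].
          pose proof (cosh_sqr s) as E.
          apply Rminus_diag_uniq.
          generalize dependent (sinh s). generalize dependent (cosh s).
          generalize (sin (m * s)) (cos (m * s)) (cos e).
          intros sm cm ce cs HN ss E. field_simplify_eq; [|lra].
          replace (ss ^ 2) with (cs * cs - 1) by (rewrite E; ring). ring.
        - intros s _. rcont; try apply pow_nonzero; apply Rgt_not_eq, HN. }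
      rewrite RInt_Rminus, RInt_Rscal in F.
      - fold J1 in F. rewrite sinh_0 in F. unfold Rdiv in F at 2. lra.
      - apply ex_RInt_cont; [lra|]. intros s _. rcont; try apply pow_nonzero; apply Rgt_not_eq, HN.
      - apply ex_RInt_cont; [lra|]. intros s _. rcont; try apply pow_nonzero; apply Rgt_not_eq, HN.
      - apply ex_RInt_cont; [lra|]. intros s _. rcont; try apply pow_nonzero; apply Rgt_not_eq, HN. }
    rewrite EJ. eapply Rle_trans; [apply Rabs_triang|].
    apply Rplus_le_compat.
    - rewrite Rabs_mult. pose proof (sinh_nonneg S ltac:(lra)). pose proof (cosh_gt_1 S HS).
      rewrite <- (Rmult_1_l (sinh S / (cosh S - 1))).
      apply Rmult_le_compat; try apply Rabs_pos; [apply cos_abs|].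
      rewrite Rabs_pos_eq.
      + apply Rmult_le_compat_l; [lra|]. apply Rinv_le_contravar; lra.
      + apply Rmult_le_pos; [lra|]. left; apply Rinv_0_lt_compat, HN.
    - rewrite Rabs_mult, (Rabs_pos_eq m) by lra. apply Rmult_le_compat_l; [lra|].
      apply RInt_le_const; [lra| |].
      + intros s _. rcont; try apply pow_nonzero; apply Rgt_not_eq, HN.
      + intros s Hs'. rewrite Rabs_mult.
        pose proof (sinh_nonneg s ltac:(lra)) as Hsn.
        rewrite (Rabs_pos_eq (sinh s / _)) by (apply Rmult_le_pos; [lra|]; left; apply Rinv_0_lt_compat, HN).
        assert (Hsin : Rabs (sin (m * s)) <= m * s).
        { assert (0 <= m * s) by nra. destruct (Req_dec (m * s) 0) as [Z|Z].
          - rewrite Z, sin_0, Rabs_R0. lra.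
          - apply Rabs_le. pose proof (sin_lt_x (m * s) ltac:(lra)).
            split; [|lra]. destruct (Rle_dec (m * s) 1).
            + assert (0 <= sin (m * s)) by (apply sin_ge_0; pose proof PI2_1; lra). lra.
            + pose proof (SIN_bound (m * s)); lra. }
        apply Rle_trans with (m * s * (sinh s / (cosh s - cos e))).
        * apply Rmult_le_compat_r; [|exact Hsin].
          apply Rmult_le_pos; [lra|]; left; apply Rinv_0_lt_compat, HN.
        * apply Rmult_le_reg_r with (cosh s - cos e); [apply HN|].
          replace (m * s * (sinh s / (cosh s - cos e)) * (cosh s - cos e)) with (m * (s * sinh s))
            by (field; apply Rgt_not_eq, HN).
          rewrite Rmult_assoc. apply Rmult_le_compat_l; [lra|].
          eapply Rle_trans; [apply (sinh_half_bound S s Hs')|].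
          apply Rmult_le_compat_l; [pose proof (cosh_ge_1 (S / 2)); lra|]. lra. }
  assert (B2 : Rabs (J2 - PI) <= 2 * (e / (exp S - 1)) + e + (S - 0) * (m ^ 2 * e)).
  { set (J3 := RInt (fun s => sin e / (cosh s - cos e) * (1 - cos (m * s))) 0 S).
    assert (EJ : J2 = RInt (fun s => sin e / (cosh s - cos e)) 0 S - J3).
    { unfold J2, J3. rewrite <- RInt_Rminus.
      - apply RInt_ext. intros s _. eqR. ring.
      - apply ex_RInt_cont; [lra|]. intros s _. rcont; try apply pow_nonzero; apply Rgt_not_eq, HN.
      - apply ex_RInt_cont; [lra|]. intros s _. rcont; try apply pow_nonzero; apply Rgt_not_eq, HN. }
    (* Here [1 - cos (m s) <= m^2 s^2 / 2 <= m^2 (cosh s - 1)] cancels the denominator, and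
       [sin e <= e] supplies the smallness. *)
    assert (BJ : Rabs J3 <= (S - 0) * (m ^ 2 * e)).
    { apply RInt_le_const; [lra| |].
      - intros s _. rcont; try apply pow_nonzero; apply Rgt_not_eq, HN.
      - intros s Hs'. pose proof (COS_bound (m * s)).
        rewrite Rabs_pos_eq by (apply Rmult_le_pos; [left; apply Rdiv_lt_0_compat; [lra|apply HN]|lra]).
        apply Rmult_le_reg_r with (cosh s - cos e); [apply HN|].
        replace (sin e / (cosh s - cos e) * (1 - cos (m * s)) * (cosh s - cos e))
          with (sin e * (1 - cos (m * s))) by (field; apply Rgt_not_eq, HN).
        pose proof (cos_ge_quad (m * s)). pose proof (cosh_quad s). pose proof (sin_lt_x e (proj1 He)).
        replace (m ^ 2 * e * (cosh s - cos e)) with (e * (m ^ 2 * (cosh s - cos e))) by ring.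
        apply Rmult_le_compat; try lra.
        apply Rle_trans with (m ^ 2 * (s ^ 2 / 2)); [|apply Rmult_le_compat_l; [nra|lra]].
        replace (m ^ 2 * (s ^ 2 / 2)) with ((m * s) ^ 2 / 2) by field. lra. }
    rewrite EJ. replace (RInt (fun s => sin e / (cosh s - cos e)) 0 S - J3 - PI)
      with ((RInt (fun s => sin e / (cosh s - cos e)) 0 S - PI) + - J3) by ring.
    eapply Rle_trans; [apply Rabs_triang|]. rewrite Rabs_Ropp.
    apply Rplus_le_compat; [|exact BJ]. now apply RInt_poisson. }
  rewrite EA.
  replace (sinh (m * e) * J1 + m * cosh (m * e) * J2 - m * PI) with
    (sinh (m * e) * J1 + m * cosh (m * e) * (J2 - PI) + m * PI * (cosh (m * e) - 1)) by ring.
  pose proof (cosh_ge_1 (m * e)). pose proof (sinh_nonneg (m * e) ltac:(nra)).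
  eapply Rle_trans; [apply Rabs_triang|]. apply Rplus_le_compat.
  - eapply Rle_trans; [apply Rabs_triang|]. apply Rplus_le_compat; rewrite Rabs_mult.
    + rewrite (Rabs_pos_eq (sinh _)) by lra. now apply Rmult_le_compat_l.
    + rewrite (Rabs_pos_eq (m * _)) by nra. apply Rmult_le_compat_l; [nra|exact B2].
  - pose proof PI_RGT_0. rewrite Rabs_pos_eq; [lra|]. apply Rmult_le_pos; [nra|lra].
Qed.

End Sech.

(** The bounds of [sech_green] and [sech_boundary] are added and [e] tends to [0] with [S] fixed.
    The order matters: the constants in [sech_boundary] grow with [S], whereas the bound of
    [sech_green] is independent of [e]. *)
Lemma sech_int_lim m S : 0 < m -> 0 < S ->
  Rabs (sinh (m * PI) * sech_int m S - m * PI) <= PI * (sinh (m * PI) * tail_err m (cosh S) (sinh S)).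
Proof.
  intros Hm HS. pose proof PI2_1 as HP.
  apply le_of_le_plus_vanishing with (d := fun e =>
    sinh (m * e) * (sinh S / (cosh S - 1) + m * ((S - 0) * (m * (2 * cosh (S / 2)))))
    + m * cosh (m * e) * (2 * (e / (exp S - 1)) + e + (S - 0) * (m ^ 2 * e))
    + m * PI * (cosh (m * e) - 1)).
  - assert (1 < exp S) by (rewrite <- exp_0; now apply exp_increasing). rcont; lra.
  - assert (1 < exp S) by (rewrite <- exp_0; now apply exp_increasing).
    rewrite Rmult_0_r, sinh_0, cosh_0. unfold Rdiv. ring.
  - intros e He.
    eapply Rle_trans; [|apply Rplus_le_compat; [apply (sech_green m S Hm HS e); lra|apply (sech_boundary m S Hm HS e); lra]].
    match goal with |- Rabs ?a <= Rabs ?b + Rabs ?c => replace a with (- b + c) by ring end.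
    eapply Rle_trans; [apply Rabs_triang|]. rewrite Rabs_Ropp. lra.
Qed.

(** Eliminates [sech_int] between the two Green estimates. The error is uniform in [T], as the later
    integration over [[0, PI]] requires. *)
Lemma wave_int_lim m S T : 0 < m -> 0 < S -> 0 <= T <= PI ->
  Rabs (wave_int m S T - sin (m * T) * (PI / sinh (m * PI)))
    <= (PI * sinh PI + PI) / m * tail_err m (cosh S) (sinh S).
Proof.
  intros Hm HS HT.
  pose proof PI_RGT_0 as HP.
  pose proof (wave_int_sech_int m S T Hm HS HT) as H1.
  pose proof (sech_int_lim m S Hm HS) as H2.
  pose proof (sinh_ge_x (m * PI) ltac:(nra)) as Hsh. assert (Hsp : 0 < sinh (m * PI)) by nra.
  set (tl := tail_err m (cosh S) (sinh S)) in *.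
  apply Rmult_le_reg_l with m; [exact Hm|].
  rewrite <- (Rabs_pos_eq m) at 1 by lra. rewrite <- Rabs_mult.
  replace (m * (wave_int m S T - sin (m * T) * (PI / sinh (m * PI)))) with
    ((m * wave_int m S T - sin (m * T) * sech_int m S) +
     sin (m * T) * ((sinh (m * PI) * sech_int m S - m * PI) / sinh (m * PI))) by (field; lra).
  replace (m * ((PI * sinh PI + PI) / m * tl)) with (PI * (sinh PI * tl) + 1 * (PI * (sinh (m * PI) * tl) / sinh (m * PI)))
    by (field; lra).
  eapply Rle_trans; [apply Rabs_triang|]. apply Rplus_le_compat; [exact H1|].
  rewrite Rabs_mult. apply Rmult_le_compat; try apply Rabs_pos; [apply sin_abs|].
  unfold Rdiv. rewrite Rabs_mult. rewrite (Rabs_pos_eq (/ _)) by (left; now apply Rinv_0_lt_compat).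
  apply Rmult_le_compat_r; [left; now apply Rinv_0_lt_compat|exact H2].
Qed.

(** * The Legendre integral and its primitive *)

Lemma cosh_strict x y : 0 <= x < y -> cosh x < cosh y.
Proof.
  intros H. destruct (cosh_mono x y ltac:(lra)) as [E|E]; [exact E|].
  exfalso.
  assert (S : sinh x < sinh y) by (apply sinh_lt; lra).
  pose proof (cosh_sqr x). pose proof (cosh_sqr y). pose proof (sinh_nonneg x ltac:(lra)). nra.
Qed.

Lemma arcosh_arg_pos x : 1 <= x -> 1 <= x + sqrt (x ^ 2 - 1).
Proof. intros H. pose proof (sqrt_pos (x ^ 2 - 1)). lra. Qed.

Lemma cosh_arcosh x : 1 <= x -> cosh (arcosh x) = x.
Proof.
  intros H. pose proof (arcosh_arg_pos x H) as P. unfold cosh, arcosh.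
  rewrite exp_Ropp, exp_ln by lra.
  assert (E : sqrt (x ^ 2 - 1) * sqrt (x ^ 2 - 1) = x ^ 2 - 1) by (apply sqrt_sqrt; nra).
  set (q := sqrt (x ^ 2 - 1)) in *.
  replace (/ (x + q)) with (x - q).
  - field.
  - apply Rmult_eq_reg_l with (x + q); [|lra]. rewrite Rinv_r by lra. nra.
Qed.

Lemma arcosh_ge_0 x : 1 <= x -> 0 <= arcosh x.
Proof.
  intros H. unfold arcosh. rewrite <- ln_1. pose proof (arcosh_arg_pos x H) as [P|P].
  - left. apply ln_increasing; lra.
  - right. now rewrite <- P.
Qed.

Lemma arcosh_gt_0 x : 1 < x -> 0 < arcosh x.
Proof.
  intros H. destruct (arcosh_ge_0 x ltac:(lra)) as [P|P]; [exact P|].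
  pose proof (cosh_arcosh x ltac:(lra)) as E. rewrite <- P, cosh_0 in E. lra.
Qed.

Lemma arcosh_le x : 1 <= x -> arcosh x <= sqrt (2 * (x - 1)).
Proof.
  intros H. rewrite <- (sqrt_Rsqr (arcosh x)) by now apply arcosh_ge_0.
  apply sqrt_le_1_alt. unfold Rsqr. pose proof (cosh_quad (arcosh x)) as Q.
  rewrite cosh_arcosh in Q by exact H. simpl in Q. lra.
Qed.

Lemma lt_arcosh x s : 1 <= x -> 0 <= s -> s < arcosh x -> cosh s < x.
Proof. intros Hx Hs H. rewrite <- (cosh_arcosh x Hx). apply cosh_strict. lra. Qed.

(** Provides an upper limit beyond the support of [(x - cosh s)_+] for every real [x], including
    [x < 1], so that [cut_integral] is continuous on the whole line and in particular at [x = 1]. *)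
Lemma cosh_cut x : x <= cosh (1 + Rabs x).
Proof.
  pose proof (cosh_quad (1 + Rabs x)) as Q. pose proof (Rle_abs x). pose proof (Rabs_pos x). nra.
Qed.

Definition cut_integrand (h : R -> R -> C) (b : C) (x s : R) : C := (h x s * ppow (x - cosh s) b)%C.
Definition cut_integral (h : R -> R -> C) (b : C) (x : R) : C := CInt (cut_integrand h b x) 0 (1 + Rabs x).

Section Cut.
Variable (h : R -> R -> C).
Hypothesis Hh : forall x s, ccont2 h x s.

Lemma cut_integrand_cont2 b x s : 0 < Re b -> ccont2 (cut_integrand h b) x s.
Proof.
  intros Hb. apply (ccont_mult (fun p : R * R => h (fst p) (snd p))
    (fun p : R * R => ppow (fst p - cosh (snd p)) b)); [apply Hh|].
  apply (ccont_comp (fun p : R * R => fst p - cosh (snd p)) (fun y => ppow y b)).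
  - rcont.
  - now apply ccont_ppow.
Qed.

Lemma cut_integrand_cont b x (s : R) : 0 < Re b -> ccont (cut_integrand h b x) s.
Proof. intros Hb. apply (ccont2_snd (cut_integrand h b)). now apply cut_integrand_cont2. Qed.

(** Any upper limit beyond the support gives the same value, so the limit can be frozen near a given
    [x]. *)
Lemma cut_integral_cut b x A : 0 < Re b -> 0 <= A -> x <= cosh A -> cut_integral h b x = CInt (cut_integrand h b x) 0 A.
Proof.
  intros Hb HA Hx. unfold cut_integral.
  assert (Z : forall A B, 0 <= A <= B -> x <= cosh A -> CInt (cut_integrand h b x) 0 B = CInt (cut_integrand h b x) 0 A).
  { clear A HA Hx. intros A B HAB Hx.
    rewrite <- (CInt_Chasles _ 0 A B); try lra; [|intros s _; now apply cut_integrand_cont].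
    rewrite (CInt_ext _ (fun _ => RtoC 0) A B); [|lra|].
    - rewrite CInt_RtoC, RInt_const. unfold scal; simpl; unfold mult; simpl. rewrite Rmult_0_r. ring.
    - intros s Hs. unfold cut_integrand. pose proof (cosh_mono A s ltac:(lra)). rewrite ppow_neg by lra. ring. }
  pose proof (Rabs_pos x). pose proof (cosh_cut x).
  destruct (Rle_dec A (1 + Rabs x)).
  - apply Z; lra.
  - symmetry. apply Z; lra.
Qed.

Lemma cut_integral_cont b (x : R) : 0 < Re b -> ccont (cut_integral h b) x.
Proof.
  intros Hb. pose proof (Rabs_pos x).
  (* The limit [2 + Rabs x] lies beyond the support for all [u] in [(x - 1, x + 1)]. *)
  apply ccont_ext_loc with (fun u => CInt (fun s => cut_integrand h b u s) 0 (2 + Rabs x)).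
  - assert (L : locally x (fun t => x - 1 < t < x + 1)).
    { apply filter_and; [apply (open_gt _ x)|apply (open_lt _ x)]; lra. }
    eapply filter_imp; [|exact L]. intros t Ht. simpl in Ht. symmetry. apply cut_integral_cut; [exact Hb|lra|].
    pose proof (cosh_quad (2 + Rabs x)) as Q. pose proof (Rle_abs x). nra.
  - apply CInt_param_cont_glob; [lra|]. intros; now apply cut_integrand_cont2.
Qed.

Variable (hx : R -> R -> C).
Hypothesis Hhx : forall x s, ccont2 hx x s.
Hypothesis Hd : forall x s, cder (fun x => h x s) x (hx x s).

(** Differentiation lowers the exponent by one; starting from [b + 1] leaves the exponent [b], for
    which the integrand is still continuous. *)
Lemma cut_integral_der b x A : 0 < Re b -> 0 <= A -> x < cosh A ->
  cder (cut_integral h (b + 1)%C) x (CInt (fun s => cut_integrand hx (b + 1)%C x s + (b + 1) * cut_integrand h b x s)%C 0 A).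
Proof.
  intros Hb HA Hx. assert (Hb1 : 0 < Re (b + 1)%C) by (simpl; unfold Re in *; lra).
  apply cder_ext_loc with (fun x => CInt (fun s => cut_integrand h (b + 1)%C x s) 0 A).
  - assert (L : locally x (fun t => t < cosh A)) by (now apply (open_lt _ x)).
    eapply filter_imp; [|exact L]. intros t Ht. simpl in Ht. symmetry. apply cut_integral_cut; auto; lra.
  - apply (CInt_param_der (cut_integrand h (b + 1)%C)
       (fun x s => cut_integrand hx (b + 1)%C x s + (b + 1) * cut_integrand h b x s)%C (x - 1) (x + 1) 0 A); [lra|exact HA| | |].
    + intros u s _ _. unfold cut_integrand. eapply cder_eq.
      * apply cder_mult; [apply Hd|].
        apply (cder_comp (fun y => ppow y (b + 1)%C) (fun u => u - cosh s)); [now apply cder_ppow|].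
        instantiate (1 := 1). auto_derive; auto; ring.
      * cbv beta. ring.
    + intros u s _ _. now apply cut_integrand_cont2.
    + intros u s _ _.
      apply (ccont_plus (fun p : R * R => cut_integrand hx (b + 1)%C (fst p) (snd p))
               (fun p : R * R => (b + 1) * cut_integrand h b (fst p) (snd p))%C).
      * apply (ccont_mult (fun p : R * R => hx (fst p) (snd p))
          (fun p : R * R => ppow (fst p - cosh (snd p)) (b + 1)%C)); [apply Hhx|].
        apply (ccont_comp (fun p : R * R => fst p - cosh (snd p)) (fun y => ppow y (b + 1)%C)).
        -- rcont.
        -- now apply ccont_ppow.
      * apply (ccont_mult (fun _ : R * R => (b + 1)%C)); [apply ccont_const|]. now apply (cut_integrand_cont2 b u s).
Qed.

End Cut.

Definition cos_weight (m : R) (x s : R) : C := RtoC (cos (m * s)).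
(* The weight left by the integration by parts in [legendre_integrand_is_CInt_gen], multiplied by [b]. *)
Definition parts_weight (m : R) (b : C) (x s : R) : C :=
  (RtoC (cos (m * s) * cosh s - m * sin (m * s) * sinh s) + b * RtoC (cos (m * s) * (x + cosh s)))%C.
(** The function [M_m] of the overview. *)
Definition legendre_prim m b x := cut_integral (cos_weight m) b x.
(** The function [F_m] of the overview for [x > 1], in the form reached after the integration by
    parts in [s], where the exponent is [b] instead of [b - 1]. *)
Definition legendre_core m b x := (cut_integral (parts_weight m b) b x / (b * RtoC (x ^ 2 - 1)))%C.
Definition legendre_integrand m b x s : C := (RtoC (cos (m * s)) * cpow (x - cosh s) (b - 1))%C.

Lemma cos_weight_cont m x s : ccont2 (cos_weight m) x s.
Proof. apply ccont_RtoC. rcont. Qed.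

Lemma parts_weight_cont m b x s : ccont2 (parts_weight m b) x s.
Proof.
  apply (ccont_plus (fun p : R * R => RtoC (cos (m * snd p) * cosh (snd p) - m * sin (m * snd p) * sinh (snd p)))
    (fun p : R * R => b * RtoC (cos (m * snd p) * (fst p + cosh (snd p))))%C).
  - apply ccont_RtoC. rcont.
  - apply ccont_mult; [apply ccont_const|]. apply ccont_RtoC. rcont.
Qed.

Lemma is_CInt_gen_FTC_left f P a : 0 < a ->
  (forall s, 0 <= s < a -> cder P s (f s)) -> (forall s, 0 <= s < a -> ccont f s) ->
  forall l, clim P (at_left a) l -> is_CInt_gen f (at_point 0) (at_left a) (l - P 0)%C.
Proof.
  intros Ha Hd Hc l [L1 L2].
  assert (HP : filter_prod (at_point 0) (at_left a) (fun ab => fst ab = 0 /\ 0 < snd ab < a)).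
  { apply Filter_prod with (fun x => x = 0) (fun x => 0 < x < a).
    - reflexivity.
    - exists (mkposreal a Ha). intros y Hy Hya.
      unfold_ball_in Hy.
      apply Rabs_def2 in Hy. lra.
    - intros x y -> Hy. simpl. lra. }
  assert (AP : forall g : R -> R, filterlim g (at_point 0) (locally (g 0))).
  { intros g Q HQ. unfold filtermap, at_point. now apply locally_singleton. }
  split.
  - apply (is_RInt_gen_prim (fun t => Re (f t)) (fun t => Re (P t)) (at_point 0) (at_left a)); [|apply (AP (fun t => Re (P t)))|exact L1].
    apply (filter_imp _ _) with (2 := HP). intros [u v] [Hu Hv]; simpl in *. subst u.
    apply (is_RInt_derive (V := R_CompleteNormedModule) (fun t => Re (P t)) (fun t => Re (f t)));
    intros x; rewrite Rmin_left, Rmax_right by lra; intros; [apply Hd|apply Hc]; lra.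
  - apply (is_RInt_gen_prim (fun t => Im (f t)) (fun t => Im (P t)) (at_point 0) (at_left a)); [|apply (AP (fun t => Im (P t)))|exact L2].
    apply (filter_imp _ _) with (2 := HP). intros [u v] [Hu Hv]; simpl in *. subst u.
    apply (is_RInt_derive (V := R_CompleteNormedModule) (fun t => Im (P t)) (fun t => Im (f t)));
    intros x; rewrite Rmin_left, Rmax_right by lra; intros; [apply Hd|apply Hc]; lra.
Qed.

Lemma legendre_integrand_cont m b x (s : R) : cosh s < x -> ccont (legendre_integrand m b x) s.
Proof.
  intros H. apply ccont_mult.
  - apply ccont_RtoC. rcont.
  - apply (ccont_comp (fun s => x - cosh s) (fun y => cpow y (b - 1)%C)); [rcont|]. apply ccont_cpow. lra.
Qed.

Lemma Cmult_eq_reg_l (c z w : C) : (c * z = c * w)%C -> c <> 0%C -> z = w.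
Proof.
  intros E H. replace z with (/ c * (c * z))%C by (field; exact H). rewrite E. field. exact H.
Qed.

Lemma C_neq_0_Re (z : C) : 0 < Re z -> z <> 0%C.
Proof. intros H E. rewrite E in H. simpl in H. lra. Qed.

(* Integration by parts after [x^2 - 1 = sinh^2 s + (x - cosh s)(x + cosh s)]. *)
Lemma legendre_integrand_is_CInt_gen m b x : 0 < Re b -> 1 < x ->
  is_CInt_gen (legendre_integrand m b x) (at_point 0) (at_left (arcosh x)) (legendre_core m b x).
Proof.
  intros Hb Hx. pose proof (arcosh_gt_0 x Hx) as Ha.
  assert (Hb0 : b <> 0%C) by now apply C_neq_0_Re.
  assert (Hx0 : RtoC (x ^ 2 - 1) <> 0%C) by (intros E; apply RtoC_inj in E; nra).
  set (c := (/ (b * RtoC (x ^ 2 - 1)))%C).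
  (* The part of the integrand with [sinh^2 s] is integrated by parts, since
     [b sinh s (x - cosh s)^(b-1)] is minus the derivative of [(x - cosh s)^b]. The boundary term
     vanishes at [0] through [sinh 0] and at [arcosh x] through the power. *)
  set (P := fun s => (c * (- (RtoC (cos (m * s) * sinh s) * ppow (x - cosh s) b) + CInt (cut_integrand (parts_weight m b) b x) 0 s))%C).
  assert (P0 : P 0 = 0%C).
  { unfold P. rewrite CInt_point, sinh_0, Rmult_0_r. ring. }
  replace (legendre_core m b x) with (P (arcosh x) - P 0)%C.
  2:{ rewrite P0. unfold P, legendre_core, c. rewrite cosh_arcosh, ppow_neg by lra.
      rewrite (cut_integral_cut (parts_weight m b) (parts_weight_cont m b) b x (arcosh x)); try lra.
      - field. auto.
      - rewrite cosh_arcosh; lra. }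
  assert (HP : forall s, ccont P s).
  { intros s. unfold P. apply ccont_mult; [apply ccont_const|]. apply ccont_plus.
    - apply ccont_opp. apply ccont_mult; [apply ccont_RtoC; rcont|].
      apply (ccont_comp (fun s => x - cosh s) (fun y => ppow y b)); [rcont|now apply ccont_ppow].
    - eapply cder_ccont. apply (CInt_der (cut_integrand (parts_weight m b) b x) (Rmin 0 s - 1)).
      + pose proof (Rmin_l 0 s); lra.
      + pose proof (Rmin_r 0 s); lra.
      + intros t _. apply cut_integrand_cont; auto. apply parts_weight_cont. }
  apply is_CInt_gen_FTC_left with (P := P); auto.
  - intros s Hs. pose proof (lt_arcosh x s ltac:(lra) ltac:(lra) (proj2 Hs)) as Hc.
    apply cder_ext_loc with (fun s => c * (- (RtoC (cos (m * s) * sinh s) * cpow (x - cosh s) b) + CInt (cut_integrand (parts_weight m b) b x) 0 s))%C.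
    { assert (L : locally s (fun t => 0 < x - cosh t)).
      { assert (Cc : continuous (fun t => x - cosh t) s) by rcont.
        apply (Cc (fun y => 0 < y)). apply (open_gt 0 (x - cosh s)). lra. }
      eapply filter_imp; [|exact L]. intros t Ht. simpl in Ht. unfold P. now rewrite ppow_pos. }
    eapply cder_eq.
    + apply cder_scal. apply cder_plus.
      * apply cder_opp. apply cder_mult.
        -- apply cder_RtoC. instantiate (1 := cos (m * s) * cosh s - m * sin (m * s) * sinh s).
           auto_derive; auto; ring.
        -- apply (cder_comp (fun y => cpow y b) (fun s => x - cosh s)); [apply cder_cpow; lra|].
           instantiate (1 := - sinh s). auto_derive; auto; ring.
      * apply (CInt_der (cut_integrand (parts_weight m b) b x) (- 1)); try lra.
        intros t _. apply cut_integrand_cont; auto. apply parts_weight_cont.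
    + unfold cut_integrand, parts_weight, legendre_integrand. rewrite ppow_pos by lra.
      assert (E : cpow (x - cosh s) b = (RtoC (x - cosh s) * cpow (x - cosh s) (b - 1))%C).
      { rewrite <- cpow_S by lra. f_equal. ring. }
      rewrite E. set (y := cpow (x - cosh s) (b - 1)).
      assert (EQ : (RtoC (x ^ 2 - 1) = RtoC (sinh s) * RtoC (sinh s) + RtoC (x - cosh s) * RtoC (x + cosh s))%C).
      { rewrite <- !RtoC_mult, <- RtoC_plus. f_equal. pose proof (cosh_sqr s). nra. }
      unfold c. apply Cmult_eq_reg_l with (b * RtoC (x ^ 2 - 1))%C; [|now apply Cmult_neq_0].
      rewrite Cmult_assoc, Cinv_r, Cmult_1_l by now apply Cmult_neq_0.
      rewrite EQ, !RtoC_mult, RtoC_opp. ring.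
  - intros s Hs. apply legendre_integrand_cont. apply lt_arcosh; lra.
  - apply ccont_at_left, HP.
Qed.

(** Both are values of one integral, with exponent [b = (b + 1) - 1]: the first directly, the second
    after integration by parts. This raises the exponent in [legendre_prim] to [b + 1]. *)
Lemma prim_eq_core m b x : 0 < Re b -> 1 < x -> legendre_prim m b x = legendre_core m (b + 1)%C x.
Proof.
  intros Hb Hx. pose proof (arcosh_gt_0 x Hx) as Ha.
  assert (Hb1 : 0 < Re (b + 1)%C) by (simpl; unfold Re in *; lra).
  pose proof (is_CInt_gen_unique _ _ _ _ (legendre_integrand_is_CInt_gen m (b + 1)%C x Hb1 Hx)) as E.
  rewrite <- E. symmetry.
  refine (is_CInt_gen_unique (legendre_integrand m (b + 1)%C x) (at_point 0) (at_left (arcosh x)) _ _).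
  set (P := fun s => CInt (cut_integrand (cos_weight m) b x) 0 s).
  assert (HP : forall s, cder P s (cut_integrand (cos_weight m) b x s)).
  { intros s. apply (CInt_der (cut_integrand (cos_weight m) b x) (Rmin 0 s - 1)).
    + pose proof (Rmin_l 0 s); lra.
    + pose proof (Rmin_r 0 s); lra.
    + intros t _. apply cut_integrand_cont; auto. apply cos_weight_cont. }
  replace (legendre_prim m b x) with (P (arcosh x) - P 0)%C.
  2:{ unfold P, legendre_prim. rewrite CInt_point, (cut_integral_cut (cos_weight m) (cos_weight_cont m) b x (arcosh x)); try lra; [ring|].
      rewrite cosh_arcosh; lra. }
  assert (EQ : forall s, 0 <= s < arcosh x -> cut_integrand (cos_weight m) b x s = legendre_integrand m (b + 1)%C x s).
  { intros s Hs. unfold cut_integrand, legendre_integrand, cos_weight. rewrite ppow_pos.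
    - f_equal. f_equal. ring.
    - pose proof (lt_arcosh x s ltac:(lra) ltac:(lra) (proj2 Hs)). lra. }
  apply is_CInt_gen_FTC_left with (P := P); auto.
  - intros s Hs. rewrite <- EQ by exact Hs. apply HP.
  - intros s Hs. apply legendre_integrand_cont. apply lt_arcosh; lra.
  - apply ccont_at_left. eapply cder_ccont, HP.
Qed.

(** Differentiating the defining integral would produce the singular exponent [b - 1]. The form
    given by [prim_eq_core] is differentiated instead. *)
Lemma legendre_prim_der m b x : 0 < Re b -> 1 < x -> cder (legendre_prim m b) x (b * legendre_core m b x)%C.
Proof.
  intros Hb Hx.
  assert (Hb1 : 0 < Re (b + 1)%C) by (simpl; unfold Re in *; lra).
  assert (Hb0 : b <> 0%C) by now apply C_neq_0_Re.
  assert (Hb10 : (b + 1)%C <> 0%C) by now apply C_neq_0_Re.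
  assert (Hx0 : RtoC (x ^ 2 - 1) <> 0%C) by (intros E; apply RtoC_inj in E; nra).
  set (A := arcosh (x + 1)).
  assert (HA : 0 <= A) by (apply arcosh_ge_0; lra).
  assert (HAx : cosh A = x + 1) by (apply cosh_arcosh; lra).
  set (N := cut_integral (parts_weight m (b + 1)%C) (b + 1)%C).
  assert (HE : forall t, 1 < t -> legendre_prim m b t = (RtoC (/ (t ^ 2 - 1)) * (/ (b + 1) * N t))%C).
  { intros t Ht. rewrite prim_eq_core by assumption. unfold legendre_core, N.
    assert (RtoC (t ^ 2 - 1) <> 0%C) by (intros E; apply RtoC_inj in E; nra).
    rewrite RtoC_inv by nra. field. auto. }
  set (hx := fun x s : R => ((b + 1) * RtoC (cos (m * s)))%C).
  assert (HN : cder N x (CInt (fun s => cut_integrand hx (b + 1)%C x s + (b + 1) * cut_integrand (parts_weight m (b + 1)%C) b x s)%C 0 A)).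
  { apply cut_integral_der; auto; try lra.
    - apply parts_weight_cont.
    - intros u s. unfold hx. apply (ccont_mult (fun _ : R * R => (b + 1)%C)); [apply ccont_const|].
      apply ccont_RtoC. rcont.
    - intros u s. unfold parts_weight, hx.
      eapply cder_eq.
      + apply cder_plus; [apply cder_const|]. apply cder_scal. apply cder_RtoC.
        instantiate (1 := cos (m * s)). auto_derive; auto; ring.
      + ring. }
  (* The two weights combine because [(x - cosh s) + (x + cosh s) = 2 x]. The resulting term
     [2 x legendre_prim] cancels against the derivative of [1 / (x^2 - 1)]. *)
  assert (EN : CInt (fun s => cut_integrand hx (b + 1)%C x s + (b + 1) * cut_integrand (parts_weight m (b + 1)%C) b x s)%C 0 A
     = ((b + 1) * (cut_integral (parts_weight m b) b x + 2 * RtoC x * legendre_prim m b x))%C).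
  { unfold legendre_prim. rewrite (cut_integral_cut (parts_weight m b) (parts_weight_cont m b) b x A), (cut_integral_cut (cos_weight m) (cos_weight_cont m) b x A) by (auto; lra).
    rewrite <- CInt_scal, <- CInt_plus, <- CInt_scal; try exact HA.
    - apply CInt_ext; auto. intros s _. unfold cut_integrand, hx, parts_weight, cos_weight. rewrite ppow_S.
      rewrite !RtoC_mult, !RtoC_plus, RtoC_minus. ring.
    - intros s _. apply ccont_plus; [apply cut_integrand_cont; auto; apply parts_weight_cont|].
      apply ccont_mult; [apply ccont_const|apply cut_integrand_cont; auto; apply cos_weight_cont].
    - intros s _. apply cut_integrand_cont; auto; apply parts_weight_cont.
    - intros s _. apply ccont_mult; [apply ccont_const|apply cut_integrand_cont; auto; apply cos_weight_cont].
    - intros s _. apply cut_integrand_cont; auto; apply cos_weight_cont. }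
  rewrite EN in HN.
  apply cder_ext_loc with (fun t => RtoC (/ (t ^ 2 - 1)) * (/ (b + 1) * N t))%C.
  { assert (L : locally x (fun t => 1 < t)) by (now apply (open_gt 1 x)).
    eapply filter_imp; [|exact L]. intros t Ht. simpl in Ht. symmetry. now apply HE. }
  eapply cder_eq.
  - apply cder_mult.
    + apply cder_RtoC. instantiate (1 := - (2 * x) / (x ^ 2 - 1) ^ 2). auto_derive; [nra|]. field. nra.
    + apply cder_scal. exact HN.
  - assert (EM := HE x Hx).
    assert (E2 : N x = ((b + 1) * RtoC (x ^ 2 - 1) * legendre_prim m b x)%C).
    { rewrite EM, RtoC_inv by nra. field. auto. }
    assert (Hr : x ^ 2 - 1 <> 0) by nra. pose proof (pow_nonzero _ 2 Hr) as Hr2.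
    cbv beta. rewrite E2. unfold legendre_core. rewrite RtoC_div, RtoC_opp, RtoC_mult, RtoC_inv, RtoC_pow by assumption.
    field. auto.
Qed.

Lemma legendre_core_cont m b (x : R) : 0 < Re b -> 1 < x -> ccont (legendre_core m b) x.
Proof.
  intros Hb Hx. assert (Hb0 : b <> 0%C) by now apply C_neq_0_Re.
  apply ccont_ext_loc with (fun x => / b * (RtoC (/ (x ^ 2 - 1)) * cut_integral (parts_weight m b) b x))%C.
  - assert (L : locally x (fun t => 1 < t)) by (now apply (open_gt 1 x)).
    eapply filter_imp; [|exact L]. intros t Ht. simpl in Ht. unfold legendre_core.
    rewrite RtoC_inv by nra. field. split; [|exact Hb0]. intros E; apply RtoC_inj in E; nra.
  - apply ccont_mult; [apply ccont_const|]. apply ccont_mult; [|apply cut_integral_cont; auto; apply parts_weight_cont].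
    apply ccont_RtoC. rcont. nra.
Qed.

(** The modulus is taken inside the improper integral that defines [F_m], where [|cos| <= 1] and the
    power has modulus [(x - cosh s)^(Re b - 1)]. The bound no longer contains [m], which makes it
    usable for the whole series. *)
Lemma legendre_core_bound m b x : 0 < Re b -> 1 < x -> Cmod (legendre_core m b x) <= Re (legendre_core 0 (RtoC (Re b)) x).
Proof.
  intros Hb Hx. set (z := legendre_core m b x).
  assert (HbR : 0 < Re (RtoC (Re b))) by exact Hb.
  pose proof (legendre_integrand_is_CInt_gen 0 (RtoC (Re b)) x HbR Hx) as [H0 _].
  pose proof (arcosh_gt_0 x Hx) as Ha.
  assert (HP : filter_prod (at_point 0) (at_left (arcosh x)) (fun ab => fst ab = 0 /\ 0 < snd ab < arcosh x)).
  { apply Filter_prod with (fun x => x = 0) (fun y => 0 < y < arcosh x).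
    - reflexivity.
    - exists (mkposreal _ Ha). intros y Hy Hya.
      unfold_ball_in Hy.
      apply Rabs_def2 in Hy. lra.
    - intros u v -> Hy. simpl. lra. }
  destruct (is_CInt_gen_scal (Cconj z) _ _ _ _ (legendre_integrand_is_CInt_gen m b x Hb Hx)) as [H1 _].
  fold z in H1.
  assert (H2 := is_RInt_gen_scal (V := R_NormedModule) _ (Cmod z) _ H0).
  assert (HL : norm (Re (Cconj z * z)%C) <= scal (Cmod z) (Re (legendre_core 0 (RtoC (Re b)) x))).
  { apply (RInt_gen_norm (V := R_CompleteNormedModule) (Fa := at_point 0) (Fb := at_left (arcosh x))
      (fun s => Re (Cconj z * legendre_integrand m b x s)%C) (fun s => scal (Cmod z) (Re (legendre_integrand 0 (RtoC (Re b)) x s)))).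
    - apply (filter_imp _ _) with (2 := HP). intros [u v]; simpl; lra.
    - apply (filter_imp _ _) with (2 := HP). intros [u v] [Hu Hv] s Hs; simpl in Hu, Hv, Hs.
      assert (Hc : cosh s < x) by (apply lt_arcosh; lra).
      eapply Rle_trans; [apply (re_le_Cmod (Cconj z * legendre_integrand m b x s)%C)|].
      rewrite Cmod_mult, Cmod_conj. apply Rmult_le_compat_l; [apply Cmod_ge_0|].
      unfold legendre_integrand. rewrite Cmod_mult, Cmod_R, Cmod_cpow.
      rewrite <- RtoC_minus, cpow_R, Rmult_0_l, cos_0, Cmult_1_l. simpl (Re (RtoC _)).
      replace (Re (b - 1)%C) with (Re b - 1) by (simpl; unfold Re; ring).
      rewrite <- (Rmult_1_l (Rpower (x - cosh s) (Re b - 1))) at 2.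
      apply Rmult_le_compat_r; [left; apply exp_pos|apply cos_abs].
    - exact H1.
    - exact H2. }
  change (Rabs (Re (Cconj z * z)%C) <= Cmod z * Re (legendre_core 0 (RtoC (Re b)) x)) in HL.
  assert (E : Re (Cconj z * z)%C = Cmod z * Cmod z)
    by (pose proof (Cmod2_alt z); unfold Re, Im in *; simpl in *; nra).
  rewrite E, Rabs_pos_eq in HL by (pose proof (Cmod_ge_0 z); nra).
  destruct (Req_dec (Cmod z) 0) as [Z|Z].
  (* If [z = 0] the factor [|z|] cannot be cancelled, and the claim is the nonnegativity of the
     integral of a positive function. *)
  - rewrite Z. clear - Hb Hx HP H0 HbR.
    assert (HZ : is_RInt_gen (fun _ : R => 0) (at_point 0) (at_left (arcosh x)) 0).
    { destruct (is_CInt_gen_FTC_left (fun _ => RtoC 0) (fun _ => RtoC 0) (arcosh x)) with (l := RtoC 0) as [HZ _].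
      - now apply arcosh_gt_0.
      - intros s _. apply cder_const.
      - intros s _. apply ccont_const.
      - apply clim_const.
      - replace (Re (RtoC 0 - RtoC 0)%C) with 0 in HZ by (simpl; ring). exact HZ. }
    assert (HG : @norm R_AbsRing R_NormedModule 0 <= Re (legendre_core 0 (RtoC (Re b)) x)).
    2:{ change (Rabs 0 <= Re (legendre_core 0 (RtoC (Re b)) x)) in HG. now rewrite Rabs_R0 in HG. }
    apply (RInt_gen_norm (V := R_CompleteNormedModule) (Fa := at_point 0) (Fb := at_left (arcosh x))
      (fun s => 0) (fun s => Re (legendre_integrand 0 (RtoC (Re b)) x s))); auto.
    + apply (filter_imp _ _) with (2 := HP). intros [u v]; simpl; lra.
    + apply (filter_imp _ _) with (2 := HP). intros [u v] [Hu Hv] s Hs.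
      change (norm 0) with (Rabs 0). rewrite Rabs_R0. unfold legendre_integrand.
      rewrite <- RtoC_minus, cpow_R, Rmult_0_l, cos_0, Cmult_1_l. left; apply exp_pos.
  - apply Rmult_le_reg_l with (Cmod z); [pose proof (Cmod_ge_0 z); lra|exact HL].
Qed.

Lemma cut_integrand_bound m b x s : 0 < Re b -> Cmod (cut_integrand (cos_weight m) b x s) <= Rpower (Rmax 1 x) (Re b).
Proof.
  intros Hb. unfold cut_integrand, cos_weight. rewrite Cmod_mult, Cmod_R. pose proof (cosh_ge_1 s). pose proof (Rmax_r 1 x).
  assert (HP : Cmod (ppow (x - cosh s) b) <= Rpower (Rmax 1 x) (Re b)).
  { destruct (Rle_dec (x - cosh s) 0).
    - rewrite ppow_neg, Cmod_0 by lra. left; apply exp_pos.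
    - rewrite ppow_pos, Cmod_cpow by lra. apply Rle_Rpower_l; lra. }
  rewrite <- (Rmult_1_l (Rpower _ _)).
  apply Rmult_le_compat; [apply Rabs_pos|apply Cmod_ge_0|apply cos_abs|exact HP].
Qed.

Lemma legendre_prim_bound m b x : 0 < Re b -> 1 <= x -> Cmod (legendre_prim m b x) <= sqrt (2 * (x - 1)) * Rpower x (Re b).
Proof.
  intros Hb Hx. unfold legendre_prim. pose proof (arcosh_ge_0 x Hx).
  rewrite (cut_integral_cut (cos_weight m) (cos_weight_cont m) b x (arcosh x)); try lra; [|rewrite cosh_arcosh; lra].
  apply Rle_trans with ((arcosh x - 0) * Rpower x (Re b)).
  - apply CInt_le_const; [lra| |].
    + intros s _. apply cut_integrand_cont; auto; apply cos_weight_cont.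
    + intros s _. replace x with (Rmax 1 x) at 2 by (apply Rmax_right; lra). now apply cut_integrand_bound.
  - apply Rmult_le_compat_r; [left; apply exp_pos|]. pose proof (arcosh_le x Hx). lra.
Qed.

(** * The bilinear integral *)

Lemma ppow_div y u b : 0 < u -> ppow (y / u) b = (ppow y b * cpow u (- b))%C.
Proof.
  intros Hu. destruct (Rle_dec y 0).
  - rewrite !ppow_neg; [ring|lra|].
    unfold Rdiv. rewrite <- (Rmult_0_l (/ u)). apply Rmult_le_compat_r; [left; now apply Rinv_0_lt_compat|lra].
  - rewrite !ppow_pos; [|lra|apply Rdiv_lt_0_compat; lra].
    unfold Rdiv. rewrite cpow_mult, cpow_inv; [reflexivity|lra|lra|now apply Rinv_0_lt_compat].
Qed.

Lemma Rpower_decr s u v : 0 <= s -> 0 < u <= v -> Rpower v (- s) <= Rpower u (- s).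
Proof.
  intros Hs H. rewrite !Rpower_Ropp. apply Rinv_le_contravar; [apply exp_pos|]. now apply Rle_Rpower_l.
Qed.

Section Kernel.
Variables (n : R) (b : C).
Hypotheses (Hn : 0 < n) (Hb : 0 < Re b) (HnPI : sin (n * PI) = 0).

Definition inc_core (x : R) : C := CInt (fun t => RtoC (cos (n * t)) * cpow (cosh t + x) (- b))%C 0 PI.
(** The exponent [p] is kept free because differentiation in [x] lowers it by one; the values used
    are [- b - 1] and [- b - 2]. *)
Definition sin_moment_integrand (p : C) (x t : R) : C := (RtoC (sin (n * t) * sinh t) * cpow (cosh t + x) p)%C.
Definition sin_moment (p : C) (x : R) : C := CInt (fun t => sin_moment_integrand p x t) 0 PI.

Lemma sin_moment_integrand_cont2 p x t : 0 < x -> ccont2 (sin_moment_integrand p) x t.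
Proof.
  intros Hx. apply (ccont_mult (fun q : R * R => RtoC (sin (n * snd q) * sinh (snd q)))
    (fun q : R * R => cpow (cosh (snd q) + fst q) p)).
  - apply ccont_RtoC. rcont.
  - apply (ccont_comp (fun q : R * R => cosh (snd q) + fst q) (fun y => cpow y p)).
    + rcont.
    + apply ccont_cpow. simpl. pose proof (cosh_ge_1 t). lra.
Qed.

Lemma sin_moment_cont p (x : R) : 0 < x -> ccont (sin_moment p) x.
Proof.
  intros Hx. apply (CInt_param_cont (sin_moment_integrand p) (x / 2) (x + 1) 0 PI x); try lra.
  - pose proof PI_RGT_0; lra.
  - intros u t Hu _. apply sin_moment_integrand_cont2. lra.
Qed.

Lemma sin_moment_der p x : 0 < x -> cder (sin_moment p) x (p * sin_moment (p - 1) x)%C.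
Proof.
  intros Hx. pose proof PI_RGT_0 as HPI.
  eapply cder_eq.
  - apply (CInt_param_der (sin_moment_integrand p) (fun x t => p * sin_moment_integrand (p - 1) x t)%C (x / 2) (x + 1) 0 PI x); try lra.
    + intros u t Hu _. unfold sin_moment_integrand. eapply cder_eq.
      * apply cder_scal. apply (cder_comp (fun y => cpow y p) (fun u => cosh t + u)).
        -- apply cder_cpow. pose proof (cosh_ge_1 t). lra.
        -- instantiate (1 := 1). auto_derive; auto; ring.
      * cbv beta. ring.
    + intros u t Hu _. apply sin_moment_integrand_cont2. lra.
    + intros u t Hu _. apply (ccont_mult (fun _ : R * R => p)); [apply ccont_const|].
      apply (sin_moment_integrand_cont2 (p - 1) u t). lra.
  - apply CInt_scal; [lra|]. intros t _. apply (ccont2_snd (sin_moment_integrand (p - 1))). now apply sin_moment_integrand_cont2.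
Qed.

Lemma sin_moment_bound p x : Re p <= 0 -> 1 <= x -> Cmod (sin_moment p x) <= PI * sinh PI * Rpower x (Re p).
Proof.
  intros Hp Hx. pose proof PI_RGT_0 as HPI.
  rewrite Rmult_assoc. replace PI with (PI - 0) at 1 by ring.
  apply CInt_le_const; [lra| |].
  - intros t _. apply (ccont2_snd (sin_moment_integrand p)). apply sin_moment_integrand_cont2. lra.
  - intros t Ht. unfold sin_moment_integrand. rewrite Cmod_mult, Cmod_R, Cmod_cpow.
    apply Rmult_le_compat; [apply Rabs_pos|left; apply exp_pos| |].
    + rewrite Rabs_mult. rewrite <- (Rmult_1_l (sinh PI)).
      apply Rmult_le_compat; try apply Rabs_pos; [apply sin_abs|].
      rewrite Rabs_pos_eq by (apply sinh_nonneg; lra). apply sinh_mono. lra.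
    + replace (Re p) with (- (- Re p)) by ring. apply Rpower_decr; [lra|].
      pose proof (cosh_ge_1 t). lra.
Qed.

Lemma inc_core_eq x : 0 < x -> inc_core x = (b / RtoC n * sin_moment (- b - 1) x)%C.
Proof.
  intros Hx. pose proof PI_RGT_0 as HPI.
  assert (Hn0 : RtoC n <> 0%C) by (intros E; apply RtoC_inj in E; lra).
  assert (Hpos : forall t, 0 < cosh t + x) by (intros t; pose proof (cosh_ge_1 t); lra).
  assert (HcG : ccont_on (fun t => RtoC (cos (n * t)) * cpow (cosh t + x) (- b))%C 0 PI).
  { intros t _. apply ccont_mult; [apply ccont_RtoC; rcont|].
    apply (ccont_comp (fun t => cosh t + x) (fun y => cpow y (- b)%C)); [rcont|now apply ccont_cpow]. }
  assert (Hcg : ccont_on (fun t => sin_moment_integrand (- b - 1) x t) 0 PI).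
  { intros t _. apply (ccont2_snd (sin_moment_integrand (- b - 1))). now apply sin_moment_integrand_cont2. }
  assert (E : (RtoC n * inc_core x - b * sin_moment (- b - 1) x)%C =
    (RtoC (sin (n * PI)) * cpow (cosh PI + x) (- b) - RtoC (sin (n * 0)) * cpow (cosh 0 + x) (- b))%C).
  { unfold inc_core, sin_moment. rewrite <- !CInt_scal, <- CInt_minus by (try lra; try assumption; now apply ccont_on_scal).
    apply (CInt_FTC (fun t => RtoC (sin (n * t)) * cpow (cosh t + x) (- b))%C); [lra| |].
    - intros t _. eapply cder_eq.
      + apply cder_mult.
        * apply cder_RtoC. instantiate (1 := n * cos (n * t)). auto_derive; auto; ring.
        * apply (cder_comp (fun y => cpow y (- b)%C) (fun t => cosh t + x)).
          -- now apply cder_cpow.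
          -- instantiate (1 := sinh t). auto_derive; auto; ring.
      + cbv beta. unfold sin_moment_integrand. rewrite !RtoC_mult. ring.
    - intros t Ht. apply ccont_minus; apply ccont_mult; try apply ccont_const; [now apply HcG|now apply Hcg]. }
  rewrite HnPI, Rmult_0_r, sin_0 in E.
  assert (E2 : (RtoC n * inc_core x = b * sin_moment (- b - 1) x)%C).
  { apply Ceq_minus. rewrite E. ring. }
  apply Cmult_eq_reg_l with (RtoC n); [|exact Hn0]. rewrite E2. field. exact Hn0.
Qed.

(** The derivative of [(x - cosh s) / (x + cosh t)] is [(cosh s + cosh t) / (x + cosh t)^2], so the
    integrand is a multiple of the derivative of the [(b+1)]-th power of that ratio. The ratio tends
    to [1], which gives the value over the half-line. *)
Lemma inner_x_integral s t X : 1 <= X ->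
  CInt (fun x => cpow (cosh t + x) (- b - 2) * ppow (x - cosh s) b)%C 1 X =
  (/ ((b + 1) * RtoC (cosh s + cosh t)) * ppow ((X - cosh s) / (X + cosh t)) (b + 1))%C.
Proof.
  intros HX. pose proof (cosh_ge_1 s) as Hs. pose proof (cosh_ge_1 t) as Ht.
  assert (Hb10 : (b + 1)%C <> 0%C) by (apply C_neq_0_Re; simpl; unfold Re in *; lra).
  assert (HN : RtoC (cosh s + cosh t) <> 0%C) by (intros E; apply RtoC_inj in E; lra).
  set (c := (/ ((b + 1) * RtoC (cosh s + cosh t)))%C).
  rewrite (CInt_FTC (fun x => c * ppow ((x - cosh s) / (x + cosh t)) (b + 1))%C); [|exact HX| |].
  - rewrite (ppow_neg ((1 - cosh s) / (1 + cosh t))); [ring|].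
    unfold Rdiv. rewrite <- (Rmult_0_l (/ (1 + cosh t))). apply Rmult_le_compat_r; [|lra].
    left; apply Rinv_0_lt_compat; lra.
  - intros x Hx. eapply cder_eq.
    + apply cder_scal. apply (cder_comp (fun y => ppow y (b + 1)%C) (fun x => (x - cosh s) / (x + cosh t))).
      * now apply cder_ppow.
      * instantiate (1 := (cosh s + cosh t) * / (x + cosh t) ^ 2). auto_derive; [lra|]. field. lra.
    + rewrite ppow_div by lra. unfold c. rewrite RtoC_mult.
      assert (E : cpow (cosh t + x) (- b - 2) = (RtoC (/ (x + cosh t) ^ 2) * cpow (x + cosh t) (- b))%C).
      { replace (cosh t + x) with (x + cosh t) by ring.
        replace (- b - 2)%C with (- b + RtoC (-2))%C by (apply C_ext; unfold Re, Im; simpl; ring).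
        rewrite cpow_plus, cpow_R.
        replace (Rpower (x + cosh t) (-2)) with (/ (x + cosh t) ^ 2); [ring|].
        replace (-2) with (- INR 2) by (simpl; ring). rewrite Rpower_Ropp, Rpower_pow by lra. reflexivity. }
      rewrite E. field. split; [exact HN|exact Hb10].
  - intros x Hx. apply ccont_mult.
    + apply (ccont_comp (fun x => cosh t + x) (fun y => cpow y (- b - 2)%C)); [rcont|apply ccont_cpow; lra].
    + apply (ccont_comp (fun x => x - cosh s) (fun y => ppow y b)); [rcont|now apply ccont_ppow].
Qed.

Variable (m : R).
Hypothesis (Hm : 0 < m).

(** The integral [wave_int] up to [arcosh X], with the extra factor that truncating the [x]-integral
    at [X] leaves behind. *)
Definition ratio_integral X t := CInt (fun s => RtoC (cos (m * s) * (sinh t / (cosh s + cosh t))) *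
  ppow ((X - cosh s) / (X + cosh t)) (b + 1))%C 0 (arcosh X).

Lemma ratio_integrand_cont2 X t s : 0 < X -> ccont2 (fun t s => RtoC (cos (m * s) * (sinh t / (cosh s + cosh t))) *
  ppow ((X - cosh s) / (X + cosh t)) (b + 1))%C t s.
Proof.
  intros HX. pose proof (cosh_ge_1 s) as Hs. pose proof (cosh_ge_1 t) as Ht.
  apply (ccont_mult (fun q : R * R => RtoC (cos (m * snd q) * (sinh (fst q) / (cosh (snd q) + cosh (fst q)))))
    (fun q : R * R => ppow ((X - cosh (snd q)) / (X + cosh (fst q))) (b + 1)%C)).
  - apply ccont_RtoC. rcont. simpl. lra.
  - apply (ccont_comp (fun q : R * R => (X - cosh (snd q)) / (X + cosh (fst q))) (fun y => ppow y (b + 1)%C)).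
    + rcont. simpl. lra.
    + apply ccont_ppow. simpl; unfold Re in *; lra.
Qed.

Lemma ratio_integral_cont X (t : R) : 1 <= X -> ccont (ratio_integral X) t.
Proof.
  intros HX. apply (CInt_param_cont_glob (fun t s => RtoC (cos (m * s) * (sinh t / (cosh s + cosh t))) *
  ppow ((X - cosh s) / (X + cosh t)) (b + 1))%C 0 (arcosh X)).
  - now apply arcosh_ge_0.
  - intros u v. apply ratio_integrand_cont2. lra.
Qed.

Lemma legendre_prim_continuous (x : R) : ccont (legendre_prim m b) x.
Proof. apply cut_integral_cont; auto. apply cos_weight_cont. Qed.

Lemma ccont2_of_fst (f : R -> C) (x y : R) : ccont f x -> ccont2 (fun u _ => f u) x y.
Proof. intros H. apply (ccont_comp (fun q : R * R => fst q) f); [apply continuous_fst|exact H]. Qed.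

Lemma ccont2_mult (f g : R -> R -> C) (x y : R) : ccont2 f x y -> ccont2 g x y ->
  ccont2 (fun u v => f u v * g u v)%C x y.
Proof. apply (ccont_mult (fun q : R * R => f (fst q) (snd q)) (fun q : R * R => g (fst q) (snd q))). Qed.

(** Fubini is applied twice, to [(x, t)] and then to [(x, s)]. For [x <= X] the truncated power
    vanishes beyond [s = arcosh X], so the second domain is a rectangle as well. *)
Lemma sin_moment_prim_integral X : 1 < X ->
  ((b + 1) * CInt (fun x => sin_moment (- b - 2) x * legendre_prim m b x) 1 X)%C =
  CInt (fun t => RtoC (sin (n * t)) * ratio_integral X t)%C 0 PI.
Proof.
  intros HX. pose proof PI_RGT_0 as HPI. set (A := arcosh X).
  assert (HA : 0 <= A) by (apply arcosh_ge_0; lra).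
  assert (HAX : cosh A = X) by (apply cosh_arcosh; lra).
  assert (Hb10 : (b + 1)%C <> 0%C) by (apply C_neq_0_Re; simpl; unfold Re in *; lra).
  set (p := (- b - 2)%C).
  rewrite (CInt_ext _ (fun x => CInt (fun t => sin_moment_integrand p x t * legendre_prim m b x)%C 0 PI)); [|lra|].
  2:{ intros x Hx. unfold sin_moment. rewrite Cmult_comm, <- CInt_scal.
      - apply CInt_ext; [lra|]. intros t _. ring.
      - lra.
      - intros t _. apply (ccont2_snd (sin_moment_integrand p)), sin_moment_integrand_cont2. lra. }
  rewrite CInt_Fubini; try lra.
  2:{ intros x t Hx _. apply ccont2_mult; [apply sin_moment_integrand_cont2; lra|]. apply ccont2_of_fst, legendre_prim_continuous. }
  rewrite <- CInt_scal; [|lra|].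
  2:{ intros t _. apply (CInt_param_cont (fun t x => sin_moment_integrand p x t * legendre_prim m b x)%C (t - 1) (t + 1) 1 X); try lra.
      intros u x _ Hx.
      destruct (ccont2_mult (sin_moment_integrand p) (fun u _ => legendre_prim m b u) x u) as [C1 C2].
      - apply sin_moment_integrand_cont2; lra.
      - apply ccont2_of_fst, legendre_prim_continuous.
      - split; [apply (cont2_swap (fun x y => Re (sin_moment_integrand p x y * legendre_prim m b x)%C))|apply (cont2_swap (fun x y => Im (sin_moment_integrand p x y * legendre_prim m b x)%C))]; assumption. }
  apply CInt_ext; [lra|]. intros t Ht.
  pose proof (cosh_ge_1 t) as Hct.
  set (k := fun x s : R => (cpow (cosh t + x) p * cut_integrand (cos_weight m) b x s)%C).
  assert (Hk : forall x s, 0 < x -> ccont2 k x s).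
  { intros x s Hx. apply ccont2_mult; [|apply cut_integrand_cont2; auto; apply cos_weight_cont].
    apply (ccont2_of_fst (fun x => cpow (cosh t + x) p)).
    apply (ccont_comp (fun x => cosh t + x) (fun y => cpow y p)); [rcont|]. apply ccont_cpow. lra. }
  rewrite (CInt_ext _ (fun x => RtoC (sin (n * t) * sinh t) * CInt (fun s => k x s) 0 A)%C); [|lra|].
  2:{ intros x Hx. unfold sin_moment_integrand, k, legendre_prim.
      rewrite (cut_integral_cut (cos_weight m) (cos_weight_cont m) b x A); try lra.
      rewrite CInt_scal; [ring|lra|]. intros s _. apply cut_integrand_cont; auto. apply cos_weight_cont. }
  rewrite CInt_scal; [|lra|].
  2:{ intros x Hx. apply (CInt_param_cont k (x / 2) (x + 1) 0 A); try lra.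
      intros u s Hu _. apply Hk. lra. }
  rewrite CInt_Fubini; try lra; [|intros x s Hx _; apply Hk; lra].
  unfold ratio_integral. fold A.
  rewrite (CInt_ext (fun s => CInt (fun x => k x s) 1 X)
     (fun s => (RtoC (cos (m * s)) * (/ ((b + 1) * RtoC (cosh s + cosh t)) * ppow ((X - cosh s) / (X + cosh t)) (b + 1)))%C)); [|lra|].
  2:{ intros s Hs. rewrite <- inner_x_integral by lra. rewrite <- CInt_scal; [|lra|].
      - apply CInt_ext; [lra|]. intros x _. unfold k, cut_integrand, cos_weight. fold p. ring.
      - intros x Hx. apply ccont_mult.
        + apply (ccont_comp (fun x => cosh t + x) (fun y => cpow y (- b - 2)%C)); [rcont|apply ccont_cpow; lra].
        + apply (ccont_comp (fun x => x - cosh s) (fun y => ppow y b)); [rcont|now apply ccont_ppow]. }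
  assert (HQc : ccont_on (fun s => RtoC (cos (m * s)) * (/ ((b + 1) * RtoC (cosh s + cosh t)) * ppow ((X - cosh s) / (X + cosh t)) (b + 1)))%C 0 A).
  { intros s _. pose proof (cosh_ge_1 s).
    apply ccont_ext with (fun s => / (b + 1) * (RtoC (cos (m * s) * / (cosh s + cosh t)) * ppow ((X - cosh s) / (X + cosh t)) (b + 1)))%C.
    - intros u. pose proof (cosh_ge_1 u).
      rewrite RtoC_mult, RtoC_inv by lra. field. split; [|exact Hb10]. intros E; apply RtoC_inj in E; lra.
    - apply ccont_mult; [apply ccont_const|]. apply ccont_mult; [apply ccont_RtoC; rcont; lra|].
      apply (ccont_comp (fun s => (X - cosh s) / (X + cosh t)) (fun y => ppow y (b + 1)%C)); [rcont; lra|].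
      apply ccont_ppow. simpl; unfold Re in *; lra. }
  rewrite <- CInt_scal, <- CInt_scal, <- CInt_scal; try lra; auto.
  - apply CInt_ext; [lra|]. intros s _. pose proof (cosh_ge_1 s).
    rewrite !RtoC_mult, RtoC_div by lra. field.
    split; [|exact Hb10]. intros E; apply RtoC_inj in E; lra.
  - intros s _. apply (ccont2_snd (fun t s => RtoC (cos (m * s) * (sinh t / (cosh s + cosh t))) *
      ppow ((X - cosh s) / (X + cosh t)) (b + 1))%C). apply ratio_integrand_cont2. lra.
  - now apply ccont_on_scal.
Qed.

(** By [ppow_near_1] the factor differs from [1] by at most
    [|b+1| (cosh s + cosh t) / (X + cosh t)], whose numerator cancels the denominator of the kernel.
    This leaves [O(1/X)] on an interval of length [arcosh X], for which the crude bound
    [sqrt (2 (X - 1))] is enough. *)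
Lemma ratio_integral_approx X t : 1 < X -> 0 <= t <= PI ->
  Cmod (ratio_integral X t - RtoC (wave_int m (arcosh X) t))%C <= sqrt (2 * (X - 1)) * (sinh PI * Cmod (b + 1) / X).
Proof.
  intros HX Ht. set (A := arcosh X).
  assert (HA : 0 <= A) by (apply arcosh_ge_0; lra).
  assert (HAX : cosh A = X) by (apply cosh_arcosh; lra).
  pose proof (cosh_ge_1 t) as Hct.
  unfold wave_int. rewrite <- CInt_RtoC. unfold ratio_integral. fold A.
  assert (C1 : ccont_on (fun s => RtoC (cos (m * s) * (sinh t / (cosh s + cosh t))) *
      ppow ((X - cosh s) / (X + cosh t)) (b + 1))%C 0 A).
  { intros s _. apply (ccont2_snd (fun t s => RtoC (cos (m * s) * (sinh t / (cosh s + cosh t))) *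
      ppow ((X - cosh s) / (X + cosh t)) (b + 1))%C). apply ratio_integrand_cont2. lra. }
  assert (C2 : ccont_on (fun s => RtoC (cos (m * s) * (sinh t / (cosh s + cosh t)))) 0 A).
  { intros s _. apply ccont_RtoC. rcont. pose proof (cosh_ge_1 s). lra. }
  rewrite <- CInt_minus by assumption.
  assert (Hnn : 0 <= sinh PI * Cmod (b + 1) / X).
  { apply Rmult_le_pos; [|left; apply Rinv_0_lt_compat; lra].
    apply Rmult_le_pos; [apply sinh_nonneg; pose proof PI_RGT_0; lra|apply Cmod_ge_0]. }
  apply Rle_trans with ((A - 0) * (sinh PI * Cmod (b + 1) / X)).
  - apply CInt_le_const; [exact HA| |].
    + intros s Hs. apply ccont_minus; [now apply C1|now apply C2].
    + intros s Hs. pose proof (cosh_ge_1 s) as Hcs.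
      assert (Hsx : cosh s < X) by (apply lt_arcosh; unfold A in Hs; lra).
      set (rho := (X - cosh s) / (X + cosh t)).
      assert (Hr : 0 <= rho <= 1).
      { unfold rho. split; [apply Rmult_le_pos; [lra|left; apply Rinv_0_lt_compat; lra]|].
        apply Rmult_le_reg_r with (X + cosh t); [lra|]. unfold Rdiv. rewrite Rmult_assoc, Rinv_l by lra. lra. }
      match goal with |- Cmod (?w * ?p - ?w)%C <= _ => replace (w * p - w)%C with (- (w * (1 - p)))%C by ring end.
      rewrite Cmod_opp, Cmod_mult, Cmod_R.
      pose proof (ppow_near_1 b rho Hb Hr) as Hp.
      apply Rle_trans with (Rabs (cos (m * s) * (sinh t / (cosh s + cosh t))) * (Cmod (b + 1) * (1 - rho))).
      { apply Rmult_le_compat_l; [apply Rabs_pos|exact Hp]. }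
      rewrite Rabs_mult. pose proof (sinh_nonneg t (proj1 Ht)) as Hst.
      rewrite (Rabs_pos_eq (sinh t / _)) by (apply Rmult_le_pos; [lra|left; apply Rinv_0_lt_compat; lra]).
      assert (E : 1 - rho = (cosh s + cosh t) / (X + cosh t)) by (unfold rho; field; lra).
      rewrite E.
      replace (Rabs (cos (m * s)) * (sinh t / (cosh s + cosh t)) * (Cmod (b + 1) * ((cosh s + cosh t) / (X + cosh t))))
        with (Rabs (cos (m * s)) * (sinh t * Cmod (b + 1) * / (X + cosh t))) by (field; lra).
      rewrite <- (Rmult_1_l (sinh PI * _ / X)).
      pose proof (Cmod_ge_0 (b + 1)%C) as Hcb.
      assert (0 < / (X + cosh t)) by (apply Rinv_0_lt_compat; lra).
      apply Rmult_le_compat; [apply Rabs_pos| |apply cos_abs|].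
      * apply Rmult_le_pos; [apply Rmult_le_pos; lra|lra].
      * apply Rmult_le_compat; try lra.
        -- apply Rmult_le_pos; lra.
        -- apply Rmult_le_compat_r; [lra|]. apply sinh_mono. lra.
        -- apply Rinv_le_contravar; lra.
  - apply Rmult_le_compat_r; [exact Hnn|]. pose proof (arcosh_le X ltac:(lra)). unfold A. lra.
Qed.

Definition sin_sin_int := RInt (fun t => sin (n * t) * sin (m * t)) 0 PI.

(** The first term comes from replacing the ratio power by [1], the second from truncating the
    Fourier integral at [arcosh X]. There [cosh] equals [X], and [X] is also used as an upper bound
    for [sinh]. *)
Definition core_error X := PI * (sqrt (2 * (X - 1)) * (sinh PI * Cmod (b + 1) / X)
   + (PI * sinh PI + PI) / m * tail_err m X X).

Lemma sin_moment_prim_limit X : 1 < X ->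
  Cmod ((b + 1) * CInt (fun x => sin_moment (- b - 2) x * legendre_prim m b x) 1 X - RtoC (PI / sinh (m * PI) * sin_sin_int))%C <= core_error X.
Proof.
  intros HX. pose proof PI_RGT_0 as HPI. set (A := arcosh X).
  assert (HA : 0 < A) by (apply arcosh_gt_0; lra).
  assert (HAX : cosh A = X) by (apply cosh_arcosh; lra).
  rewrite sin_moment_prim_integral by exact HX.
  unfold sin_sin_int. rewrite <- RInt_Rscal by (apply ex_RInt_cont; [lra|]; intros; rcont).
  rewrite <- CInt_RtoC.
  assert (C1 : ccont_on (fun t => RtoC (sin (n * t)) * ratio_integral X t)%C 0 PI).
  { intros t _. apply ccont_mult; [apply ccont_RtoC; rcont|]. apply ratio_integral_cont. lra. }
  assert (C2 : ccont_on (fun t => RtoC (PI / sinh (m * PI) * (sin (n * t) * sin (m * t)))) 0 PI).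
  { intros t _. apply ccont_RtoC. apply rc_mult; [apply continuous_const|]. rcont. }
  rewrite <- CInt_minus by (try lra; assumption).
  unfold core_error. set (k := _ + _). replace (PI * k) with ((PI - 0) * k) by ring. unfold k.
  apply CInt_le_const; [lra| |].
  - intros t Ht. apply ccont_minus; [now apply C1|now apply C2].
  - intros t Ht.
    replace (RtoC (sin (n * t)) * ratio_integral X t - RtoC (PI / sinh (m * PI) * (sin (n * t) * sin (m * t))))%C with
      (RtoC (sin (n * t)) * ((ratio_integral X t - RtoC (wave_int m A t)) + RtoC (wave_int m A t - sin (m * t) * (PI / sinh (m * PI)))))%C
      by (rewrite RtoC_minus, !RtoC_mult; ring).
    rewrite Cmod_mult, Cmod_R. rewrite <- (Rmult_1_l (_ + _)).
    apply Rmult_le_compat; [apply Rabs_pos|apply Cmod_ge_0|apply sin_abs|].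
    eapply Rle_trans; [apply Cmod_triangle|]. apply Rplus_le_compat.
    + apply ratio_integral_approx; lra.
    + rewrite Cmod_R. eapply Rle_trans; [apply wave_int_lim; lra|].
      pose proof (sinh_nonneg PI ltac:(lra)).
      apply Rmult_le_compat_l.
      * apply Rmult_le_pos; [nra|left; now apply Rinv_0_lt_compat].
      * unfold tail_err. rewrite HAX. apply Rplus_le_compat_r.
        apply Rmult_le_compat_r; [left; apply Rinv_0_lt_compat; nra|].
        pose proof (cosh_sqr A). rewrite HAX in *. pose proof (sinh_nonneg A ltac:(lra)). nra.
Qed.

End Kernel.

(** * The improper bilinear integral and its dominating function *)

Lemma lim_sqrt_inv : filterlim (fun X => sqrt (2 * / X)) poo (locally 0).
Proof.
  rewrite <- sqrt_0.
  apply (filterlim_comp _ _ _ (fun X => 2 * / X) sqrt poo (locally 0)).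
  - rewrite <- (Rmult_0_r 2). apply flim_mult; [apply filterlim_const|].
    apply filterlim_ext with (fun X => / (0 + X)); [intros; now rewrite Rplus_0_l|apply lim_inv_poo].
  - apply continuous_sqrt.
Qed.

Lemma sqrt_growth X : 1 <= X -> sqrt (2 * (X - 1)) / X <= sqrt (2 * / X).
Proof.
  intros H. apply Rmult_le_reg_r with X; [lra|]. unfold Rdiv. rewrite Rmult_assoc, Rinv_l, Rmult_1_r by lra.
  rewrite <- (sqrt_Rsqr X) at 3 by lra.
  rewrite <- sqrt_mult_alt by (apply Rmult_le_pos; [lra|left; apply Rinv_0_lt_compat; lra]).
  apply sqrt_le_1_alt. unfold Rsqr. replace (2 * / X * (X * X)) with (2 * X) by (field; lra). lra.
Qed.

Lemma lim_sqrt_frac : filterlim (fun X => sqrt (2 * (X - 1)) / X) poo (locally 0).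
Proof.
  apply flim_squeeze with (fun X => sqrt (2 * / X)); [|apply lim_sqrt_inv].
  exists 1. intros X HX. rewrite Rminus_0_r, Rabs_pos_eq.
  - apply sqrt_growth; lra.
  - apply Rmult_le_pos; [apply sqrt_pos|left; apply Rinv_0_lt_compat; lra].
Qed.

Lemma core_error_lim b m : filterlim (core_error b m) poo (locally 0).
Proof.
  apply filterlim_ext with (fun X => PI * ((sinh PI * Cmod (b + 1)) * (sqrt (2 * (X - 1)) / X)
     + (PI * sinh PI + PI) / m * (X / (X - 1) ^ 2 + m * / (-1 + X)))).
  { intros X. unfold core_error, tail_err, Rdiv. replace (-1 + X) with (X - 1) by ring. ring. }
  assert (L : filterlim (fun X => X / (X - 1) ^ 2) poo (locally 0)).
  { apply flim_squeeze with (fun X => 2 * / (-1 + X)).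
    - exists 2. intros X HX. rewrite Rminus_0_r, Rabs_pos_eq.
      + apply Rmult_le_reg_r with ((X - 1) ^ 2); [nra|].
        replace (2 * / (-1 + X) * (X - 1) ^ 2) with (2 * (X - 1)) by (field; lra).
        unfold Rdiv. rewrite Rmult_assoc, Rinv_l by nra. lra.
      + apply Rmult_le_pos; [lra|left; apply Rinv_0_lt_compat; nra].
    - rewrite <- (Rmult_0_r 2). apply flim_mult; [apply filterlim_const|apply lim_inv_poo]. }
  replace 0 with (PI * ((sinh PI * Cmod (b + 1)) * 0 + (PI * sinh PI + PI) / m * (0 + m * 0))) by ring.
  apply flim_mult; [apply filterlim_const|]. apply flim_plus.
  - apply flim_mult; [apply filterlim_const|apply lim_sqrt_frac].
  - apply flim_mult; [apply filterlim_const|]. apply flim_plus; [exact L|].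
    apply flim_mult; [apply filterlim_const|apply lim_inv_poo].
Qed.

Lemma legendre_prim_at_1 m b : 0 < Re b -> legendre_prim m b 1 = 0%C.
Proof.
  intros Hb. unfold legendre_prim. rewrite (cut_integral_cut (cos_weight m) (cos_weight_cont m) b 1 0); try lra; [|rewrite cosh_0; lra].
  apply CInt_point.
Qed.

Lemma Re_opp_sub b (k : R) : Re (- b - RtoC k)%C = - Re b - k.
Proof. simpl. unfold Re. ring. Qed.

Lemma inc_core_legendre_core_integral n m b : 0 < n -> 0 < m -> 0 < Re b -> sin (n * PI) = 0 ->
  is_CInt_gen (fun x => inc_core n b x * legendre_core m b x)%C (at_right 1) poo
    (/ RtoC n * RtoC (PI / sinh (m * PI) * sin_sin_int n m))%C.
Proof.
  intros Hn Hm Hb HnPI.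
  set (p := (- b - 1)%C). set (q := (- b - 2)%C).
  assert (Hgc : forall x : R, 0 < x -> ccont (fun x => sin_moment n q x * legendre_prim m b x)%C x).
  { intros x Hx. apply ccont_mult; [now apply sin_moment_cont|now apply legendre_prim_continuous]. }
  (* Integration by parts in [x]: the derivative of [legendre_prim] is [b legendre_core], that of
     [sin_moment p] is [-(b+1) sin_moment q], and the integral term removes the latter
     contribution. *)
  set (P := fun x => (/ RtoC n * (sin_moment n p x * legendre_prim m b x + (b + 1) * CInt (fun u => sin_moment n q u * legendre_prim m b u) 1 x))%C).
  assert (HI : forall x, 0 < x -> cder (fun x => CInt (fun u => sin_moment n q u * legendre_prim m b u)%C 1 x) x (sin_moment n q x * legendre_prim m b x)%C).
  { intros x Hx. apply (CInt_der (fun u => sin_moment n q u * legendre_prim m b u)%C 0); try lra. exact Hgc. }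
  set (L := (/ RtoC n * RtoC (PI / sinh (m * PI) * sin_sin_int n m))%C).
  refine (is_CInt_gen_ext (fun x => (b / RtoC n * sin_moment n p x) * legendre_core m b x)%C _ _ _ _ _ _).
  { apply ext_at_right_poo. intros x Hx. rewrite inc_core_eq by (auto; lra). reflexivity. }
  replace L with (L - 0)%C by ring.
  apply is_CInt_gen_FTC with P.
  - intros x Hx. eapply cder_eq.
    + apply cder_scal. apply cder_plus.
      * apply cder_mult; [apply sin_moment_der; lra|now apply legendre_prim_der].
      * apply cder_scal. apply HI. lra.
    + cbv beta. unfold Cdiv. replace (p - 1)%C with q by (unfold p, q; ring). unfold p at 1. ring.
  - intros x Hx. apply ccont_mult; [|now apply legendre_core_cont].
    apply ccont_mult; [apply ccont_const|]. apply sin_moment_cont; lra.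
  - assert (CP : ccont P 1).
    { unfold P. apply ccont_mult; [apply ccont_const|]. apply ccont_plus.
      - apply ccont_mult; [apply sin_moment_cont; lra|now apply legendre_prim_continuous].
      - apply ccont_mult; [apply ccont_const|]. eapply cder_ccont. apply HI. lra. }
    apply ccont_at_right in CP. eapply clim_eq; [exact CP|].
    unfold P. rewrite CInt_point, legendre_prim_at_1 by exact Hb. ring.
  - unfold P, L. apply clim_mult; [apply clim_const|].
    eapply clim_eq; [apply clim_plus|].
    (* The boundary term is at most a constant times [X^(- Re b - 1) sqrt (2 (X - 1)) X^(Re b)],
       which is of order [X^(-1/2)]. *)
    + apply clim_squeeze with (l := RtoC 0) (g := fun X => PI * sinh PI * (sqrt (2 * (X - 1)) / X)).
      * exists 1. intros X HX. replace (sin_moment n p X * legendre_prim m b X - 0)%C with (sin_moment n p X * legendre_prim m b X)%C by ring.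
        rewrite Cmod_mult.
        assert (Hp : Re p = - Re b - 1) by apply (Re_opp_sub b 1).
        pose proof (sin_moment_bound n p X ltac:(lra) ltac:(lra)) as B1.
        pose proof (legendre_prim_bound m b X Hb ltac:(lra)) as B2.
        eapply Rle_trans; [apply Rmult_le_compat; [apply Cmod_ge_0|apply Cmod_ge_0|exact B1|exact B2]|].
        right. rewrite Hp. replace (- Re b - 1) with (- Re b + - (1)) by ring.
        rewrite Rpower_plus, !Rpower_Ropp, Rpower_1 by lra.
        field. split; [lra|apply Rgt_not_eq, exp_pos].
      * rewrite <- (Rmult_0_r (PI * sinh PI)). apply flim_mult; [apply filterlim_const|apply lim_sqrt_frac].
    + apply clim_squeeze with (l := RtoC (PI / sinh (m * PI) * sin_sin_int n m)) (g := core_error b m).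
      * exists 1. intros X HX. now apply sin_moment_prim_limit.
      * apply core_error_lim.
    + ring.
Qed.

(** * A majorant independent of the summation index *)

Definition dominating (s : R) (x : R) := Rpower x (- s - 1) * Re (legendre_core 0 (RtoC s) x).
(** Integration by parts as in the bilinear integral, with a pure power in place of [sin_moment].
    The lower limit [2] is the base point [a + 1] of [dominated_cauchy] for [a = 1]. *)
Definition dominating_prim (s : R) (x : R) := / s * (Rpower x (- s - 1) * Re (legendre_prim 0 (RtoC s) x)
   + (s + 1) * RInt (fun u => Rpower u (- s - 2) * Re (legendre_prim 0 (RtoC s) u)) 2 x).

Lemma Rpower_cont p (x : R) : 0 < x -> continuous (fun u => Rpower u p) x.
Proof.
  intros H. apply (ex_derive_continuous (V := R_NormedModule)). unfold Rpower. auto_derive; auto.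
Qed.

Lemma dominating_cont s (x : R) : 0 < s -> 1 < x -> continuous (dominating s) x.
Proof.
  intros Hs Hx. apply rc_mult; [apply Rpower_cont; lra|]. apply (legendre_core_cont 0 (RtoC s) x); auto.
Qed.

Lemma dom_prim_integrand_cont s (x : R) : 0 < s -> 0 < x -> continuous (fun u => Rpower u (- s - 2) * Re (legendre_prim 0 (RtoC s) u)) x.
Proof.
  intros Hs Hx. apply rc_mult; [now apply Rpower_cont|]. apply (cut_integral_cont (cos_weight 0) (cos_weight_cont 0) (RtoC s) x Hs).
Qed.

Lemma dominating_prim_der s x : 0 < s -> 1 < x -> is_derive (dominating_prim s) x (dominating s x).
Proof.
  intros Hs Hx.
  assert (D1 : is_derive (fun u => Rpower u (- s - 1)) x ((- s - 1) * Rpower x (- s - 2))).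
  { assert (E : Rpower x (- s - 2) = Rpower x (- s - 1) * / x).
    { replace (- s - 2) with (- s - 1 + - (1)) by ring. rewrite Rpower_plus, Rpower_Ropp, Rpower_1 by lra. reflexivity. }
    rewrite E. unfold Rpower. auto_derive; [lra|].
    change (- s + - (1)) with (- s - 1). ring. }
  destruct (legendre_prim_der 0 (RtoC s) x Hs Hx) as [D2 _].
  assert (D3 : is_derive (fun x => RInt (fun u => Rpower u (- s - 2) * Re (legendre_prim 0 (RtoC s) u)) 2 x) x
    (Rpower x (- s - 2) * Re (legendre_prim 0 (RtoC s) x))).
  { apply (RInt_der (fun u => Rpower u (- s - 2) * Re (legendre_prim 0 (RtoC s) u)) 0); try lra.
    intros t Ht. now apply dom_prim_integrand_cont. }
  rewrite re_scal_l in D2.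
  unfold dominating_prim. evar_last.
  - apply (is_derive_scal (fun x => _ + _) x (/ s)).
    apply (is_derive_plus (V := R_NormedModule)); [apply (der_mult _ _ _ _ _ D1 D2)|].
    apply (is_derive_scal _ x (s + 1)). exact D3.
  - unfold dominating. unfold scal, plus; simpl; unfold mult; simpl. field. split; nra.
Qed.

Lemma Re_legendre_prim_bound s x : 0 < s -> 1 <= x -> Rabs (Re (legendre_prim 0 (RtoC s) x)) <= sqrt (2 * (x - 1)) * Rpower x s.
Proof. intros Hs Hx. eapply Rle_trans; [apply re_le_Cmod|]. now apply (legendre_prim_bound 0 (RtoC s) x). Qed.

Lemma dominating_prim_lim_1 s : 0 < s -> exists l : R, filterlim (dominating_prim s) (at_right 1) (locally l).
Proof.
  intros Hs. exists (dominating_prim s 1).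
  assert (C : continuous (dominating_prim s) 1).
  { unfold dominating_prim. apply rc_mult; [apply continuous_const|]. apply rc_plus.
    - apply rc_mult; [apply Rpower_cont; lra|]. apply (cut_integral_cont (cos_weight 0) (cos_weight_cont 0) (RtoC s) 1 Hs).
    - apply rc_mult; [apply continuous_const|]. apply (ex_derive_continuous (V := R_NormedModule)).
      eexists. apply (RInt_der (fun u => Rpower u (- s - 2) * Re (legendre_prim 0 (RtoC s) u)) 0); try lra.
      intros t Ht. now apply dom_prim_integrand_cont. }
  exact (filterlim_filter_le_1 _ (@filter_le_within _ (locally 1) _ _) C).
Qed.

Lemma dominating_prim_lim_poo s : 0 < s -> exists l : R, filterlim (dominating_prim s) poo (locally l).
Proof.
  intros Hs.
  set (f := fun u => Rpower u (- s - 2) * Re (legendre_prim 0 (RtoC s) u)).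
  (* The bound [sqrt (2 (x - 1)) x^s] on [legendre_prim] makes [f] at most [sqrt 2 x^(-3/2)], whose
     primitive is [- 2 sqrt 2 x^(-1/2)]. *)
  destruct (dominated_cauchy f (fun u => sqrt 2 * (/ u * / sqrt u)) (fun u => - 2 * sqrt 2 * / sqrt u) 1 poo 0) as [k Hk].
  - intros x Hx. apply dom_prim_integrand_cont; lra.
  - intros x Hx. apply (ex_derive_continuous (V := R_NormedModule)). auto_derive.
    pose proof (sqrt_lt_R0 x ltac:(lra)). repeat split; lra.
  - intros x Hx. pose proof (sqrt_lt_R0 x ltac:(lra)) as Hq. auto_derive; [repeat split; lra|].
    assert (E : sqrt x * sqrt x = x) by (apply sqrt_sqrt; lra).
    replace (/ x) with (/ (sqrt x * sqrt x)) by (now rewrite E). field. lra.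
  - intros x Hx. unfold f. rewrite Rabs_mult, (Rabs_pos_eq (Rpower _ _)) by (left; apply exp_pos).
    apply Rle_trans with (Rpower x (- s - 2) * (sqrt (2 * (x - 1)) * Rpower x s)).
    + apply Rmult_le_compat_l; [left; apply exp_pos|]. apply Re_legendre_prim_bound; lra.
    + replace (Rpower x (- s - 2) * (sqrt (2 * (x - 1)) * Rpower x s)) with (/ x * (sqrt (2 * (x - 1)) / x)).
      2:{ replace (- s - 2) with (- s + - (1 + 1)) by ring. rewrite Rpower_plus, !Rpower_Ropp, Rpower_plus, Rpower_1 by lra.
          field. split; first [lra | apply Rgt_not_eq, exp_pos]. }
      rewrite <- Rmult_assoc, (Rmult_comm (sqrt 2)), Rmult_assoc.
      apply Rmult_le_compat_l; [left; apply Rinv_0_lt_compat; lra|].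
      eapply Rle_trans; [apply sqrt_growth; lra|].
      rewrite sqrt_mult_alt by lra. rewrite sqrt_inv. lra.
  - apply poo_gt.
  - replace 0 with (- 2 * (sqrt (2 * / 1) * 0)) by ring.
    apply filterlim_ext_loc with (fun u => - 2 * (sqrt (2 * / 1) * sqrt (2 * / u) * / sqrt 2)).
    + exists 1. intros u Hu. rewrite Rinv_1, Rmult_1_r.
      rewrite (sqrt_mult_alt 2 (/ u)) by lra. rewrite sqrt_inv. field.
      split; apply Rgt_not_eq, sqrt_lt_R0; lra.
    + apply flim_mult; [apply filterlim_const|].
      replace (sqrt (2 * / 1) * 0) with (sqrt (2 * / 1) * 0 * / sqrt 2) by ring.
      apply flim_mult; [|apply filterlim_const]. apply flim_mult; [apply filterlim_const|apply lim_sqrt_inv].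
  - replace (1 + 1) with 2 in Hk by ring.
    exists (/ s * (0 + (s + 1) * k)). unfold dominating_prim. fold f.
    apply flim_mult; [apply filterlim_const|]. apply flim_plus.
    + apply flim_squeeze with (fun X => sqrt (2 * (X - 1)) / X); [|apply lim_sqrt_frac].
      exists 1. intros X HX. rewrite Rminus_0_r, Rabs_mult, (Rabs_pos_eq (Rpower _ _)) by (left; apply exp_pos).
      eapply Rle_trans; [apply Rmult_le_compat_l; [left; apply exp_pos|apply Re_legendre_prim_bound; lra]|].
      right. replace (- s - 1) with (- s + - (1)) by ring. rewrite Rpower_plus, !Rpower_Ropp, Rpower_1 by lra.
      field. split; [lra|apply Rgt_not_eq, exp_pos].
    + apply flim_mult; [apply filterlim_const|exact Hk].
Qed.

Lemma inc_core_legendre_core_bound n m b x : 0 < n -> 0 < Re b -> sin (n * PI) = 0 -> 1 < x ->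
  Cmod (inc_core n b x * legendre_core m b x)%C <= Cmod (b / RtoC n) * (PI * sinh PI) * dominating (Re b) x.
Proof.
  intros Hn Hb HnPI Hx. rewrite inc_core_eq by (auto; lra).
  rewrite !Cmod_mult. unfold dominating.
  assert (Hp : Re (- b - 1)%C = - Re b - 1) by apply (Re_opp_sub b 1).
  pose proof (sin_moment_bound n (- b - 1)%C x ltac:(lra) ltac:(lra)) as B1. rewrite Hp in B1.
  pose proof (legendre_core_bound m b x Hb Hx) as B2.
  rewrite <- Rmult_assoc.
  apply Rmult_le_compat; try apply Cmod_ge_0; auto.
  - apply Rmult_le_pos; apply Cmod_ge_0.
  - rewrite Rmult_assoc. apply Rmult_le_compat_l; [apply Cmod_ge_0|]. exact B1.
Qed.

(** * Series *)

Fixpoint csum (u : nat -> C) (N : nat) : C :=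
  match N with O => 0%C | S N => (u O + csum (fun k => u (S k)) N)%C end.

Lemma ex_series_Re (u : nat -> C) : ex_series (fun k => Cmod (u k)) -> ex_series (fun k => Re (u k)).
Proof.
  intros H. apply (ex_series_le (K := R_AbsRing) (V := R_CompleteNormedModule) _ (fun k => Cmod (u k))); [|exact H].
  intros k. apply re_le_Cmod.
Qed.
Lemma ex_series_Im (u : nat -> C) : ex_series (fun k => Cmod (u k)) -> ex_series (fun k => Im (u k)).
Proof.
  intros H. apply (ex_series_le (K := R_AbsRing) (V := R_CompleteNormedModule) _ (fun k => Cmod (u k))); [|exact H].
  intros k. apply Im_le_Cmod.
Qed.

Lemma CSeries_split u N : ex_series (fun k => Cmod (u k)) ->
  CSeries u = (csum u N + CSeries (fun k => u (N + k)%nat))%C.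
Proof.
  revert u. induction N as [|N IH]; intros u Hu.
  - simpl. rewrite Cplus_0_l. reflexivity.
  - assert (Hu' : ex_series (fun k => Cmod (u (S k)))) by (now apply (ex_series_incr_1 (fun k => Cmod (u k)))).
    change (csum u (S N)) with (u O + csum (fun k => u (S k)) N)%C.
    rewrite <- Cplus_assoc.
    transitivity (u O + CSeries (fun k => u (S k)))%C.
    + unfold CSeries. apply C_ext; simpl.
      * rewrite Series_incr_1; [reflexivity|now apply ex_series_Re].
      * rewrite Series_incr_1; [reflexivity|now apply ex_series_Im].
    + f_equal. exact (IH (fun k => u (S k)) Hu').
Qed.

Lemma CSeries_Cmult c u : ex_series (fun k => Cmod (u k)) ->
  CSeries (fun k => c * u k)%C = (c * CSeries u)%C.
Proof.
  intros H.
  pose proof (ex_series_Re u H) as H1. pose proof (ex_series_Im u H) as H2.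
  unfold CSeries. apply C_ext.
  - change (Series (fun k => Re c * Re (u k) - Im c * Im (u k)) =
      Re c * Series (fun k => Re (u k)) - Im c * Series (fun k => Im (u k))).
    rewrite Series_minus, !Series_scal_l; auto;
    now apply (ex_series_scal (V := R_NormedModule)).
  - change (Series (fun k => Re c * Im (u k) + Im c * Re (u k)) =
      Re c * Series (fun k => Im (u k)) + Im c * Series (fun k => Re (u k))).
    rewrite Series_plus, !Series_scal_l; auto;
    now apply (ex_series_scal (V := R_NormedModule)).
Qed.

(** The pairing with the conjugate of the sum, as for integrals: [|z|^2] is the sum of
    [Re (conj z * u k)], hence at most [|z|] times the sum of moduli. *)
Lemma CSeries_le u : ex_series (fun k => Cmod (u k)) -> Cmod (CSeries u) <= Series (fun k => Cmod (u k)).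
Proof.
  intros H. set (z := CSeries u).
  assert (Hpos : 0 <= Series (fun k => Cmod (u k))).
  { replace 0 with (Series (fun k => 0 * Cmod (u k))) by (rewrite Series_scal_l; ring).
    apply Series_le; [|exact H]. intros k. pose proof (Cmod_ge_0 (u k)). lra. }
  destruct (Req_dec (Cmod z) 0) as [Z|Z]; [lra|].
  assert (Hz : 0 < Cmod z) by (pose proof (Cmod_ge_0 z); lra).
  apply Rmult_le_reg_l with (Cmod z); [exact Hz|].
  replace (Cmod z * Cmod z) with (Re (Cconj z * z)%C)
    by (pose proof (Cmod2_alt z); unfold Re, Im in *; simpl in *; nra).
  unfold z at 2. rewrite <- CSeries_Cmult by exact H. unfold CSeries; simpl.
  rewrite <- Series_scal_l.
  assert (E : forall k, Rabs (Re (Cconj z * u k)%C) <= Cmod z * Cmod (u k)).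
  { intros k. eapply Rle_trans; [apply re_le_Cmod|]. rewrite Cmod_mult, Cmod_conj. lra. }
  assert (Hs : ex_series (fun k => Cmod z * Cmod (u k))) by (now apply (ex_series_scal (V := R_NormedModule))).
  eapply Rle_trans; [apply Rle_abs|].
  eapply Rle_trans; [apply Series_Rabs|].
  - apply (ex_series_le (K := R_AbsRing) (V := R_CompleteNormedModule) _ (fun k => Cmod z * Cmod (u k))); [|exact Hs].
    intros k. change (Rabs (Rabs (Re (Cconj z * u k)%C)) <= Cmod z * Cmod (u k)). rewrite Rabs_Rabsolu. apply E.
  - apply Series_le; [|exact Hs]. intros k. split; [apply Rabs_pos|apply E].
Qed.

Lemma Series_tail_small (c : nat -> R) : ex_series c -> forall eps, 0 < eps ->
  exists N0, forall N, (N0 <= N)%nat -> Series (fun k => c (N + k)%nat) < eps.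
Proof.
  intros H eps He. pose proof (Series_correct c H) as L. unfold is_series in L.
  destruct (proj1 (filterlim_locally _ _) L (mkposreal eps He)) as [N0 HN].
  (* The partial sum [sum_n c N] has [N + 1] terms, so the tail starting at [S N] belongs to it. *)
  exists (S N0). intros N HN'. destruct N as [|N]; [lia|].
  specialize (HN N ltac:(lia)).
  unfold_ball_in HN.
  rewrite sum_n_Reals in HN. apply Rabs_def2 in HN.
  rewrite (Series_incr_n c (S N)) in HN by (auto; lia). simpl pred in HN. lra.
Qed.

Lemma csum_ccont {T : UniformSpace} (h : nat -> T -> C) x N : (forall k, ccont (h k) x) ->
  ccont (fun t => csum (fun k => h k t) N) x.
Proof.
  revert h. induction N as [|N IH]; intros h H; simpl.
  - apply ccont_const.
  - apply ccont_plus; [apply H|]. apply (IH (fun k => h (S k))). intros; apply H.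
Qed.

Lemma is_CInt_gen_0 a : is_CInt_gen (fun _ => RtoC 0) (at_right a) poo (RtoC 0).
Proof.
  assert (E : (RtoC 0 - RtoC 0)%C = RtoC 0) by ring.
  pose proof (is_CInt_gen_FTC (fun _ => RtoC 0) (fun _ => RtoC 0) a (RtoC 0) (RtoC 0)) as F.
  rewrite E in F. apply F; clear F.
  - intros; apply cder_const.
  - intros; apply ccont_const.
  - apply clim_const.
  - apply clim_const.
Qed.

Lemma csum_is_CInt_gen (h : nat -> R -> C) l a N :
  (forall k, is_CInt_gen (h k) (at_right a) poo (l k)) ->
  is_CInt_gen (fun x => csum (fun k => h k x) N) (at_right a) poo (csum l N).
Proof.
  revert h l. induction N as [|N IH]; intros h l H; simpl.
  - apply is_CInt_gen_0.
  - refine (is_CInt_gen_plus _ _ _ _ _ _ (H O) _). apply (IH (fun k => h (S k)) (fun k => l (S k))). intros; apply H.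
Qed.

Lemma csum_single (u : nat -> C) k0 N : (forall k, k <> k0 -> u k = 0%C) -> (k0 < N)%nat -> csum u N = u k0.
Proof.
  revert u k0. induction N as [|N IH]; intros u k0 H HN; [lia|]. simpl.
  destruct k0 as [|k0].
  - assert (Z : forall N (v : nat -> C), (forall k, v k = 0%C) -> csum v N = 0%C).
    { clear. induction N as [|N IH]; intros v Hv; simpl; [reflexivity|]. rewrite Hv, IH; [ring|]. intros; apply Hv. }
    rewrite Z; [ring|]. intros k. apply H. lia.
  - rewrite (H O) by lia. rewrite (IH (fun k => u (S k)) k0); [ring| |lia]. intros k Hk. apply H. lia.
Qed.

(** The three-epsilon argument: the approximation error enters at [t] and at [x], the variation of
    [g] once. *)
Lemma ccont_uniform {T : UniformSpace} (f : T -> C) x :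
  (forall eps, 0 < eps -> exists g : T -> C, ccont g x /\ locally x (fun t => Cmod (f t - g t)%C <= eps)) ->
  ccont f x.
Proof.
  intros H.
  assert (L : forall eps : posreal, locally x (fun t => Cmod (f t - f x)%C < eps)).
  { intros eps. pose proof (cond_pos eps) as He.
    destruct (H (eps / 4) ltac:(lra)) as [g [Hg HL]].
    pose proof (locally_singleton _ _ HL) as Hx.
    assert (Hc : continuous (fun t => Cmod (g t - g x)%C) x).
    { apply ccont_Cmod. apply ccont_minus; [exact Hg|apply ccont_const]. }
    assert (He4 : 0 < eps / 4) by lra.
    pose proof (proj1 (filterlim_locally _ _) Hc (mkposreal _ He4)) as Hl.
    generalize (filter_and _ _ HL Hl). apply filter_imp. intros t [H1 H2].
    unfold_ball_in H2.
    replace (g x - g x)%C with (RtoC 0) in H2 by ring. rewrite Cmod_0, Ropp_0, Rplus_0_r in H2.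
    apply Rabs_def2 in H2.
    replace (f t - f x)%C with ((f t - g t) + ((g t - g x) + - (f x - g x)))%C by ring.
    eapply Rle_lt_trans; [apply Cmod_triangle|].
    eapply Rle_lt_trans; [apply Rplus_le_compat_l, Cmod_triangle|]. rewrite Cmod_opp. lra. }
  split; apply filterlim_locally; intros eps; (eapply filter_imp; [|apply (L eps)]); intros t Ht;
  simpl in Ht; unfold ball; simpl; unfold AbsRing_ball, abs, minus, plus, opp; simpl;
  (eapply Rle_lt_trans; [|exact Ht]).
  - apply (re_le_Cmod (f t - f x)%C).
  - apply (Im_le_Cmod (f t - f x)%C).
Qed.

Lemma is_CInt_gen_norm f (g : R -> R) a l (lg : R) : (forall x, a < x -> Cmod (f x) <= g x) ->
  is_CInt_gen f (at_right a) poo l -> is_RInt_gen g (at_right a) poo lg -> Cmod l <= lg.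
Proof.
  intros H Hf Hg.
  destruct (is_CInt_gen_scal (Cconj l) _ _ _ _ Hf) as [H1 _].
  assert (H2 := is_RInt_gen_scal (V := R_NormedModule) _ (Cmod l) _ Hg).
  assert (HL : Re (Cconj l * l)%C <= Cmod l * lg).
  { refine (is_RInt_gen_le _ _ a _ _ _ H1 H2). intros x Hx.
    eapply Rle_trans; [apply Rle_abs|]. eapply Rle_trans; [apply re_le_Cmod|].
    rewrite Cmod_mult, Cmod_conj. apply Rmult_le_compat_l; [apply Cmod_ge_0|]. now apply H. }
  replace (Re (Cconj l * l)%C) with (Cmod l * Cmod l) in HL
    by (pose proof (Cmod2_alt l); unfold Re, Im in *; simpl in *; nra).
  destruct (Req_dec (Cmod l) 0) as [Z|Z].
  - rewrite Z. apply is_RInt_gen_ge0 with g a; [|exact Hg]. intros x Hx.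
    eapply Rle_trans; [apply Cmod_ge_0|now apply H].
  - apply Rmult_le_reg_l with (Cmod l); [pose proof (Cmod_ge_0 l); lra|exact HL].
Qed.

(** * Termwise integration of a series with a common majorant *)

Section DominatedSeries.
Variables (c : nat -> C) (f : nat -> R -> C) (l : nat -> C) (a : R) (g G : R -> R) (la lb : R).
Hypotheses (Hc : ex_series (fun k => Cmod (c k)))
  (Hf : forall k (x : R), a < x -> ccont (f k) x)
  (Hg : forall x : R, a < x -> continuous g x)
  (HG : forall x, a < x -> is_derive G x (g x))
  (Hfg : forall k x, a < x -> Cmod (f k x) <= g x)
  (Ga : filterlim G (at_right a) (locally la)) (Gb : filterlim G poo (locally lb))
  (Hl : forall k, is_CInt_gen (f k) (at_right a) poo (l k)).

Let s (x : R) := CSeries (fun k => c k * f k x)%C.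

Lemma dseries_abs x : a < x -> ex_series (fun k => Cmod (c k * f k x)%C).
Proof.
  intros Hx. apply (ex_series_le (K := R_AbsRing) (V := R_CompleteNormedModule) _ (fun k => g x * Cmod (c k))).
  - intros k. change (Rabs (Cmod (c k * f k x)%C) <= g x * Cmod (c k)).
    rewrite Rabs_pos_eq by apply Cmod_ge_0. rewrite Cmod_mult, Rmult_comm.
    apply Rmult_le_compat_r; [apply Cmod_ge_0|]. now apply Hfg.
  - now apply (ex_series_scal (V := R_NormedModule)).
Qed.

(** The error splits into a factor depending only on [N] and the majorant [g x]. This one estimate
    yields local uniform convergence, hence continuity, and also the exchange of sum and
    integral. *)
Lemma dseries_tail x N : a < x ->
  Cmod (s x - csum (fun k => c k * f k x)%C N)%C <= Series (fun k => Cmod (c (N + k)%nat)) * g x.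
Proof.
  intros Hx. pose proof (dseries_abs x Hx) as H. unfold s. rewrite (CSeries_split _ N H).
  match goal with |- Cmod ?z <= _ => replace z with (CSeries (fun k => c (N + k)%nat * f (N + k)%nat x)%C) by ring end.
  assert (H' : ex_series (fun k => Cmod (c (N + k)%nat * f (N + k)%nat x)%C)).
  { now apply (ex_series_incr_n (fun k => Cmod (c k * f k x)%C)). }
  eapply Rle_trans; [now apply CSeries_le|].
  rewrite <- Series_scal_r. apply Series_le.
  - intros k. split; [apply Cmod_ge_0|]. rewrite Cmod_mult. apply Rmult_le_compat_l; [apply Cmod_ge_0|now apply Hfg].
  - apply (ex_series_scal_r (g x)). now apply (ex_series_incr_n (fun k => Cmod (c k))).
Qed.

Lemma dseries_bound x : a < x -> Cmod (s x) <= Series (fun k => Cmod (c k)) * g x.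
Proof.
  intros Hx. pose proof (dseries_tail x 0 Hx) as H. simpl in H.
  replace (s x - 0)%C with (s x) in H by ring. exact H.
Qed.

Lemma dseries_cont (x : R) : a < x -> ccont s x.
Proof.
  intros Hx. apply ccont_uniform. intros eps He.
  assert (Hg0 : 0 <= g x) by (eapply Rle_trans; [apply Cmod_ge_0|apply (Hfg O x Hx)]).
  (* Near [x] the continuous majorant stays below [g x + 1], so a tail below this quotient gives an
     error at most [eps] on a neighbourhood. *)
  destruct (Series_tail_small _ Hc (eps / (g x + 1))) as [N HN]; [apply Rdiv_lt_0_compat; lra|].
  specialize (HN N (Nat.le_refl N)).
  exists (fun t => csum (fun k => c k * f k t)%C N). split.
  - apply (csum_ccont (fun k t => c k * f k t)%C). intros k. apply ccont_mult; [apply ccont_const|now apply Hf].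
  - assert (L1 : locally x (fun t => a < t)) by (now apply (open_gt a x)).
    assert (L2 : locally x (fun t => g t < g x + 1)).
    { apply (Hg x Hx (fun y => y < g x + 1)). apply (open_lt (g x + 1) (g x)). lra. }
    generalize (filter_and _ _ L1 L2). apply filter_imp. intros t [H1 H2]. simpl in H1, H2.
    eapply Rle_trans; [now apply dseries_tail|].
    assert (0 <= g t) by (eapply Rle_trans; [apply Cmod_ge_0|apply (Hfg O t H1)]).
    assert (Hd : 0 <= eps / (g x + 1)) by (apply Rlt_le, Rdiv_lt_0_compat; lra).
    apply Rle_trans with (eps / (g x + 1) * (g x + 1)).
    + apply Rle_trans with (eps / (g x + 1) * g t); [apply Rmult_le_compat_r; lra|apply Rmult_le_compat_l; lra].
    + right. field. lra.
Qed.

Lemma dseries_is_CInt_gen : is_CInt_gen s (at_right a) poo (CInt_gen s (at_right a) poo).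
Proof.
  set (A := Series (fun k => Cmod (c k))).
  apply ex_CInt_gen_dominated with (g := fun x => A * g x) (G := fun x => A * G x) (la := A * la) (lb := A * lb).
  - apply dseries_cont.
  - intros x Hx. apply rc_mult; [apply continuous_const|auto].
  - intros x Hx. apply (is_derive_scal G x A). auto.
  - intros x Hx. now apply dseries_bound.
  - apply flim_mult; [apply filterlim_const|exact Ga].
  - apply flim_mult; [apply filterlim_const|exact Gb].
Qed.

Lemma dseries_abs_integrable (d : C) : ex_RInt_gen (fun x => Cmod (d * s x)%C) (at_right a) poo.
Proof.
  set (A := Cmod d * Series (fun k => Cmod (c k))).
  apply ex_RInt_gen_dominated with (g := fun x => A * g x) (G := fun x => A * G x) (la := A * la) (lb := A * lb).
  - intros x Hx. apply ccont_Cmod. apply ccont_mult; [apply ccont_const|now apply dseries_cont].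
  - intros x Hx. apply rc_mult; [apply continuous_const|auto].
  - intros x Hx. apply (is_derive_scal G x A). auto.
  - intros x Hx. rewrite Rabs_pos_eq by apply Cmod_ge_0. rewrite Cmod_mult. unfold A. rewrite Rmult_assoc.
    apply Rmult_le_compat_l; [apply Cmod_ge_0|]. now apply dseries_bound.
  - apply flim_mult; [apply filterlim_const|exact Ga].
  - apply flim_mult; [apply filterlim_const|exact Gb].
Qed.

(** A partial sum containing the index [k0] integrates to [c k0 * l k0] alone, and its distance to
    the full integral is at most the tail of the coefficients times the integral of [g]. *)
Lemma dseries_integral_single k0 : (forall k, k <> k0 -> l k = 0%C) ->
  is_CInt_gen s (at_right a) poo (c k0 * l k0)%C.
Proof.
  intros H0. pose proof dseries_is_CInt_gen as HI. set (I := CInt_gen s (at_right a) poo) in *.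
  assert (HgI : is_RInt_gen g (at_right a) poo (lb - la)) by (now apply is_RInt_gen_FTC with G).
  assert (Hpos : 0 <= lb - la).
  { apply is_RInt_gen_ge0 with g a; [|exact HgI]. intros x Hx. eapply Rle_trans; [apply Cmod_ge_0|apply (Hfg O x Hx)]. }
  assert (B : forall N, (k0 < N)%nat -> Cmod (I - c k0 * l k0)%C <= Series (fun k => Cmod (c (N + k)%nat)) * (lb - la)).
  { intros N HN.
    assert (Hs : is_CInt_gen (fun x => csum (fun k => c k * f k x)%C N) (at_right a) poo (csum (fun k => c k * l k)%C N)).
    { apply (csum_is_CInt_gen (fun k x => c k * f k x)%C). intros k. refine (is_CInt_gen_scal _ _ _ _ _ (Hl k)). }
    rewrite (csum_single (fun k => c k * l k)%C k0 N) in Hs; [|intros k Hk; rewrite H0 by exact Hk; ring|exact HN].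
    pose proof (is_CInt_gen_plus _ _ _ _ _ _ HI (is_CInt_gen_scal (- (1))%C _ _ _ _ Hs)) as HD.
    replace (I - c k0 * l k0)%C with (I + - (1) * (c k0 * l k0))%C by ring.
    refine (is_CInt_gen_norm _ (fun x => Series (fun k => Cmod (c (N + k)%nat)) * g x) a _ _ _ HD _).
    - intros x Hx. replace (s x + - (1) * csum (fun k => c k * f k x) N)%C with (s x - csum (fun k => c k * f k x)%C N)%C by ring.
      now apply dseries_tail.
    - apply (is_RInt_gen_scal (V := R_NormedModule) g _ _ HgI). }
  assert (E : I = (c k0 * l k0)%C).
  { apply Ceq_minus. apply Cmod_eq_0. apply Rle_antisym; [|apply Cmod_ge_0].
    apply Rnot_lt_le. intros Hn.
    set (z := Cmod (I - c k0 * l k0)%C) in *.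
    (* The added [1] avoids a division by zero when the integral [lb - la] of [g] vanishes. *)
    destruct (Series_tail_small _ Hc (z / (lb - la + 1))) as [N0 HN]; [apply Rdiv_lt_0_compat; lra|].
    specialize (HN (max N0 (S k0)) (Nat.le_max_l _ _)).
    specialize (B (max N0 (S k0)) (Nat.le_max_r _ _)).
    set (T := Series (fun k => Cmod (c (Nat.max N0 (S k0) + k)%nat))) in *.
    assert (T * (lb - la + 1) < z).
    { apply Rmult_lt_compat_r with (r := lb - la + 1) in HN; [|lra].
      unfold Rdiv in HN. rewrite Rmult_assoc, Rinv_l, Rmult_1_r in HN by lra. exact HN. }
    destruct (Rle_dec 0 T); [nra|]. nra. }
  rewrite <- E. exact HI.
Qed.

End DominatedSeries.

(** * The inversion formula *)

Lemma sin_INR_PI n : sin (INR n * PI) = 0.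
Proof. apply sin_eq_0_1. exists (Z.of_nat n). now rewrite INR_IZR_INZ. Qed.

Lemma sin_sin_int_diag n : (1 <= n)%nat -> sin_sin_int (INR n) (INR n) = PI / 2.
Proof.
  intros Hn. assert (H : 1 <= INR n) by (now apply (le_INR 1)). pose proof PI_RGT_0.
  unfold sin_sin_int. rewrite (RInt_FTC (fun t => t / 2 - sin (2 * (INR n * t)) / (4 * INR n))); [|lra| |].
  - rewrite !Rmult_0_r, sin_0, sin_2a, sin_INR_PI. eqR. field. lra.
  - intros t _. auto_derive; auto. rewrite cos_2a_sin. field. lra.
  - intros t _. rcont.
Qed.

Lemma sin_sin_int_offdiag n m : n <> m -> (1 <= n)%nat -> (1 <= m)%nat -> sin_sin_int (INR n) (INR m) = 0.
Proof.
  intros Hnm Hn Hm. assert (H : 1 <= INR n) by (now apply (le_INR 1)).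
  assert (H' : 1 <= INR m) by (now apply (le_INR 1)). pose proof PI_RGT_0.
  assert (Hd : INR n - INR m <> 0) by (intros E; apply Hnm, INR_eq; lra).
  unfold sin_sin_int.
  rewrite (RInt_FTC (fun t => sin ((INR n - INR m) * t) / (2 * (INR n - INR m))
     - sin ((INR n + INR m) * t) / (2 * (INR n + INR m)))); [|lra| |].
  - rewrite !Rmult_0_r, sin_0, Rmult_minus_distr_r, Rmult_plus_distr_r, sin_minus, sin_plus, !sin_INR_PI.
    eqR. field. split; lra.
  - intros t _. auto_derive; auto.
    replace ((INR n - INR m) * t) with (INR n * t - INR m * t) by ring.
    replace ((INR n + INR m) * t) with (INR n * t + INR m * t) by ring.
    rewrite cos_minus, cos_plus. field. split; lra.
  - intros t _. rcont.
Qed.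

Lemma ccosh_imag (t : R) n : ccosh (RtoC t * (nuc n + RtoC (1 / 2)))%C = RtoC (cos (INR n * t)).
Proof.
  unfold ccosh, nuc.
  replace (RtoC t * (((- (1 / 2))%R, INR n) + RtoC (1 / 2)))%C with ((0, INR n * t) : C)
    by (apply C_ext; simpl; field).
  unfold cexp; simpl. rewrite Ropp_0, exp_0, cos_neg, sin_neg.
  apply C_ext; simpl; field.
Qed.

Lemma sinh_arcosh_sqr x : 1 <= x -> x ^ 2 - 1 = sinh (arcosh x) * sinh (arcosh x).
Proof. intros H. pose proof (cosh_sqr (arcosh x)) as E. rewrite cosh_arcosh in E by exact H. lra. Qed.

Lemma sinh_arcosh_pos x : 1 < x -> 0 < sinh (arcosh x).
Proof. intros H. pose proof (arcosh_gt_0 x H). pose proof (sinh_ge_x (arcosh x)). lra. Qed.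

Lemma LegendreP_eq mu n x : Re mu < 1 / 2 -> 1 < x ->
  LegendreP mu (nuc n) x =
  (RtoC (sqrt (2 / PI)) * cpow (sinh (arcosh x)) mu / Gamma (RtoC (1 / 2) - mu)
   * legendre_core (INR n) (RtoC (1 / 2) - mu) x)%C.
Proof.
  intros Hmu Hx. unfold LegendreP. f_equal.
  assert (Hb : 0 < Re (RtoC (1 / 2) - mu)%C) by (simpl; unfold Re in *; lra).
  refine (is_CInt_gen_unique _ _ _ _ (is_CInt_gen_ext _ _ _ _ _ _ (legendre_integrand_is_CInt_gen (INR n) _ x Hb Hx))).
  apply filter_forall. intros ab t _. unfold legendre_integrand. rewrite ccosh_imag, cosh_arcosh by lra.
  f_equal. f_equal. apply C_ext; simpl; unfold Re, Im; field.
Qed.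

Lemma LegendreP_inc_eq mu n x :
  LegendreP_inc mu (nuc n) x PI =
  (RtoC (sqrt (2 / PI)) * Gamma (RtoC (1 / 2) - mu) * cpow (x ^ 2 - 1) (- mu / 2)
   / (Gamma (RtoC (1 / 2) + (0, INR n) - mu) * Gamma (RtoC (1 / 2) - (0, INR n) - mu))
   * inc_core (INR n) (RtoC (1 / 2) - mu) x)%C.
Proof.
  unfold LegendreP_inc, inc_core. pose proof PI_RGT_0. f_equal.
  - f_equal. f_equal; f_equal; apply C_ext; simpl; field.
  - apply CInt_ext; [lra|]. intros t _. rewrite ccosh_imag. f_equal. f_equal. ring.
Qed.

Lemma cpow_sinh_cancel mu x : 1 < x -> (cpow (x ^ 2 - 1) (- mu / 2) * cpow (sinh (arcosh x)) mu = 1)%C.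
Proof.
  intros Hx. pose proof (sinh_arcosh_pos x Hx) as Hs.
  rewrite sinh_arcosh_sqr by lra. rewrite cpow_mult, <- cpow_plus by assumption.
  replace (- mu / 2 + - mu / 2)%C with (- mu)%C by field. apply cpow_opp_inv.
Qed.

Theorem theorem1 (mu : C) (a : nat -> C) :
  Re mu < 1/2 ->
  ex_series (fun m => Cmod (a (S m))) ->
  forall n : nat, (1 <= n)%nat ->
    (* the inner series converges absolutely for every x > 1 *)
    (forall x : R, 1 < x ->
       ex_series (fun m => Cmod (a (S m) * LegendreP mu (nuc (S m)) x)%C)) /\
    (* the outer integral converges absolutely *)
    ex_RInt_gen
      (fun x => Cmod (LegendreP_inc mu (nuc n) x PI *
                      CSeries (fun m => a (S m) * LegendreP mu (nuc (S m)) x))%C)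
      (at_right 1) (Rbar_locally p_infty) /\
    a n =
      (RtoC (INR n / PI * sinh (PI * INR n)) *
       Gamma (RtoC (1/2) + (0, INR n) - mu) *
       Gamma (RtoC (1/2) - (0, INR n) - mu) *
       CInt_gen
         (fun x => LegendreP_inc mu (nuc n) x PI *
                   CSeries (fun m => a (S m) * LegendreP mu (nuc (S m)) x))
         (at_right 1) (Rbar_locally p_infty))%C.
Proof.
  intros Hmu Ha n Hn. pose proof PI_RGT_0 as HPI.
  set (b := (RtoC (1 / 2) - mu)%C).
  assert (Hb : 0 < Re b) by (unfold b; simpl; unfold Re in *; lra).
  assert (HnR : 1 <= INR n) by (now apply (le_INR 1)).
  assert (HSk : forall k, 0 < INR (S k)) by (intros k; apply lt_0_INR; lia).
  set (G1 := Gamma (RtoC (1/2) + (0, INR n) - mu)%C). set (G2 := Gamma (RtoC (1/2) - (0, INR n) - mu)%C).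
  assert (HG1 : G1 <> 0%C) by (apply Gamma_neq_0; simpl; unfold Re in *; lra).
  assert (HG2 : G2 <> 0%C) by (apply Gamma_neq_0; simpl; unfold Re in *; lra).
  assert (HG : Gamma b <> 0%C) by (now apply Gamma_neq_0).
  set (c := fun k => a (S k)).
  set (f := fun k x => (inc_core (INR n) b x * legendre_core (INR (S k)) b x)%C).
  set (l := fun k => (/ RtoC (INR n) * RtoC (PI / sinh (INR (S k) * PI) * sin_sin_int (INR n) (INR (S k))))%C).
  set (K0 := Cmod (b / RtoC (INR n)) * (PI * sinh PI)).
  destruct (dominating_prim_lim_1 (Re b) Hb) as [la Hla]. destruct (dominating_prim_lim_poo (Re b) Hb) as [lb Hlb].
  (* The constant left from the two Legendre prefactors: the square roots multiply to [2 / PI],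
     while [Gamma b] and the powers of [x^2 - 1] cancel. *)
  set (kap := (RtoC (2 / PI) / (G1 * G2))%C).
  assert (Hf : forall k (x : R), 1 < x -> ccont (f k) x).
  { intros k x Hx. apply ccont_mult; [|now apply legendre_core_cont].
    apply ccont_ext_loc with (fun x => b / RtoC (INR n) * sin_moment (INR n) (- b - 1) x)%C.
    - assert (L : locally x (fun t => 1 < t)) by (now apply (open_gt 1 x)).
      eapply filter_imp; [|exact L]. intros t Ht. simpl in Ht. symmetry. apply inc_core_eq; auto; try lra. apply sin_INR_PI.
    - apply ccont_mult; [apply ccont_const|apply sin_moment_cont; lra]. }
  assert (Hg : forall x : R, 1 < x -> continuous (fun x => K0 * dominating (Re b) x) x).
  { intros x Hx. apply rc_mult; [apply continuous_const|now apply dominating_cont]. }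
  assert (HGd : forall x, 1 < x -> is_derive (fun x => K0 * dominating_prim (Re b) x) x (K0 * dominating (Re b) x)).
  { intros x Hx. apply (is_derive_scal (dominating_prim (Re b)) x K0). now apply dominating_prim_der. }
  assert (Hfg : forall k x, 1 < x -> Cmod (f k x) <= K0 * dominating (Re b) x).
  { intros k x Hx. apply inc_core_legendre_core_bound; auto; try lra. apply sin_INR_PI. }
  assert (Ga : filterlim (fun x => K0 * dominating_prim (Re b) x) (at_right 1) (locally (K0 * la))).
  { apply flim_mult; [apply filterlim_const|exact Hla]. }
  assert (Gb : filterlim (fun x => K0 * dominating_prim (Re b) x) poo (locally (K0 * lb))).
  { apply flim_mult; [apply filterlim_const|exact Hlb]. }
  assert (Hl : forall k, is_CInt_gen (f k) (at_right 1) poo (l k)).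
  { intros k. apply inc_core_legendre_core_integral; auto; try lra. apply sin_INR_PI. }
  assert (Hseries : forall x, 1 < x -> ex_series (fun m => Cmod (a (S m) * legendre_core (INR (S m)) b x)%C)).
  { intros x Hx.
    apply (ex_series_le (K := R_AbsRing) (V := R_CompleteNormedModule) _ (fun k => Re (legendre_core 0 (RtoC (Re b)) x) * Cmod (a (S k)))).
    - intros k. change (Rabs (Cmod (a (S k) * legendre_core (INR (S k)) b x)%C) <= Re (legendre_core 0 (RtoC (Re b)) x) * Cmod (a (S k))).
      rewrite Rabs_pos_eq by apply Cmod_ge_0. rewrite Cmod_mult, Rmult_comm.
      apply Rmult_le_compat_r; [apply Cmod_ge_0|]. now apply legendre_core_bound.
    - now apply (ex_series_scal (V := R_NormedModule)). }
  (* The prefactors depend on [x] but not on the summation index, so they leave the series before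
     they cancel. *)
  assert (Hint : forall x, 1 < x ->
    (kap * CSeries (fun k => c k * f k x) =
     LegendreP_inc mu (nuc n) x PI * CSeries (fun m => a (S m) * LegendreP mu (nuc (S m)) x))%C).
  { intros x Hx.
    set (d := (RtoC (sqrt (2 / PI)) * cpow (sinh (arcosh x)) mu / Gamma b)%C).
    assert (E1 : CSeries (fun m => a (S m) * LegendreP mu (nuc (S m)) x)%C =
      (d * CSeries (fun m => a (S m) * legendre_core (INR (S m)) b x))%C).
    { rewrite <- CSeries_Cmult by now apply Hseries.
      unfold CSeries. f_equal; apply Series_ext; intros k; f_equal;
      rewrite LegendreP_eq by assumption; fold b; fold d; ring. }
    assert (E2 : CSeries (fun k => c k * f k x)%C =
      (inc_core (INR n) b x * CSeries (fun m => a (S m) * legendre_core (INR (S m)) b x))%C).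
    { rewrite <- CSeries_Cmult by now apply Hseries.
      unfold CSeries. f_equal; apply Series_ext; intros k; f_equal; unfold c, f; ring. }
    rewrite E1, E2, LegendreP_inc_eq. fold b G1 G2. unfold kap, d.
    assert (Esq : RtoC (2 / PI) = (RtoC (sqrt (2 / PI)) * RtoC (sqrt (2 / PI)))%C).
    { rewrite <- RtoC_mult, sqrt_sqrt; [reflexivity|]. apply Rlt_le, Rdiv_lt_0_compat; lra. }
    rewrite Esq.
    set (sg := CSeries _).
    transitivity (RtoC (sqrt (2 / PI)) * RtoC (sqrt (2 / PI)) / (G1 * G2) * (inc_core (INR n) b x * sg)
       * (cpow (x ^ 2 - 1) (- mu / 2) * cpow (sinh (arcosh x)) mu))%C.
    - rewrite cpow_sinh_cancel by exact Hx. ring.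
    - field. auto. }
  split; [|split].
  - intros x Hx.
    apply (ex_series_ext (fun m => Cmod (RtoC (sqrt (2 / PI)) * cpow (sinh (arcosh x)) mu / Gamma b)
       * Cmod (a (S m) * legendre_core (INR (S m)) b x)%C)).
    + intros k. rewrite LegendreP_eq by assumption. fold b. rewrite <- Cmod_mult. f_equal. ring.
    + apply (ex_series_scal (V := R_NormedModule)). now apply Hseries.
  - destruct (dseries_abs_integrable c f 1 (fun x => K0 * dominating (Re b) x) (fun x => K0 * dominating_prim (Re b) x)
      (K0 * la) (K0 * lb) Ha Hf Hg HGd Hfg Ga Gb kap) as [v Hv].
    exists v. refine (is_RInt_gen_ext _ _ _ _ Hv).
    apply ext_at_right_poo. intros x Hx. now rewrite Hint.
  (* The series runs over [a (S m)] from [m = 0], so the surviving term has index [n'] with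
     [n = S n']. *)
  - destruct n as [|n']; [lia|].
    assert (H0 : forall k, k <> n' -> l k = 0%C).
    { intros k Hk. unfold l. rewrite sin_sin_int_offdiag by lia. rewrite Rmult_0_r. ring. }
    pose proof (dseries_integral_single c f l 1 (fun x => K0 * dominating (Re b) x) (fun x => K0 * dominating_prim (Re b) x)
      (K0 * la) (K0 * lb) Ha Hf Hg HGd Hfg Ga Gb Hl n' H0) as HI.
    pose proof (is_CInt_gen_scal kap _ _ _ _ HI) as HJ.
    rewrite (is_CInt_gen_unique _ _ _ _ (is_CInt_gen_ext _ _ _ _ _ (ext_at_right_poo _ 1 Hint) HJ)).
    unfold kap, l, c. rewrite sin_sin_int_diag by lia.
    set (N := INR (S n')) in *.
    assert (Hsh : 0 < sinh (N * PI)) by (pose proof (sinh_ge_x (N * PI) ltac:(nra)); nra).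
    replace (RtoC (N / PI * sinh (PI * N)) * G1 * G2 *
      (RtoC (2 / PI) / (G1 * G2) * (a (S n') * (/ RtoC N * RtoC (PI / sinh (N * PI) * (PI / 2))))))%C
      with (RtoC (N / PI * sinh (PI * N)) * RtoC (2 / PI) * RtoC (/ N) * RtoC (PI / sinh (N * PI) * (PI / 2)) * a (S n'))%C.
    + rewrite <- !RtoC_mult.
      (* The value [PI / 2] of the diagonal sine integral makes the product of all constants equal
         to [1]. *)
      replace (N / PI * sinh (PI * N) * (2 / PI) * / N * (PI / sinh (N * PI) * (PI / 2))) with 1; [ring|].
      rewrite (Rmult_comm PI N). field. lra.
    + rewrite (RtoC_inv N) by lra. field.
      repeat split; auto. intros E; apply RtoC_inj in E; lra.
Qed.
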